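(* Let $V:\mathbb{R}^3\to\mathbb{R}$ be locally bounded, positive, with $V(\mathbf r)\to\infty$ as $|\mathbf r|\to\infty$. Let $g>0$, let $v_1:\mathbb{R}^3\to[0,\infty)$ be smooth, compactly supported, spherically symmetric, with scattering length $1$, fixed independently of $N$, and for $N\ge 2$ put $a=a_N=\frac{g}{4\pi N}$ and $v(\mathbf r)=v_N(\mathbf r)=a_N^{-2}\,v_1(\mathbf r/a_N)$. Let $\Psi_N^0$ be the (strictly positive, $C^1$) normalized ground state of $$H_N=\sum_{i=1}^N\bigl(-\Delta_i+V(\mathbf r_i)\bigr)+\sum_{1\le i<j\le N}v_N(\mathbf r_i-\mathbf r_j)$$ on symmetric wave functions in $L^2(\mathbb{R}^{3N})$, let $\rho_N=|\Psi_N^0|^2$ and $G_N=\rho_N\,d\mathbf r_1\cdots d\mathbf r_N$, with one-particle marginal $G_1^N$. Let $\rho_{GP}=|\phi_{GP}|^2$, where $\phi_{GP}$ is the minimizer of the Gross-Pitaevskii functional with parameter $g$, and let $G=\rho_{GP}\,d\mathbf r$ on $\mathbb{R}^3$. If $(G_N)$ is $G$-entropy chaotic, i.e. $G_1^N$ converges weakly to $G$ and $H(G_N)\to H(G)<+\infty$ as $N\to\infty$, then $G_1^N$ converges to $G$ in total variation, i.e. $\sup_{A\in\mathcal B(\mathbb{R}^3)}|G_1^N(A)-G(A)|\to0$ as $N\to\infty$.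
   Context: Units are $\hbar=2m=1$. Scattering length: for $v\ge 0$ smooth, radial and compactly supported, let $\phi_0$ solve $-\Delta\phi_0+\tfrac12 v\phi_0=0$ on $\mathbb{R}^3$ with $\phi_0(\mathbf r)\to1$ as $|\mathbf r|\to\infty$; outside the support of $v$ one has $\phi_0(\mathbf r)=1-a/|\mathbf r|$, and $a$ is the scattering length of $v$. Ground state: $\Psi_N^0$ minimizes $\int_{\mathbb{R}^{3N}}\bigl(\sum_i|\nabla_i\Psi|^2+\sum_iV(\mathbf r_i)|\Psi|^2+\sum_{i<j}v_N(\mathbf r_i-\mathbf r_j)|\Psi|^2\bigr)d\mathbf r_1\cdots d\mathbf r_N$ among permutation-symmetric $\Psi\in L^2(\mathbb{R}^{3N})$ with $\|\Psi\|_2=1$. Standing assumption: it exists, is unique up to a constant phase, and is strictly positive and continuously differentiable (after choice of phase). Gross-Pitaevskii functional: $E^{GP}[\phi]=\int_{\mathbb{R}^3}\bigl(|\nabla\phi|^2+V|\phi|^2+g|\phi|^4\bigr)d\mathbf r$, minimized subject to $\int|\phi|^2=1$; $\phi_{GP}$ denotes its strictly positive minimizer (unique up to phase). $G_1^N$ is the law of the first $\mathbb{R}^3$-coordinate under $G_N$. Entropy: for a probability measure $F$ on $(\mathbb{R}^{3})^N$ with density $f$ having finite $k$-th moment for some $k>0$, the entropy is $\hat H(F)=\int f\log f$, understood as $$\int\Bigl(\frac{f}{h_k}\log\frac{f}{h_k}-\frac{f}{h_k}+1\Bigr)h_k+\int f\log h_k,\qquad h_k=C_k\exp(-|\mathbf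 r_1|^k-\cdots-|\mathbf r_N|^k),$$ with $C_k$ a normalizing constant making $h_k$ a probability density. The normalized entropy is $H(F)=\frac1N\hat H(F)$ (so $H(G)=\int\rho_{GP}\log\rho_{GP}$). Entropy chaos presupposes that these entropies are defined. *)

(* Defs.v *)
From HB Require Import structures.
From mathcomp Require Import all_boot all_order all_algebra.
From mathcomp Require Import perm complex.
From mathcomp Require Import all_classical all_reals all_analysis.

Set Implicit Arguments.
Unset Strict Implicit.
Unset Printing Implicit Defensive.

Import Order.TTheory GRing.Theory Num.Theory.
Import numFieldNormedType.Exports.

Local Open Scope classical_set_scope.
Local Open Scope ring_scope.

(* A configuration of m particles in R^n is a matrix 'M[R]_(m, n) whose i-th
   row is the position of the i-th particle; in particular R^3 is 'rV[R]_3.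
   The library topology and norm on matrices are those of the sup norm; the
   Euclidean norm is enorm below. *)

(* The sigma-algebra generated by the entries. It is the Borel one. *)
Definition measure_matrix_display : measure_display.
Proof. by constructor. Qed.

Section measurable_matrix.
Context {R : realType}.
Variables m n : nat.

Definition mx_coords (k : 'I_(m * n)) (x : 'M[R]_(m, n)) : measurableTypeR R :=
  mxvec x ord0 k.

Let mx_set0 : g_sigma_preimage mx_coords set0.
Proof. exact: sigma_algebra0. Qed.

Let mx_setC A : g_sigma_preimage mx_coords A -> g_sigma_preimage mx_coords (~` A).
Proof. exact: sigma_algebraC. Qed.

Let mx_bigcup (F : _^nat) : (forall i, g_sigma_preimage mx_coords (F i)) ->
  g_sigma_preimage mx_coords (\bigcup_i (F i)).
Proof. exact: sigma_algebra_bigcup. Qed.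

HB.instance Definition _ :=
  @isMeasurable.Build measure_matrix_display 'M[R]_(m, n)
    (g_sigma_preimage mx_coords) mx_set0 mx_setC mx_bigcup.


Lemma measurable_mx_coords k : measurable_fun [set: 'M[R]_(m, n)] (mx_coords k).
Proof.
move=> _ Y mY; rewrite setTI; apply: sub_sigma_algebra => /=.
rewrite -bigcup_seq/=; exists k => /=; first by rewrite mem_index_enum.
by exists Y => //; rewrite setTI.
Qed.

Lemma measurable_mx_entry i j :
  measurable_fun [set: 'M[R]_(m, n)] (fun x => x i j : measurableTypeR R).
Proof.
rewrite (_ : (fun x => _) = mx_coords (mxvec_index i j)).
  exact: measurable_mx_coords.
by apply/funext => x; rewrite /mx_coords mxvecE.
Qed.

Definition mx_of_tuple (t : (m * n).-tuple (measurableTypeR R)) : 'M[R]_(m, n) :=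
  vec_mx (\row_k tnth t k).

Lemma measurable_mx_of_tuple : measurable_fun setT mx_of_tuple.
Proof.
have H : g_sigma_preimage (fun k => mx_coords k \o mx_of_tuple) `<=` measurable.
  rewrite (_ : (fun k => _) = (fun k => @tnth _ (measurableTypeR R) ^~ k)) //.
  by apply/funext => k; apply/funext => t; rewrite /= /mx_coords vec_mxK mxE.
rewrite g_sigma_preimage_comp in H => _ A mA; rewrite setTI; apply: H.
by exists A => //; rewrite setTI.
Qed.

End measurable_matrix.
Arguments mx_of_tuple {R m n}.

Section tuple_measure.
Context d (T : measurableType d) (R : realType).
Variable mu : {sigma_finite_measure set T -> \bar R}.

Definition tuple_cons n (p : T * n.-tuple T) : n.+1.-tuple T :=
  [the n.+1.-tuple T of p.1 :: p.2].

Lemma measurable_tuple_cons n : measurable_fun setT (@tuple_cons n).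
Proof. exact: (measurable_cons measurable_fst measurable_snd). Qed.

Section step.
Variables (n : nat) (nu : {sigma_finite_measure set (n.-tuple T) -> \bar R}).

Definition tuple_measure_step : set (n.+1.-tuple T) -> \bar R :=
  pushforward (mu \x nu)%E (@tuple_cons n).

Let step0 : tuple_measure_step set0 = 0%E.
Proof. by rewrite /tuple_measure_step /pushforward preimage_set0 measure0. Qed.

Let step_ge0 A : (0 <= tuple_measure_step A)%E.
Proof. exact: (measure_ge0 (mu \x nu)%E). Qed.

Let measurable_preimage_cons (A : set (n.+1.-tuple T)) :
  measurable A -> measurable (@tuple_cons n @^-1` A).
Proof.
by move=> mA; rewrite -[X in measurable X]setTI; exact: measurable_tuple_cons.
Qed.

Let step_sigma_additive : semi_sigma_additive tuple_measure_step.
Proof.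
move=> F mF tF mUF; rewrite /tuple_measure_step /pushforward preimage_bigcup.
apply: (@measure_semi_sigma_additive _ _ _ (mu \x nu)%E).
- by move=> k; exact: measurable_preimage_cons.
- apply/trivIsetP => /= i j _ _ ij; rewrite -preimage_setI.
  by move/trivIsetP : tF => /(_ _ _ _ _ ij) ->//; rewrite preimage_set0.
- by rewrite -preimage_bigcup; exact: measurable_preimage_cons.
Qed.

HB.instance Definition _ :=
  isMeasure.Build _ _ _ tuple_measure_step step0 step_ge0 step_sigma_additive.

Let step_sigma_finite : sigma_finite setT tuple_measure_step.
Proof.
have /sigma_finiteP[F [TF ndF Foo]] := sigma_finiteT mu.
have /sigma_finiteP[G [TG ndG Goo]] := sigma_finiteT nu.
pose u (t : n.+1.-tuple T) : T * n.-tuple T := (thead t, [tuple of behead t]).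
have mu_ : measurable_fun setT u.
  apply/measurable_fun_pair; first exact: measurable_tnth.
  exact: measurable_behead.
exists (fun k => u @^-1` (F k `*` G k)).
  rewrite -preimage_bigcup (_ : \bigcup_k _ = setT) ?preimage_setT//.
  rewrite -setXTT TF TG predeqE => -[x y]; split.
    by move=> [k _ []/= ? ?]; split; exists k.
  move=> [/= [k _ Fkx] [l _ Gly]]; exists (maxn k l) => //; split.
  - by move: x Fkx; exact/subsetPset/ndF/leq_maxl.
  - by move: y Gly; exact/subsetPset/ndG/leq_maxr.
move=> k; have [? ?] := Foo k; have [? ?] := Goo k; split.
  by rewrite -[X in measurable X]setTI; apply: mu_ => //; exact: measurableX.
rewrite /tuple_measure_step /pushforward -comp_preimage.
rewrite (_ : u \o _ = id); last first.
  by apply/funext => -[x t]; rewrite /u /tuple_cons /=; congr pair; exact/val_inj.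
by rewrite preimage_id product_measure1E// lte_mul_pinfty// ge0_fin_numE.
Qed.

HB.instance Definition _ :=
  Measure_isSigmaFinite.Build _ _ _ tuple_measure_step step_sigma_finite.

End step.

Fixpoint tuple_measure n : {sigma_finite_measure set (n.-tuple T) -> \bar R} :=
  if n is n'.+1 then tuple_measure_step (tuple_measure n')
  else dirac [tuple].

Lemma tuple_measure_box n (A : 'I_n -> set T) : (forall i, measurable (A i)) ->
  tuple_measure n [set t | forall i, A i (tnth t i)] =
  (\big[mule/1]_(i < n) mu (A i))%E.
Proof.
elim: n A => [|n IH] A mA /=.
  by rewrite big_ord0 diracE mem_set//= => -[].
rewrite big_ord_recl -(IH (fun i => A (lift ord0 i)))//.
rewrite [LHS](_ : _ = (mu \x tuple_measure n)%E
   (A ord0 `*` [set t | forall i, A (lift ord0 i) (tnth t i)])); last first.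
  rewrite /tuple_measure_step /pushforward /=.
  congr product_measure1; apply/seteqP; split => [[x t] /= H|[x t] /= [H0 H] i].
    split; first exact: (H ord0).
    by move=> i; have := H (lift ord0 i); rewrite tnthS.
  by case: (unliftP ord0 i) => [j ->|->]; rewrite ?tnthS//; exact: H.
rewrite product_measure1E// (_ : [set _ | _] = \bigcap_(i in [set: 'I_n])
    ((@tnth _ T ^~ i) @^-1` A (lift ord0 i))); last first.
  by apply/seteqP; split => t /= H i => [_|]; [exact: H|exact: (H i I)].
apply: fin_bigcap_measurable => [|i _]; first exact: finite_finset.
by rewrite -[X in measurable X]setTI; exact: measurable_tnth.
Qed.

End tuple_measure.

Section lebesgue_mx.
Context {R : realType} {m n : nat}.

Definition lebesgue_mx : set 'M[R]_(m, n) -> \bar R :=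
  pushforward (tuple_measure (@lebesgue_measure R) (m * n)) mx_of_tuple.

HB.instance Definition _ := Measure.copy lebesgue_mx
  (@measure_function_pushforward__canonical__measure_function_Measure _ _ _ _ _
    (tuple_measure (@lebesgue_measure R) (m * n)) mx_of_tuple
    (@measurable_mx_of_tuple R m n)).

Lemma lebesgue_mx_box (A : 'I_m -> 'I_n -> set (measurableTypeR R)) :
  (forall i j, measurable (A i j)) ->
  lebesgue_mx [set x | forall i j, A i j (x i j)] =
  (\big[mule/1]_(i < m) \big[mule/1]_(j < n) lebesgue_measure (A i j))%E.
Proof.
move=> mA; rewrite pair_bigA /=.

pose B k := let: (i, j) := enum_val (cast_ord (esym (mxvec_cast m n)) k) in A i j.
have BE i j : B (mxvec_index i j) = A i j.
  by rewrite /B /mxvec_index cast_ordK enum_rankK.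
transitivity (\big[mule/1]_(k < m * n) lebesgue_measure (B k))%E; last first.
  by rewrite (reindex _ (curry_mxvec_bij m n)); apply: eq_bigr => -[i j] _ /=;
    rewrite BE.
rewrite -tuple_measure_box; last first.
  by move=> k; case/mxvec_indexP: k => i j; rewrite BE.
rewrite /lebesgue_mx /pushforward; congr (tuple_measure _ _ _).
apply/seteqP; split => t /= H.
  move=> k; case/mxvec_indexP: k => i j; rewrite BE.
  by have := H i j; rewrite !mxE.
by move=> i j; have := H (mxvec_index i j); rewrite BE !mxE.
Qed.

End lebesgue_mx.

Section calculus.
Context {R : realType} {m n : nat}.
Implicit Types f : 'M[R]_(m, n) -> R.

Definition enorm (x : 'M[R]_(m, n)) : R :=
  Num.sqrt (\sum_i \sum_j x i j ^+ 2).

Definition at_infinity : set_system 'M[R]_(m, n) :=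
  [set P | exists M : R, forall x, M < enorm x -> P x].

#[global] Instance at_infinity_filter : Filter at_infinity.
Proof.
split; first by exists 0.
- move=> P Q [M PM] [M' QM']; exists (Num.max M M') => x.
  by rewrite gt_max => /andP[/PM Px /QM' Qx].
- by move=> P Q PQ [M PM]; exists M => x /PM /PQ.
Qed.

Definition partial (ij : 'I_m * 'I_n) f : 'M[R]_(m, n) -> R :=
  fun x => 'D_(delta_mx ij.1 ij.2) f x.

Definition iter_partial (s : seq ('I_m * 'I_n)) f := foldr partial f s.

Definition is_Ck (k : nat) f :=
  forall s, ((size s < k)%N ->
               forall ij x, derivable (iter_partial s f) x (delta_mx ij.1 ij.2)) /\
            ((size s <= k)%N -> continuous (iter_partial s f)).

Definition smooth f := forall k, is_Ck k f.

Definition laplacian f : 'M[R]_(m, n) -> R :=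
  fun x => \sum_ij iter_partial [:: ij; ij] f x.

Definition compactly_supported f :=
  exists2 K : set 'M[R]_(m, n), compact K & forall x, ~ K x -> f x = 0.

Definition locally_bounded f :=
  forall x : 'M[R]_(m, n), exists M : R, \forall y \near x, `|f y| <= M.

Definition spherically_symmetric f :=
  forall x y, enorm x = enorm y -> f x = f y.

Definition loc_integrable f :=
  measurable_fun setT f /\
  forall K, compact K -> lebesgue_mx.-integrable K (EFin \o f).

Definition weak_partial (ij : 'I_m * 'I_n) (f h : 'M[R]_(m, n) -> R) :=
  [/\ loc_integrable f, loc_integrable h &
      forall theta, smooth theta -> compactly_supported theta ->
        \int[lebesgue_mx]_x (f x * partial ij theta x) =
        - \int[lebesgue_mx]_x (h x * theta x)].

End calculus.

Section wave_functions.
Context {R : realType} {m n : nat}.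
Implicit Types Phi : 'M[R]_(m, n) -> R[i].

Definition normsq (z : R[i]) : R := complex.Re z ^+ 2 + complex.Im z ^+ 2.

Definition real_wave (psi : 'M[R]_(m, n) -> R) : 'M[R]_(m, n) -> R[i] :=
  fun x => (psi x)%:C%C.

Definition weak_gradient Phi (D : 'I_m * 'I_n -> 'M[R]_(m, n) -> R[i]) :=
  forall ij,
    weak_partial ij (fun x => complex.Re (Phi x)) (fun x => complex.Re (D ij x)) /\
    weak_partial ij (fun x => complex.Im (Phi x)) (fun x => complex.Im (D ij x)).

(* The integral of |grad Phi|^2 + W(x, |Phi|^2), with value +oo when Phi is not
   weakly differentiable; weak gradients being unique almost everywhere, the
   infimum is over at most one value. *)
Definition energy (W : 'M[R]_(m, n) -> R -> R) Phi : \bar R :=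
  ereal_inf [set e | exists2 D, weak_gradient Phi D &
    e = \int[lebesgue_mx]_x
          (\sum_ij normsq (D ij x) + W x (normsq (Phi x)))%:E]%E.

Definition normalized Phi :=
  [/\ measurable_fun setT (fun x => complex.Re (Phi x)),
      measurable_fun setT (fun x => complex.Im (Phi x)) &
      (\int[lebesgue_mx]_x (normsq (Phi x))%:E)%E = 1%E].

Definition permutation_symmetric Phi :=
  forall s : 'S_m, {ae lebesgue_mx, forall x, Phi (row_perm s x) = Phi x}.

Definition minimizer (A : set ('M[R]_(m, n) -> R[i]))
    (E : ('M[R]_(m, n) -> R[i]) -> \bar R) Phi :=
  A Phi /\ forall Phi', A Phi' -> (E Phi <= E Phi')%E.

End wave_functions.

Section physics.
Context {R : realType}.
Implicit Types (V v : 'rV[R]_3 -> R).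

(* Beyond the range of v one has phi0 = 1 - a/|x|. When the support of v is a
   shell, its hole must not count as "outside", phi0 being constant there. *)
Definition scattering_length v (a : R) :=
  exists phi0 : 'rV[R]_3 -> R,
    [/\ is_Ck 2 phi0,
        forall x, - laplacian phi0 x + 2^-1 * v x * phi0 x = 0,
        phi0 x @[x --> at_infinity] --> (1 : R) &
        forall rho : R, 0 <= rho -> (forall x, rho < enorm x -> v x = 0) ->
          forall x, rho < enorm x -> phi0 x = 1 - a / enorm x].

Definition gp_length (g : R) (N : nat) : R := g / (4 * pi * N%:R).

Definition gp_potential v (g : R) (N : nat) : 'rV[R]_3 -> R :=
  fun x => (gp_length g N) ^- 2 * v ((gp_length g N)^-1 *: x).

Definition many_body_potential V v (N : nat) (x : 'M[R]_(N, 3)) : R :=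
  \sum_(i < N) V (row i x) +
  \sum_(i < N) \sum_(j < N | (i < j)%N) v (row i x - row j x).

Definition many_body_energy V v (N : nat) : ('M[R]_(N, 3) -> R[i]) -> \bar R :=
  energy (fun x d => many_body_potential V v x * d).

Definition many_body_minimizer V v (N : nat) : ('M[R]_(N, 3) -> R[i]) -> Prop :=
  minimizer [set Phi | normalized Phi /\ permutation_symmetric Phi]
    (many_body_energy V v (N:=N)).

Definition ground_state V v (N : nat) (Psi : 'M[R]_(N, 3) -> R) :=
  [/\ many_body_minimizer V v (real_wave Psi),
      forall Phi, many_body_minimizer V v Phi ->
        exists2 c : R[i], normsq c = 1 &
          {ae lebesgue_mx, forall x, Phi x = c * real_wave Psi x},
      forall x, 0 < Psi x &
      is_Ck 1 Psi].

Definition gp_energy V (g : R) : ('rV[R]_3 -> R[i]) -> \bar R :=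
  energy (fun x d => V x * d + g * d ^+ 2).

Definition gp_minimizer V (g : R) (phi : 'rV[R]_3 -> R) :=
  minimizer [set Phi | normalized Phi] (gp_energy V g) (real_wave phi) /\
  forall x, 0 < phi x.

End physics.

Section chaos.
Context {R : realType}.

Definition density_law {m n : nat} (f : 'M[R]_(m, n) -> R) :
    set 'M[R]_(m, n) -> \bar R :=
  fun A => (\int[lebesgue_mx]_(x in A) (f x)%:E)%E.

Definition first_marginal {m n : nat} (G : set 'M[R]_(m.+1, n) -> \bar R) :
    set 'rV[R]_n -> \bar R :=
  pushforward G (row ord0).

Definition weakly_converges {n : nat} (P : nat -> set 'rV[R]_n -> \bar R)
    (Q : set 'rV[R]_n -> \bar R) :=
  forall f : 'rV[R]_n -> R, continuous f -> (exists M : R, forall x, `|f x| <= M) ->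
    (\int[P k]_x (f x)%:E)%E @[k --> \oo] --> (\int[Q]_x (f x)%:E)%E.

Definition tv_distance {n : nat} (P Q : set 'rV[R]_n -> \bar R) : \bar R :=
  ereal_sup [set (`|P A - Q A|)%E | A in measurable].

Section entropy.
Variables m n : nat.
Implicit Types f : 'M[R]_(m, n) -> R.

Definition finite_moment (k : R) f :=
  (\int[lebesgue_mx]_x (enorm x `^ k * f x)%:E < +oo)%E.

Definition entropy_weight (k : R) (x : 'M[R]_(m, n)) : R :=
  expR (- \sum_i enorm (row i x) `^ k).

Definition entropy_ref (k : R) (x : 'M[R]_(m, n)) : R :=
  (\int[lebesgue_mx]_y entropy_weight k y)^-1 * entropy_weight k x.

Definition entropy_of_order (k : R) f : \bar R :=
  (\int[lebesgue_mx]_x ((f x / entropy_ref k x * ln (f x / entropy_ref k x)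
                         - f x / entropy_ref k x + 1) * entropy_ref k x)%:E
   + \int[lebesgue_mx]_x (f x * ln (entropy_ref k x))%:E)%E.

(* The value does not depend on the order k of the finite moment. *)
Definition is_entropy f (h : \bar R) :=
  exists k : R, [/\ 0 < k, finite_moment k f & h = entropy_of_order k f].

Definition is_normalized_entropy f (h : \bar R) :=
  exists2 h', is_entropy f h' & h = ((m%:R)^-1%:E * h')%E.

End entropy.

(* The k-th law is that of k + 2 particles, so that N >= 2. *)
Definition entropy_chaotic (rho : forall k : nat, 'M[R]_(k.+2, 3) -> R)
    (rho_lim : 'rV[R]_3 -> R) :=
  weakly_converges (fun k => first_marginal (density_law (rho k)))
    (density_law rho_lim) /\
  exists (H : nat -> \bar R) (H_lim : \bar R),
    [/\ forall k, is_normalized_entropy (rho k) (H k),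
        is_normalized_entropy rho_lim H_lim,
        (H_lim < +oo)%E &
        H k @[k --> \oo] --> H_lim].

End chaos.

(* Main.v *)
(* The kinetic energy controls the one-particle marginals in a strong sense.
   Testing the energy on the product of a fixed bump function, and using that
   the integral of v_N is O(1/N), shows that the ground state energy is at most
   C N.  Hence the sum over all particles of |grad Psi|^2 integrates to at most
   C N, and, some particle carrying at most the average, permutation symmetry
   gives the translation estimate P_N(F) <= P_N(F(. + h)) + C |h| for the
   marginals P_N and all measurable 0 <= F <= 1, uniformly in N.  For continuous
   F it passes to the weak limit G.  Mollified at a small scale, P_N and G get
   densities that converge pointwise, hence in L^1 (Scheffe), while mollifying
   costs a uniformly small error.  This compares G(F) with P_N(F) uniformly over
   continuous F, and then over indicators, continuous functions being dense in
   L^1(P_N + G). *)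
Require Import Defs.
From HB Require Import structures.
From mathcomp Require Import all_boot all_order all_algebra.
From mathcomp Require Import perm complex.
From mathcomp Require Import all_classical all_reals all_analysis.
From mathcomp Require Import measurable_realfun ring lra.

Set Implicit Arguments.
Unset Strict Implicit.
Unset Printing Implicit Defensive.

Import Order.TTheory GRing.Theory Num.Theory.
Import numFieldNormedType.Exports.

Local Open Scope classical_set_scope.
Local Open Scope ring_scope.

(** * Lebesgue measure on matrices *)

(** Two obstacles shape the proof. First, [energy] is an infimum over weak gradients, whereas the
    translation estimate uses the classical derivatives of the C^1 ground state; identifying the two
    takes integration by parts and uniqueness of weak derivatives, hence a supply of smooth test
    functions, made here from exp(-1/x). Second, every constant must be independent of N, although
    the trial state lives in dimension 3N and its norm depends on N. Each trial estimate is
    therefore a ratio to the integral of the squared trial state, obtained on lines parallel to one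
    coordinate axis, where all other factors cancel. Increments of Psi^2 are integrals of 2 Psi
    dPsi, which is at most Psi^2 + (dPsi)^2 in absolute value, so that unit mass and bounded kinetic
    energy per particle are enough. The favourable particle may depend on the direction of the
    shift: symmetry carries its estimate to the first particle in any case. Inequalities of the form
    Q(A) <= P_N(A) + e suffice for total variation, since complements give the reverse ones. *)

Section matrix_measurability.
Context {R : realType} {m n : nat}.
Local Notation M := 'M[R]_(m, n).

(** The entries generate the sigma-algebra, so its preimage under [f] is generated by the preimages
    under the entries of [f]. *)
Lemma measurable_fun_mx d (T : measurableType d) (f : T -> M) :
  (forall i j, measurable_fun setT (fun x => f x i j : measurableTypeR R)) ->
  measurable_fun setT f.
Proof.
move=> mf; have H : g_sigma_preimage (fun k => @mx_coords R m n k \o f) `<=` measurable.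
  apply: smallest_sub; first exact: sigma_algebra_measurable.
  move=> A; rewrite -bigcup_seq /= => -[k _] [Y mY <-].
  case/mxvec_indexP: k => i j.
  rewrite (_ : mx_coords _ \o f = fun x => f x i j); first exact: mf.
  by apply/funext => x; rewrite /= /mx_coords mxvecE.
rewrite g_sigma_preimage_comp in H => _ A mA; rewrite setTI; apply: H.
by exists A => //; rewrite setTI.
Qed.

Definition mx_box (A : 'I_m -> 'I_n -> set (measurableTypeR R)) : set M :=
  [set x | forall i j, A i j (x i j)].

Lemma measurable_mx_box A : (forall i j, measurable (A i j)) -> measurable (mx_box A).
Proof.
move=> mA; rewrite (_ : mx_box A = \bigcap_(i in [set: 'I_m])
   \bigcap_(j in [set: 'I_n]) ((fun x : M => x i j) @^-1` A i j)); last first.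
  by apply/seteqP; split => x /= H i => [_ j _|j]; [exact: H|exact: (H i I j I)].
apply: fin_bigcap_measurable => [|i _]; first exact: finite_finset.
apply: fin_bigcap_measurable => [|j _]; first exact: finite_finset.
by rewrite -[X in measurable X]setTI; exact: measurable_mx_entry.
Qed.

(** The sigma-algebra comes from the entries and not from the topology, so an open set is exhibited
    as a countable union: the cubes with rational centre and radius [1/(k+1)] that it contains. *)
Lemma open_measurable_mx (U : set M) : open U -> measurable U.
Proof.
move=> oU.
pose B (p : 'M[rat]_(m, n) * nat) : set M :=
  mx_box (fun i j => ball (ratr (p.1 i j) : R) (p.2.+1%:R^-1)).
have mB p : measurable (B p).
  by apply: measurable_mx_box => i j; rewrite ball_itv; exact: measurable_itv.
rewrite (_ : U = \bigcup_(p in [set p | B p `<=` U]) B p); last first.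
  apply/seteqP; split => [x Ux|x [p /= BU]]; last exact: BU.
  have /nbhs_ballP[e /= e0 xeU] : nbhs x U by exact: open_nbhs_nbhs.
  (* Half of [e], because a point of the cube is within [1/(k+1)] of a centre that is itself that
     close to [x]. *)
  have [k ke] : exists k : nat, k.+1%:R^-1 < e / 2.
    have e20 : 0 < e / 2 by rewrite divr_gt0.
    by have [N _ HN] := near_infty_natSinv_lt (PosNum e20); exists N; exact: (HN N (leqnn N)).
  have /choice[q xq] : forall ij : 'I_m * 'I_n,
      exists q : rat, `|x ij.1 ij.2 - ratr q| < k.+1%:R^-1.
    move=> ij; move: (x ij.1 ij.2) => y; have h0 : 0 < k.+1%:R^-1 :> R by rewrite invr_gt0.
    move: (k.+1%:R^-1) h0 => d d0.
    have [|q] := @rat_in_itvoo R (y - d) (y + d); first by lra.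
    by rewrite in_itv /= => /andP[h1 h2]; exists q; rewrite ltr_norml; apply/andP; split; lra.
  exists (\matrix_(i, j) q (i, j), k); last first.
    by move=> i j /=; rewrite mxE /ball /= distrC; exact: (xq (i, j)).
  move=> y /= By; apply: xeU; split => // i j.
  have := By i j; have := xq (i, j); rewrite /= mxE /ball /= => h1 h2.
  rewrite (_ : x i j - y i j = (x i j - ratr (q (i, j))) + (ratr (q (i, j)) - y i j)); last ring.
  rewrite (le_lt_trans (ler_normD _ _))//.
  by apply: (lt_trans (ltrD h1 h2)); move: (k.+1%:R^-1) ke => d; lra.
rewrite bigcup_mkcond; apply: countable_bigcupT_measurable => // p.
by case: ifP.
Qed.

Lemma closed_measurable_mx (U : set M) : closed U -> measurable U.
Proof.
by move=> cU; rewrite -[U]setCK; apply: measurableC; apply: open_measurable_mx; exact/closed_openC.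
Qed.

Lemma continuous_measurable_mx (f : M -> R) : continuous f -> measurable_fun setT f.
Proof.
move=> cf; apply: (measurability _ (RGenOInfty.measurableE R)).
move=> _ [_ [x ->] <-]; rewrite setTI; apply: open_measurable_mx.
by move/continuousP : cf; apply; rewrite set_itvoy; exact: open_gt.
Qed.

Definition mx_boxes : set (set M) :=
  [set X | exists2 A : 'I_m -> 'I_n -> set (measurableTypeR R), (forall i j, measurable (A i j)) & X = mx_box A].

Lemma mx_boxesI : setI_closed mx_boxes.
Proof.
move=> _ _ [A mA ->] [B mB ->]; exists (fun i j => A i j `&` B i j).
  by move=> i j; exact: measurableI.
apply/seteqP; split => x /=; first by move=> [HA HB] i j; split; [exact: HA|exact: HB].
by move=> H; split=> i j; case: (H i j).
Qed.

Lemma measurable_mx_boxes : measurable = <<s mx_boxes >>.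
Proof.
apply/seteqP; split; last first.
  apply: smallest_sub; first exact: sigma_algebra_measurable.
  by move=> _ [A mA ->]; exact: measurable_mx_box.
apply: smallest_sub; first exact: smallest_sigma_algebra.
move=> A; rewrite -bigcup_seq /= => -[k _] [Y mY <-].
apply: sub_sigma_algebra.
case/mxvec_indexP: k => i0 j0.
exists (fun i j => if (i == i0) && (j == j0) then Y else setT).
  by move=> i j; case: ifP.
rewrite setTI; apply/seteqP; split => x /=.
  rewrite /mx_coords mxvecE => Yx i j; case: ifP => // /andP[/eqP-> /eqP->] //.
by rewrite /mx_coords mxvecE => /(_ i0 j0); rewrite !eqxx.
Qed.

Definition mx_cube (r : R) : set M := mx_box (fun _ _ => `[- r, r]%classic).

Lemma mx_cubeP r x : mx_cube r x <-> forall i j, `|x i j| <= r.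
Proof. by split => H i j; have := H i j; rewrite /= in_itv /= -ler_norml. Qed.

Lemma measurable_mx_cube r : measurable (mx_cube r).
Proof. by apply: measurable_mx_box => i j; exact: measurable_itv. Qed.

Lemma lebesgue_mx_cube_lty r : (lebesgue_mx (mx_cube r) < +oo)%E.
Proof.
have mulP (x y : \bar R) : (0 <= x < +oo -> 0 <= y < +oo -> 0 <= x * y < +oo)%E.
  by move=> /andP[x0 xoo] /andP[y0 yoo]; rewrite mule_ge0//= lte_mul_pinfty// ge0_fin_numE.
suff /andP[] : (0 <= lebesgue_mx (mx_cube r) < +oo)%E by [].
rewrite /mx_cube lebesgue_mx_box; last by move=> i j; exact: measurable_itv.
have P1 : (0 <= (1 : \bar R) < +oo)%E by rewrite lee_fin ler01 ltry.
apply: (big_ind (fun x => 0 <= x < +oo)%E) => // i _.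
apply: (big_ind (fun x => 0 <= x < +oo)%E) => // j _.
by rewrite measure_ge0/= lebesgue_measure_itv; case: ifP => _; rewrite /= ?ltry.
Qed.

Lemma norm_entry (x : M) i j : `|x i j| <= `|x|.
Proof.
by rewrite [leRHS]/Num.norm/= mx_normrE; apply/bigmax_geP; right; exists (i, j).
Qed.

Lemma mx_cube_cover : \bigcup_k (mx_cube k%:R) = setT.
Proof.
apply/seteqP; split => // x _; exists (Num.bound `|x|) => //.
apply/mx_cubeP => i j; rewrite (le_trans _ (ltW (archi_boundP _)))//.
exact: norm_entry.
Qed.

Lemma lebesgue_mx_sigma_finite : sigma_finite [set: M] (@lebesgue_mx R m n).
Proof.
exists (fun k => mx_cube k%:R); first by rewrite mx_cube_cover.
by move=> k; split; [exact: measurable_mx_cube|exact: lebesgue_mx_cube_lty].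
Qed.

HB.instance Definition _ := Measure_isSigmaFinite.Build _ _ _ (@lebesgue_mx R m n) lebesgue_mx_sigma_finite.

(** Boxes form a pi-system generating the sigma-algebra, and the cubes have finite measure and
    exhaust the space. Invariance under shifts and row permutations then only has to be checked on
    boxes. *)
Lemma lebesgue_mx_unique (nu : {measure set M -> \bar R}) :
  (forall A : 'I_m -> 'I_n -> set (measurableTypeR R),
    (forall i j, measurable (A i j)) ->
    nu (mx_box A) = (\big[mule/1]_(i < m) \big[mule/1]_(j < n) lebesgue_measure (A i j))%E) ->
  forall A, measurable A -> nu A = lebesgue_mx A.
Proof.
move=> H A mA; apply/esym.
apply: (measure_unique mx_boxes (fun k => mx_cube k%:R)) => //.
- exact: measurable_mx_boxes.
- exact: mx_boxesI.
- move=> k; exists (fun _ _ => `[- k%:R, k%:R]%classic) => // i j; exact: measurable_itv.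
- exact: mx_cube_cover.
- by move=> _ [B mB ->]; rewrite H// -lebesgue_mx_box.
- by move=> k; exact: lebesgue_mx_cube_lty.
Qed.

Lemma lebesgue_measure_shift (c : R) (A : set (measurableTypeR R)) : measurable A ->
  lebesgue_measure ((fun s => s + c) @^-1` A) = lebesgue_measure A.
Proof.
move=> mA.
have mf : measurable_fun setT (fun s : measurableTypeR R => s + c : measurableTypeR R).
  by apply: measurable_funD => //; exact: measurable_cst.
apply/esym; rewrite -[RHS]/(pushforward lebesgue_measure _ A).
apply: lebesgue_measure_unique => // _ [[a b] /= ab <-].
rewrite /pushforward (_ : _ @^-1` _ = `]a - c, b - c]%classic); last first.
  by apply/seteqP; split => s /=; rewrite !in_itv /= => /andP[h1 h2]; apply/andP; split; lra.
rewrite !lebesgue_measure_itv /= !lte_fin; case: ifPn => h; case: ifPn => h' //; last by exfalso; lra.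
- by congr (_%:E); ring.
- exfalso; lra.
Qed.

Lemma measurable_mx_shift (c : M) : measurable_fun setT (fun x : M => x + c).
Proof.
apply: measurable_fun_mx => i j; rewrite (_ : (fun x => _) = fun x : M => x i j + c i j); last first.
  by apply/funext => x; rewrite mxE.
by apply: measurable_funD; [exact: measurable_mx_entry|exact: measurable_cst].
Qed.

Lemma lebesgue_mx_shift (c : M) A : measurable A ->
  pushforward (@lebesgue_mx R m n) (fun x => x + c) A = lebesgue_mx A.
Proof.
have mc := measurable_mx_shift c.
move=> mA; apply: (lebesgue_mx_unique (nu := pushforward lebesgue_mx (fun x => x + c))) => // B mB.
rewrite -[LHS]/(lebesgue_mx ((fun x => x + c) @^-1` mx_box B)).
rewrite (_ : _ @^-1` _ = mx_box (fun i j => (fun s => s + c i j) @^-1` B i j)); last first.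
  by apply/seteqP; split => x /= H i j; have := H i j; rewrite !mxE.
rewrite lebesgue_mx_box => [|i j].
  by apply: eq_bigr => i _; apply: eq_bigr => j _; exact: lebesgue_measure_shift.
have mi : measurable_fun setT (fun s : measurableTypeR R => s + c i j : measurableTypeR R).
  by apply: measurable_funD => //; exact: measurable_cst.
by rewrite -[X in measurable X]setTI; exact: mi.
Qed.

Lemma measurable_row_perm (s : 'S_m) : measurable_fun setT (@row_perm R m n s).
Proof.
apply: measurable_fun_mx => i j; rewrite (_ : (fun x => _) = fun x : M => x (s i) j); last first.
  by apply/funext => x; rewrite mxE.
exact: measurable_mx_entry.
Qed.

Lemma lebesgue_mx_row_perm (s : 'S_m) A : measurable A ->
  pushforward (@lebesgue_mx R m n) (row_perm s) A = lebesgue_mx A.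
Proof.
have ms := measurable_row_perm s.
move=> mA; apply: (lebesgue_mx_unique (nu := pushforward lebesgue_mx (row_perm s))) => // B mB.
rewrite -[LHS]/(lebesgue_mx (row_perm s @^-1` mx_box B)).
rewrite (_ : _ @^-1` _ = mx_box (fun i j => B (s^-1 i)%g j)); last first.
  apply/seteqP; split => x /= H i j.
    by have := H (s^-1 i)%g j; rewrite !mxE permKV.
  by have := H (s i) j; rewrite !mxE permK.
rewrite lebesgue_mx_box => [|i j]; last exact: mB.
rewrite (reindex_inj (@perm_inj _ s)) /=.
by apply: eq_bigr => i _; apply: eq_bigr => j _; rewrite permK.
Qed.

Lemma ge0_integral_mx_shift (c : M) (f : M -> \bar R) : measurable_fun setT f ->
  (forall x, 0 <= f x)%E ->
  (\int[lebesgue_mx]_x f (x + c)%R = \int[lebesgue_mx]_x f x)%E.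
Proof.
move=> mf f0; have mc := measurable_mx_shift c.
transitivity (\int[pushforward (@lebesgue_mx R m n) (fun x : M => (x + c)%R)]_x f x)%E.
  by rewrite (ge0_integral_pushforward mc)// => y _; exact: f0.
by apply: eq_measure_integral => A mA _; exact: lebesgue_mx_shift.
Qed.

Lemma ge0_integral_row_perm (s : 'S_m) (f : M -> \bar R) : measurable_fun setT f ->
  (forall x, 0 <= f x)%E ->
  (\int[lebesgue_mx]_x f (row_perm s x) = \int[lebesgue_mx]_x f x)%E.
Proof.
move=> mf f0; have ms := measurable_row_perm s.
transitivity (\int[pushforward lebesgue_mx (row_perm s)]_x f x)%E.
  by rewrite (ge0_integral_pushforward ms)// => y _; exact: f0.
by apply: eq_measure_integral => A mA _; exact: lebesgue_mx_row_perm.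
Qed.

(** Flattening turns the cube into a product of segments indexed by [m * n]; [vec_mx] is continuous
    and carries compactness back. *)
Lemma compact_mx_cube r : compact (mx_cube r).
Proof.
have c1 : compact [set v : 'rV[R]_(m * n) | forall k, `[- r, r]%classic (v ord0 k)].
  by apply: (@rV_compact R _ (fun=> `[- r, r]%classic)) => k; exact: segment_compact.
rewrite (_ : mx_cube r = vec_mx @` [set v : 'rV[R]_(m * n) | forall k, `[- r, r]%classic (v ord0 k)]).
  apply: continuous_compact => //; apply: continuous_subspaceT => v.
  move=> /= A /nbhs_ballP[e /= e0 eA]; apply/nbhs_ballP; exists e => //= w [_ vw].
  by apply: eA; split => // i j; rewrite !mxE; exact: vw.
apply/seteqP; split => x /=.
  move=> H; exists (mxvec x); last by rewrite mxvecK.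
  by move=> k; case/mxvec_indexP: k => i j; rewrite mxvecE; exact: H.
by move=> [v H <-] i j; rewrite mxE; exact: H.
Qed.

Lemma compact_sub_mx_cube (K : set M) : compact K -> exists2 r, 0 < r & K `<=` mx_cube r.
Proof.
move=> /compact_bounded [r [_ Hr]]; exists (`|r| + 1); first by rewrite ltr_pwDr.
move=> x Kx; apply/mx_cubeP => i j.
have := Hr (`|r| + 1) (ltr_pwDr ltr01 (ler_norm r)) x Kx; apply: le_trans.
exact: norm_entry.
Qed.

Lemma continuous_bounded_cube (f : M -> R) r : continuous f ->
  exists2 C, 0 <= C & forall x, mx_cube r x -> `|f x| <= C.
Proof.
move=> cf; have : compact (f @` mx_cube r).
  by apply: continuous_compact; [exact: continuous_subspaceT|exact: compact_mx_cube].
move=> /compact_bounded [C [_ HC]]; exists (`|C| + 1); first by rewrite addr_ge0.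
by move=> x rx; apply: (HC (`|C| + 1) (ltr_pwDr ltr01 (ler_norm C))); exists x.
Qed.

End matrix_measurability.

Lemma measurable_row {R : realType} m n (i : 'I_m) : measurable_fun setT (@row R m n i).
Proof.
apply: measurable_fun_mx => i' j; rewrite (_ : (fun x => _) = fun x : 'M[R]_(m, n) => x i j); last first.
  by apply/funext => x; rewrite mxE.
exact: measurable_mx_entry.
Qed.

Section integral_monotone.
Context d (T : measurableType d) (R : realType) (mu : {measure set T -> \bar R}).

(* The integral of a non-negative function is a supremum over simple functions
   below it, so measurability plays no role. *)
Lemma ge0_le_integral_nonmeas (f g : T -> \bar R) : (forall x, 0 <= f x)%E ->
  (forall x, f x <= g x)%E -> (\int[mu]_x f x <= \int[mu]_x g x)%E.
Proof.
move=> f0 fg; have g0 x : (0 <= g x)%E by exact: le_trans (fg x).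
rewrite !ge0_integralTE//; apply: le_ereal_sup => _ /= [h hf <-]; exists h => //.
by move=> x; exact: le_trans (fg x).
Qed.

End integral_monotone.

(** * Calculus along a coordinate *)

Section lines.
Context {R : realType} {V : normedModType R}.
Implicit Types (f : V -> R) (x v : V).

(** On a line a directional derivative is an ordinary one. The mean value theorem and the
    fundamental theorem of calculus are brought to matrices through this equality of quotients. *)
Lemma line_quotient f x v s :
  (fun h : R => h^-1 *: (((fun t => f (x + t *: v)) \o shift s) (h *: 1) - f (x + s *: v))) =
  (fun h : R => h^-1 *: ((f \o shift (x + s *: v)) (h *: v) - f (x + s *: v))).
Proof.
apply/funext => h; rewrite /= /shift /=; congr (_ *: (f _ - _)).
by rewrite scalerDl [h *: 1]mulr1 addrCA.
Qed.

Lemma is_derive_line f x v s : derivable f (x + s *: v) v ->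
  is_derive s 1 (fun t => f (x + t *: v)) ('D_v f (x + s *: v)).
Proof.
move=> df; apply: DeriveDef; last by rewrite /derive line_quotient.
by rewrite /derivable line_quotient.
Qed.

Lemma is_derive_of_line f x v (df : R) :
  is_derive (0 : R) (1 : R) (fun t => f (x + t *: v)) df -> is_derive x v f df.
Proof.
move=> [h1 h2]; apply: DeriveDef.
  by move: h1; rewrite /derivable line_quotient scale0r addr0.
by move: h2; rewrite /derive line_quotient scale0r addr0.
Qed.

Lemma line_continuous x v : continuous (fun t : R => x + t *: v).
Proof. by move=> t; apply: cvgD; [exact: cvg_cst|apply: cvgZr_tmp; exact: cvg_id]. Qed.

(** The bound on [s] keeps the intermediate point in a slightly larger cube, for either sign of
    [t]. *)
Lemma line_MVT f x v t : (forall y, derivable f y v) ->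
  exists2 s, `|s| <= `|t| & f (x + t *: v) - f x = t * 'D_v f (x + s *: v).
Proof.
move=> df; pose g t := f (x + t *: v).
have dg s : is_derive s (1 : R) g ('D_v f (x + s *: v)) by exact: is_derive_line.
have cg : continuous g.
  by move=> s; apply/differentiable_continuous; rewrite -derivable1_diffP.
have -> : f x = g 0 by rewrite /g scale0r addr0.
rewrite -/(g t); have [t0|t0] := leP 0 t.
  have [|s] := @MVT_segment R g (fun s => 'D_v f (x + s *: v)) 0 t t0.
    exact: continuous_subspaceT.
  rewrite in_itv /= => /andP[s0 st] e; exists s; first by rewrite !ger0_norm.
  by rewrite e subr0 mulrC.
have [|s] := @MVT_segment R g (fun s => 'D_v f (x + s *: v)) t 0 (ltW t0).
  exact: continuous_subspaceT.
rewrite in_itv /= => /andP[ts s0] e; exists s.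
  by rewrite !ler0_norm ?lerN2// ltW.
by rewrite -opprB e sub0r mulrN opprK mulrC.
Qed.

(** Steps [1/(n+1)] make the derivative the limit of a sequence, the form in which dominated
    convergence applies. *)
Lemma derive_seq f x v : derivable f x v ->
  (n.+1%:R * (f (x + n.+1%:R^-1 *: v) - f x)) @[n --> \oo] --> 'D_v f x.
Proof.
move=> df.
have h0 : n.+1%:R^-1 @[n --> \oo] --> (0 : R)^'.
  move=> A [e /= e0 eA]; have [N _ HN] := near_infty_natSinv_lt (PosNum e0).
  exists N => // n /= Nn; apply: eA; last by rewrite invr_eq0 pnatr_eq0.
  by rewrite /ball_ /= sub0r normrN ger0_norm ?invr_ge0//; exact: (HN n Nn).
have := cvg_comp _ _ h0 df.
rewrite -/(derive f x v); apply: cvg_trans; apply: near_eq_cvg; near=> n.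
by rewrite /= invrK [_ *: v + x]addrC.
Unshelve. all: by end_near. Qed.

End lines.

(** * Integration by parts on matrices *)

Section matrix_calculus.
Context {R : realType} {m n : nat}.
Local Notation M := 'M[R]_(m, n).
Implicit Types (f theta : M -> R) (ij : 'I_m * 'I_n).
Local Notation mu := (@lebesgue_mx R m n).

Lemma delta_mx_entry_le1 i0 j0 i j : `|(delta_mx i0 j0 : M) i j| <= 1.
Proof. by rewrite mxE; case: (_ && _); rewrite ?normr1 ?normr0. Qed.

Lemma mx_cube_shift r s (x : M) i j : mx_cube r x -> mx_cube (r + `|s|) (x + s *: delta_mx i j).
Proof.
move=> /mx_cubeP H; apply/mx_cubeP => i' j'; rewrite !mxE (le_trans (ler_normD _ _))// lerD//.
have := delta_mx_entry_le1 i j i' j'; rewrite mxE normrM => h.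
by rewrite ler_piMr.
Qed.

(** Positive and negative parts are shifted separately, so integrability is not at stake. *)
Lemma integral_mx_shift (c : M) (f : M -> \bar R) : measurable_fun setT f ->
  (\int[mu]_x f (x + c)%R = \int[mu]_x f x)%E.
Proof.
move=> mf; rewrite integralE [in RHS]integralE.
have e1 := @ge0_integral_mx_shift R m n c (f^\+)%E (measurable_funepos mf) (funepos_ge0 f).
have e2 := @ge0_integral_mx_shift R m n c (f^\-)%E (measurable_funeneg mf) (funeneg_ge0 f).
congr (_ - _)%E; [rewrite -e1|rewrite -e2]; apply: eq_integral => x _.
  by rewrite !funepos.unlock.
by rewrite !funeneg.unlock.
Qed.

Lemma bounded_integrable f r (C : R) : measurable_fun setT f ->
  (forall x, `|f x| <= C) -> (forall x, ~ mx_cube r x -> f x = 0) ->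
  mu.-integrable setT (EFin \o f).
Proof.
move=> mf fC f0.
have mc : measurable (@mx_cube R m n r) by exact: measurable_mx_cube.
have : mu.-integrable (mx_cube r) (EFin \o f).
  apply: measurable_bounded_integrable => //.
  - exact: lebesgue_mx_cube_lty.
  - exact: measurable_funTS.
  - exists C; split; first exact: num_real.
    by move=> D CD x _ /=; rewrite (le_trans (fC x))// ltW.
move=> /(integrable_mkcond _ mc); congr (_.-integrable _ _).
apply/funext => x; rewrite /patch; case: ifPn => //=.
by move=> /negP; rewrite inE => /f0 ->.
Qed.

Lemma continuous_integrable f r : continuous f -> (forall x, ~ mx_cube r x -> f x = 0) ->
  mu.-integrable setT (EFin \o f).
Proof.
move=> cf f0; have [C C0 HC] := continuous_bounded_cube r cf.
apply: (@bounded_integrable _ r C) => //; first exact: continuous_measurable_mx.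
by move=> x; have [/HC//|/f0 ->] := pselect (mx_cube r x); rewrite normr0.
Qed.

Lemma open_mx_cubeC r : open (~` @mx_cube R m n r).
Proof.
apply: closed_openC; apply: compact_closed; last exact: compact_mx_cube.
exact: norm_hausdorff.
Qed.

Lemma partial_eq0 f ij r : (forall x, ~ mx_cube r x -> f x = 0) ->
  forall x, ~ mx_cube r x -> partial ij f x = 0.
Proof.
move=> f0 x xr; rewrite /partial (near_eq_derive (g := cst 0)) ?derive_cst//.
have : nbhs x (~` @mx_cube R m n r) by apply: open_nbhs_nbhs; split => //; exact: open_mx_cubeC.
by apply: filterS => y; exact: f0.
Qed.

(** Difference quotients integrate to 0 by translation invariance. They converge to the derivative
    and, by the mean value theorem, are dominated by its bound on a cube. *)
Lemma integral_partial_eq0 f ij r : continuous f ->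
  (forall x, derivable f x (delta_mx ij.1 ij.2)) -> continuous (partial ij f) ->
  (forall x, ~ mx_cube r x -> f x = 0) ->
  (\int[mu]_x (partial ij f x)%:E = 0)%E.
Proof.
move=> cf df cp f0; set E := delta_mx ij.1 ij.2 in df.
pose q k (x : M) : R := k.+1%:R * (f (x + k.+1%:R^-1 *: E) - f x).
have [C C0 HC] := continuous_bounded_cube (r + 1 + 1) cp.
have mf : measurable_fun setT f by exact: continuous_measurable_mx.
have k1 k : `|k.+1%:R^-1 : R| <= 1.
  by rewrite ger0_norm ?invr_ge0// invf_le1// ler1n.
have mfk k : measurable_fun setT (fun x : M => f (x + k.+1%:R^-1 *: E)).
  exact: (measurableT_comp mf (measurable_mx_shift _)).
have mq k : measurable_fun setT (q k).
  by apply: measurable_funM; [exact: measurable_cst|exact: measurable_funB].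
have sub0 (x : M) k : ~ mx_cube (r + 1) x -> q k x = 0.
  move=> xr; rewrite /q !f0 ?subr0 ?mulr0//.
    move=> xr'; apply: xr; move/mx_cubeP: xr' => xr'; apply/mx_cubeP => i j.
    by rewrite (le_trans (xr' i j))// lerDl.
  move=> xr'; apply: xr.
  have := @mx_cube_shift _ (- k.+1%:R^-1) _ ij.1 ij.2 xr'.
  rewrite scaleNr addrK normrN => /mx_cubeP H; apply/mx_cubeP => i j.
  by rewrite (le_trans (H i j))// lerD2l.
have qC (x : M) k : `|q k x| <= C * \1_(mx_cube (r + 1)) x.
  have [xr|xr] := pselect (mx_cube (r + 1) x); last first.
    by rewrite sub0// normr0 mulr_ge0.
  rewrite indicE mem_set// mulr1 /q.
  have [s sk ->] := line_MVT x k.+1%:R^-1 df.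
  rewrite mulrA divff ?pnatr_eq0// mul1r; apply: HC.
  have /mx_cubeP H := @mx_cube_shift _ s _ ij.1 ij.2 xr.
  apply/mx_cubeP => i j; rewrite (le_trans (H i j))// lerD2l.
  exact: le_trans sk (k1 k).
have ifE : mu.-integrable setT (EFin \o f) by exact: continuous_integrable f0.
have ifk k : mu.-integrable setT (EFin \o (fun x : M => f (x + k.+1%:R^-1 *: E))).
  apply: (continuous_integrable (r := r + 1)) => [x|x xr].
    exact: (cvg_comp _ _ (cvgD cvg_id (cvg_cst _)) (cf _)).
  rewrite f0// => xr'; apply: xr.
  have := @mx_cube_shift _ (- k.+1%:R^-1) _ ij.1 ij.2 xr'.
  rewrite scaleNr addrK normrN => /mx_cubeP H; apply/mx_cubeP => i j.
  by rewrite (le_trans (H i j))// lerD2l.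
have q0 k : (\int[mu]_(x in setT) (q k x)%:E = 0)%E.
  rewrite /q; under eq_integral do rewrite EFinM.
  rewrite integralZl//; last exact: (integrableB measurableT (ifk k) ifE).
  rewrite (integralB measurableT (ifk k) ifE) (@integral_mx_shift _ (EFin \o f)) ?subee ?mule0//; last exact/measurable_EFinP.
  exact: integrable_fin_num.
have mcube : measurable (@mx_cube R m n (r + 1)) by exact: measurable_mx_cube.
have [|||//||_ _] := @dominated_convergence _ _ _ mu setT measurableT
   (fun k x => (q k x)%:E) (fun x => (partial ij f x)%:E)
   (fun x => (C * \1_(mx_cube (r + 1)) x)%:E).
- by move=> k; exact/measurable_EFinP.
- by apply/measurable_EFinP; exact: continuous_measurable_mx.
- by apply: aeW => x _; apply: cvg_EFin; [exact: nearW|exact: (derive_seq (df x))].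
- apply: (bounded_integrable (r := r + 1) (C := C)).
  + by apply: measurable_funM; [exact: measurable_cst|exact: measurable_indic].
  + move=> x; rewrite indicE; case: (_ \in _); rewrite ?mulr1 ?mulr0 ?normr0//.
    by rewrite ger0_norm.
  + by move=> x xr; rewrite indicE memNset// mulr0.
- by apply: aeW => x k _; rewrite abse_EFin lee_fin.
rewrite (_ : [sequence _]_n = cst 0%E); last by apply/funext => k; exact: q0.
by move=> /cvg_lim <- //; rewrite lim_cst.
Qed.

Lemma continuous_loc_integrable f : continuous f -> loc_integrable f.
Proof.
move=> cf; have mf := continuous_measurable_mx cf; split => // K cK.
have [r r0 Kr] := compact_sub_mx_cube cK.
have mK : measurable K.
  by apply: closed_measurable_mx; apply: compact_closed => //; exact: norm_hausdorff.
have [C C0 HC] := continuous_bounded_cube r cf.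
apply: measurable_bounded_integrable => //.
- apply: le_lt_trans (@lebesgue_mx_cube_lty R m n r).
  by apply: le_measure => //; rewrite inE//; exact: measurable_mx_cube.
- exact: measurable_funTS.
- exists C; split; first exact: num_real.
  by move=> D CD x Kx /=; rewrite (le_trans (HC x (Kr x Kx)))// ltW.
Qed.

Lemma compactly_supported_cube f : compactly_supported f ->
  exists2 r, 0 < r & forall x, ~ mx_cube r x -> f x = 0.
Proof.
move=> [K cK f0]; have [r r0 Kr] := compact_sub_mx_cube cK; exists r => // x xr.
by apply: f0 => /Kr.
Qed.

Lemma smooth_continuous f : smooth f -> continuous f.
Proof. by move=> sf; have [_] := sf 0%N [::]; exact. Qed.

Lemma Ck1P f ij : is_Ck 1 f -> [/\ continuous f,
  forall x, derivable f x (delta_mx ij.1 ij.2) & continuous (partial ij f)].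
Proof.
move=> Cf; split.
- by have [_] := Cf [::]; exact.
- by have [+ _] := Cf [::]; move=> /(_ isT) H x; exact: (H ij x).
- by have [_] := Cf [:: ij]; exact.
Qed.

(** Integration by parts: the partial derivative of [f * theta] integrates to 0. *)
Lemma C1_weak_partial ij f : continuous f ->
  (forall x, derivable f x (delta_mx ij.1 ij.2)) -> continuous (partial ij f) ->
  weak_partial ij f (partial ij f).
Proof.
move=> cf df cp; split; [exact: continuous_loc_integrable..|].
move=> theta st ct; have [r r0 t0] := compactly_supported_cube ct.
have [cth dth cpth] : [/\ continuous theta, forall x, derivable theta x (delta_mx ij.1 ij.2)
  & continuous (partial ij theta)] by apply: Ck1P; exact: st.
have pE : partial ij (f * theta) = (fun x => f x * partial ij theta x) + (fun x => partial ij f x * theta x).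
  apply/funext => x; rewrite /partial deriveM//.
  by congr (_ + _); rewrite /GRing.scale /= mulrC.
have c1 : continuous (fun x => f x * partial ij theta x).
  by move=> x; exact: (cvgM (cf x) (cpth x)).
have c2 : continuous (fun x => partial ij f x * theta x).
  by move=> x; exact: (cvgM (cp x) (cth x)).
have i1 : mu.-integrable setT (EFin \o (fun x => f x * partial ij theta x)).
  apply: (continuous_integrable (r := r)) => // x xr.
  by rewrite (partial_eq0 _ t0)// mulr0.
have i2 : mu.-integrable setT (EFin \o (fun x => partial ij f x * theta x)).
  by apply: (continuous_integrable (r := r)) => // x xr; rewrite t0// mulr0.
apply/eqP; rewrite -addr_eq0 -RintegralD//; apply/eqP.
rewrite /Rintegral -[RHS]/(fine (0 : \bar R)); congr fine.
rewrite -[RHS](@integral_partial_eq0 (f * theta) ij r).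
- by apply: eq_integral => x _; rewrite pE.
- by move=> x; exact: (cvgM (cf x) (cth x)).
- by move=> x; exact: derivableM.
- by rewrite pE => x; exact: (cvgD (c1 x) (c2 x)).
- by move=> x xr; rewrite /= /GRing.mul /= t0// mulr0.
Qed.

End matrix_calculus.

(** * Smooth bump functions *)

Section smooth1.
Context {R : realType}.
Implicit Types (f g : R -> R) (p : {poly R}).

Lemma is_derive1_congr f g (x df dg : R) : is_derive x (1 : R) f df -> f = g -> df = dg ->
  is_derive x (1 : R) g dg.
Proof. by move=> h <- <-. Qed.

(** The derivatives are given as functions, so that sums, products and affine substitutions are
    treated by induction on [k]. *)
Fixpoint diffn k f : Prop :=
  if k is k'.+1 then
    exists2 f', (forall x : R, is_derive x (1 : R) f (f' x)) & diffn k' f'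
  else True.

Definition smooth1 f := forall k, diffn k f.

Lemma diffnW k f : diffn k.+1 f -> diffn k f.
Proof.
elim: k f => [//|k IH] f [f' df /IH ?]; by exists f'.
Qed.

Lemma diffnD k f g : diffn k f -> diffn k g -> diffn k (fun x => f x + g x).
Proof.
elim: k f g => [//|k IH] f g [f' df nf] [g' dg ng].
exists (fun x => f' x + g' x); last exact: IH.
by move=> x; apply: (@is_deriveD _ _ _ f g).
Qed.

Lemma diffnM k f g : diffn k f -> diffn k g -> diffn k (fun x => f x * g x).
Proof.
elim: k f g => [//|k IH] f g nf ng; case: (nf) => f' df nf'; case: (ng) => g' dg ng'.
exists (fun x => f x * g' x + g x * f' x).
  by move=> x; apply: (@is_deriveM _ _ f g).
by apply: diffnD; apply: IH => //; exact: diffnW.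
Qed.

Lemma diffn_cst k (c : R) : diffn k (fun=> c).
Proof.
elim: k c => [//|k IH] c; exists (fun=> 0); last exact: IH.
by move=> x; exact: is_derive_cst.
Qed.

Lemma diffn_affine k f (a b : R) : diffn k f -> diffn k (fun x => f (a * x + b)).
Proof.
elim: k f => [//|k IH] f [f' df nf']; exists (fun x => f' (a * x + b) * a).
  move=> x; apply: (@is_derive1_comp _ f (fun x => a * x + b)).
  have H : is_derive x (1 : R) (fun y : R => a * y + b) (a *: 1 + 0).
    exact: (@is_deriveD _ _ _ (a \*: id) (cst b)).
  by rewrite addr0 [_ *: _]mulr1 in H.
by apply: diffnM; [exact: IH|exact: diffn_cst].
Qed.

(** The witnesses in [diffn] may vary with the order, but derivatives are unique, so one function
    serves for all orders. *)
Lemma smooth1_derivative f : smooth1 f ->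
  exists2 f', (forall x : R, is_derive x (1 : R) f (f' x)) & smooth1 f'.
Proof.
move=> sf; have [f' df _] := sf 1%N; exists f' => // k.
have [f'' df2] := sf k.+1; rewrite (_ : f'' = f')//; apply/funext => x.
by rewrite -(@derive_val _ _ _ _ _ _ _ (df x)) -(@derive_val _ _ _ _ _ _ _ (df2 x)).
Qed.

(* This class is closed under derivation, see is_derive_invexp. *)
Definition invexp p (x : R) : R := if 0 < x then p.[x^-1] * expR (- x^-1) else 0.

(** Keeping the term of degree [i + 1] of the exponential series leaves a spare factor [1/y], which
    becomes the decay at 0 in [invexp_bound]. *)
Lemma expR_monomial_bound i (y : R) : 0 < y -> y ^+ i * expR (- y) <= (i.+1)`!%:R / y.
Proof.
move=> y0; have := @expR_ge1Dxn R y i (ltW y0) => h.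
have h2 : y ^+ i.+1 / (i.+1)`!%:R <= expR y by apply: le_trans h; rewrite lerDr.
rewrite expRN ler_pdivrMr ?expR_gt0//.
rewrite ler_pdivrMr ?ltr0n ?fact_gt0// in h2.
by rewrite mulrAC ler_pdivlMr// -exprSr mulrC (le_trans h2)// mulrC.
Qed.

Lemma invexp_bound p : exists2 C, 0 <= C & forall x, `|invexp p x| <= C * `|x|.
Proof.
exists (\sum_(i < size p) `|p`_i| * (i.+1)`!%:R).
  by apply: sumr_ge0 => i _; rewrite mulr_ge0.
move=> x; rewrite /invexp; case: ifPn => [x0|_]; last first.
  by rewrite normr0 mulr_ge0//; apply: sumr_ge0 => i _; rewrite mulr_ge0.
rewrite horner_coef mulr_suml (le_trans (ler_norm_sum _ _ _))// mulr_suml.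
apply: ler_sum => i _; rewrite -mulrA normrM -mulrA ler_wpM2l//.
have := @expR_monomial_bound i x^-1; rewrite invr_gt0 => /(_ x0).
by rewrite invrK (gtr0_norm x0) ger0_norm// mulr_ge0 ?exprn_ge0 ?expR_ge0 ?invr_ge0 ?ltW.
Qed.

(** With [y = 1/x], the chain rule gives [(p'(y) - p(y)) * (- y^2)] times [expR (- y)]; this is
    where the polynomial on the right comes from. *)
Lemma is_derive_invexp p (x : R) :
  is_derive x (1 : R) (invexp p) (invexp ('X^2 * (p - p^`())) x).
Proof.
have [x0|x0|<-] := ltgtP 0 x.
- rewrite /invexp x0.
  apply: (@near_eq_is_derive R R R (fun y => p.[y^-1] * expR (- y^-1))).
    by near=> y; rewrite ifT//; near: y; exact: lt_nbhsr.
  have dV : is_derive x (1 : R) (fun y : R => y^-1) (- x ^- 2).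
    apply: (is_derive1_congr (@is_deriveV _ id _ _ _ _ _)) => //; last by rewrite [_ *: _]mulr1.
    by rewrite gt_eqF.
  have dp : is_derive x (1 : R) (fun y : R => p.[y^-1]) (p^`().[x^-1] * - x ^- 2).
    by apply: (@is_derive1_comp _ (horner p) (fun y => y^-1)).
  have dN : is_derive x (1 : R) (fun y : R => - y^-1) (- - x ^- 2).
    by apply: (@is_deriveN _ _ _ (fun y : R => y^-1)).
  have de : is_derive x (1 : R) (fun y : R => expR (- y^-1)) (expR (- x^-1) * (- - x ^- 2)).
    by apply: (@is_derive1_comp _ expR (fun y => - y^-1)).
  apply: (is_derive1_congr (@is_deriveM _ _ _ _ _ _ _ _ dp de)) => //.
  by rewrite !hornerE /GRing.scale /= exprVn; ring.
- have -> : invexp ('X^2 * (p - p^`())) x = 0 by rewrite /invexp ifN// -leNgt ltW.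
  apply: (@near_eq_is_derive R R R (fun=> 0)).
    by near=> y; rewrite /invexp ifN// -leNgt ltW//; near: y; exact: lt_nbhsl.
(* At 0 the difference quotient of [invexp p] is [invexp ('X * p)], bounded by a multiple of [|h|],
   so the derivative is 0. *)
- have [C C0 HC] := invexp_bound ('X * p).
  have cvg0 : h^-1 *: ((invexp p \o shift 0) (h *: 1) - invexp p 0) @[h --> (0:R)^'] --> (0:R).
    apply/cvgrPdist_le => e e0; near=> h.
    rewrite sub0r normrN /shift /= addr0 {2}/invexp ltxx subr0 [h *: 1]mulr1.
    have -> : h^-1 *: invexp p h = invexp ('X * p) h.
      by rewrite /invexp; case: ifP => _; rewrite ?scaler0// !hornerE -mulrA.
    rewrite (le_trans (HC h))//.
    have h1 : `|h| <= e / (C + 1).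
      near: h; apply: dnbhs0_le.
      by rewrite divr_gt0// ltr_wpDl.
    have C1 : C / (C + 1) <= 1 by rewrite ler_pdivrMr ?ltr_wpDl// mul1r lerDl.
    rewrite (le_trans (ler_wpM2l C0 h1))// mulrCA ger_pMr//.
  apply: DeriveDef; first by apply/cvg_ex; exists 0.
  rewrite /derive; move/cvg_lim : cvg0 => -> //.
  by rewrite /invexp ltxx.
Unshelve. all: by end_near. Qed.

Lemma smooth1_invexp p : smooth1 (invexp p).
Proof.
move=> k; elim: k p => [//|k IH] p; exists (invexp ('X^2 * (p - p^`()))) => //.
by move=> x; exact: is_derive_invexp.
Qed.

(* As n grows this increases to the indicator of ]a, b[. *)
Definition smooth_bump (a b : R) (n : nat) (x : R) : R :=
  invexp 1 (n%:R * (x - a)) * invexp 1 (n%:R * (b - x)).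

Lemma invexp1_itv x : 0 <= invexp 1 x <= 1.
Proof.
rewrite /invexp; case: ifPn => [x0|_]; last by rewrite lexx ler01.
by rewrite hornerC mul1r expR_ge0 expR_le1 oppr_le0 invr_ge0 ltW.
Qed.

Lemma bump_itv a b n x : 0 <= smooth_bump a b n x <= 1.
Proof.
have /andP[h1 h2] := invexp1_itv (n%:R * (x - a)).
have /andP[h3 h4] := invexp1_itv (n%:R * (b - x)).
by rewrite /smooth_bump mulr_ge0//= mulr_ile1.
Qed.

Lemma smooth1_bump a b n : smooth1 (smooth_bump a b n).
Proof.
move=> k; apply: diffnM.
  rewrite (_ : (fun x => _) = fun x => invexp 1 (n%:R * x + - (n%:R * a))); last first.
    by apply/funext => x; rewrite mulrBr.
  by apply: diffn_affine; exact: smooth1_invexp.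
rewrite (_ : (fun x => _) = fun x => invexp 1 ((- n%:R) * x + n%:R * b)); last first.
  by apply/funext => x; congr invexp; ring.
by apply: diffn_affine; exact: smooth1_invexp.
Qed.

Lemma bump_eq0 a b n x : ~~ (a < x < b) -> smooth_bump a b n x = 0.
Proof.
rewrite negb_and -!leNgt /smooth_bump /invexp => /orP[h|h].
  by rewrite [X in X * _]ifN ?mul0r// -leNgt mulr_ge0_le0// subr_le0.
by rewrite [X in _ * X]ifN ?mulr0// -leNgt mulr_ge0_le0// subr_le0.
Qed.

Lemma cvg_invexp1 (t : R) : 0 < t -> invexp 1 (n%:R * t) @[n --> \oo] --> (1 : R).
Proof.
move=> t0.
have h : expR (- (t^-1 * n.+1%:R^-1)) @[n --> \oo] --> (1 : R).
  have h0 : - (t^-1 * n.+1%:R^-1) @[n --> \oo] --> (0 : R).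
    rewrite -oppr0; apply: cvgN; rewrite -(mulr0 t^-1).
    exact: (cvgM (cvg_cst _) (@cvg_harmonic R)).
  by have := cvg_comp _ _ h0 (@continuous_expR R 0); rewrite expR0.
rewrite -cvg_shiftS; apply: cvg_trans h; apply: near_eq_cvg; near=> n.
by rewrite /= /invexp mulr_gt0// hornerC mul1r invfM mulrC.
Unshelve. all: by end_near. Qed.

Lemma cvg_bump a b x : a < x < b -> smooth_bump a b n x @[n --> \oo] --> (1 : R).
Proof.
move=> /andP[ax xb]; rewrite -[X in _ --> X]mulr1; apply: cvgM.
  by apply: cvg_invexp1; rewrite subr_gt0.
by apply: cvg_invexp1; rewrite subr_gt0.
Qed.

End smooth1.

(** * Products of functions of one entry *)

Section tensor.
Context {R : realType} {m n : nat}.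
Local Notation M := 'M[R]_(m, n).
Implicit Types (b : 'I_m -> 'I_n -> R -> R).

Definition tensor b (x : M) : R := \prod_i \prod_j b i j (x i j).

(** Differentiating a product in one entry replaces one factor, so iterated partial derivatives of a
    [tensor] keep this form. Replacing a factor by the constant 1 removes it. *)
Definition upd b i0 j0 (c : R -> R) i j := if (i == i0) && (j == j0) then c else b i j.

Lemma tensorE b i0 j0 x : tensor b x = b i0 j0 (x i0 j0) *
  \prod_(i | i != i0) \prod_j b i j (x i j) * \prod_(j | j != j0) b i0 j (x i0 j).
Proof. by rewrite /tensor (bigD1 i0)//= (bigD1 j0)//= mulrAC. Qed.

Lemma tensor_updE b i0 j0 c x : tensor (upd b i0 j0 c) x = c (x i0 j0) *
  \prod_(i | i != i0) \prod_j b i j (x i j) * \prod_(j | j != j0) b i0 j (x i0 j).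
Proof.
rewrite (tensorE _ i0 j0) /upd !eqxx /=; congr (_ * _ * _).
  by apply: eq_bigr => i /negPf ii0; apply: eq_bigr => j _; rewrite ii0.
by apply: eq_bigr => j /negPf ->.
Qed.

Lemma is_derive_tensor b i0 j0 (b' : R -> R) x :
  (forall t : R, is_derive t (1 : R) (b i0 j0) (b' t)) ->
  is_derive x (delta_mx i0 j0) (tensor b) (tensor (upd b i0 j0 b') x).
Proof.
move=> db; apply: is_derive_of_line.
set c1 := \prod_(i | i != i0) \prod_j b i j (x i j).
set c2 := \prod_(j | j != j0) b i0 j (x i0 j).
rewrite (_ : (fun t => _) = (c1 * c2) \*: (fun t => b i0 j0 (x i0 j0 + t))); last first.
  apply/funext => t; rewrite (tensorE _ i0 j0) !mxE !eqxx mulr1 /=.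
  rewrite [RHS]mulrC mulrA; congr (_ * _ * _).
    by apply: eq_bigr => i /negPf ii0; apply: eq_bigr => j _; rewrite !mxE ii0 mulr0 addr0.
  by apply: eq_bigr => j /negPf jj0; rewrite !mxE jj0 andbF mulr0 addr0.
have -> : tensor (upd b i0 j0 b') x = (c1 * c2) *: (b' (x i0 j0 + 0) * 1).
  by rewrite tensor_updE addr0 mulr1 [RHS]mulrC mulrA.
apply: is_deriveZ; apply: (@is_derive1_comp _ (b i0 j0) (fun t => x i0 j0 + t)).
have H : is_derive (0 : R) (1 : R) (fun t : R => x i0 j0 + t) (0 + 1).
  exact: (@is_deriveD _ _ _ (cst (x i0 j0)) id).
by rewrite add0r in H.
Qed.

Lemma continuous_tensor b : (forall i j, continuous (b i j)) -> continuous (tensor b).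
Proof.
have cprod (I : finType) (F : I -> M -> R) : (forall i, continuous (F i)) ->
    continuous (fun x => \prod_i F i x).
  by move=> cF; apply: (@continuous_big R I _ _ _ (@mul_continuous R)) => i _; exact: cF.
move=> cb; apply: (cprod) => i; apply: (cprod) => j x.
exact: (cvg_comp _ _ (@coord_continuous R m n i j x) (cb i j _)).
Qed.

Lemma smooth1_continuous f : @smooth1 R f -> continuous f.
Proof.
move=> /smooth1_derivative[f' df _] x.
by apply/differentiable_continuous; rewrite -derivable1_diffP.
Qed.

Lemma smooth1_upd b i0 j0 c : (forall i j, smooth1 (b i j)) -> smooth1 c ->
  forall i j, smooth1 (upd b i0 j0 c i j).
Proof. by move=> sb sc i j; rewrite /upd; case: ifP. Qed.

Lemma tensor_partial b i0 j0 : (forall i j, smooth1 (b i j)) ->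
  exists2 b', forall i j, smooth1 (b' i j) &
    forall x, is_derive x (delta_mx i0 j0) (tensor b) (tensor b' x).
Proof.
move=> sb; have [c dc sc] := smooth1_derivative (sb i0 j0).
by exists (upd b i0 j0 c); [exact: smooth1_upd|move=> x; exact: is_derive_tensor].
Qed.

Lemma smooth_tensor b : (forall i j, smooth1 (b i j)) -> smooth (tensor b).
Proof.
move=> sb k s.
suff [b' sb' ->] : exists2 b', (forall i j, smooth1 (b' i j)) & iter_partial s (tensor b) = tensor b'.
  split=> [_ ij x|_]; last by apply: continuous_tensor => i j; exact: smooth1_continuous.
  by have [c _ dc] := tensor_partial ij.1 ij.2 sb'.
elim: s => [|ij s [b' sb' IH]] /=; first by exists b.
have [c sc dc] := tensor_partial ij.1 ij.2 sb'.
exists c => //; apply/funext => x; rewrite IH /partial.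
exact: derive_val.
Qed.

End tensor.

(** * Densities and uniqueness of weak derivatives *)

Section density_measure.
Local Open Scope ereal_scope.
Context d (T : measurableType d) (R : realType) (mu : {measure set T -> \bar R}).

Section def.
Variable f : T -> R.

(** The two facts are arguments so that the measure structure can be attached to the term itself. *)
Definition density_measure of measurable_fun setT f & (forall x, 0 <= f x)%R :=
  fun A => \int[mu]_(x in A) (f x)%:E.

Variables (mf : measurable_fun setT f) (f0 : forall x, (0 <= f x)%R).

Let dens0 : density_measure mf f0 set0 = 0.
Proof. by rewrite /density_measure integral_set0. Qed.

Let dens_ge0 A : 0 <= density_measure mf f0 A.
Proof. by apply: integral_ge0 => x _; rewrite lee_fin. Qed.

Let dens_sigma_additive : semi_sigma_additive (density_measure mf f0).
Proof.
move=> F mF tF mUF; rewrite /density_measure ge0_integral_bigcup//; last 2 first.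
- by apply: measurable_funTS; exact/measurable_EFinP.
- by move=> x _; rewrite lee_fin.
by apply: is_cvg_ereal_nneg_natsum => n _; exact: dens_ge0.
Qed.

HB.instance Definition _ := isMeasure.Build _ _ _ (density_measure mf f0)
  dens0 dens_ge0 dens_sigma_additive.

Import HBNNSimple.

(** Monotone convergence along simple functions reduces this to indicators of level sets, where it
    is the definition of the measure. *)
Lemma ge0_integral_density_measure (g : T -> \bar R) : measurable_fun setT g ->
  (forall x, 0 <= g x) ->
  \int[density_measure mf f0]_x g x = \int[mu]_x (g x * (f x)%:E).
Proof.
move=> mg g0; pose h := nnsfun_approx measurableT mg.
have hg x : (EFin \o h ^~ x) n @[n --> \oo] --> g x by apply: cvg_nnsfun_approx.
have hnd x a b : (a <= b)%N -> ((h a x)%:E <= (h b x)%:E)%E.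
  by move=> ab; rewrite lee_fin; exact/lefP/nd_nnsfun_approx.
have -> : \int[density_measure mf f0]_x g x =
    lim (\int[density_measure mf f0]_x (EFin \o h n) x @[n --> \oo]).
  rewrite -monotone_convergence//.
  - by apply: eq_integral => x _; apply/esym/cvg_lim => //; exact: hg.
  - by move=> n; exact/measurable_EFinP.
  - by move=> n x _; rewrite lee_fin.
  - by move=> x _ a b; exact: hnd.
have -> : \int[mu]_x (g x * (f x)%:E) = lim (\int[mu]_x ((EFin \o h n) x * (f x)%:E) @[n --> \oo]).
  rewrite -monotone_convergence//.
  - apply: eq_integral => x _; apply/esym/cvg_lim => //.
    by apply: cvgeZr => //; exact: hg.
  - move=> n; apply: emeasurable_funM; exact/measurable_EFinP.
  - by move=> n x _; rewrite mule_ge0// lee_fin.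
  - by move=> x _ a b ab; rewrite lee_wpmul2r ?lee_fin//; have := hnd x a b ab; rewrite lee_fin.
congr (lim (_ @ \oo)); apply/funext => n.
transitivity (\int[density_measure mf f0]_x
   (\sum_(y \in range (h n)) (y * \1_(h n @^-1` [set y]) x)%:E)).
  by apply: eq_integral => t tE; rewrite /= fimfunE -fsumEFin.
have indich m r : measurable_fun [set: T] (fun x => (r * \1_(h m @^-1` [set r]) x)%:E).
  by apply/measurable_EFinP; exact: measurable_funM.
rewrite ge0_integral_fsum//; last by move=> y x _; exact: nnfun_muleindic_ge0.
transitivity (\int[mu]_x (\sum_(y \in range (h n))
    (y * \1_(h n @^-1` [set y]) x)%:E * (f x)%:E)); last first.
  apply: eq_integral => x xE.
  rewrite -ge0_mule_fsuml => [|y]; last exact: nnfun_muleindic_ge0.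
  by rewrite fsumEFin // -(fimfunE _ x).
rewrite ge0_integral_fsum//; last 2 first.
  - by move=> y; apply: emeasurable_funM => //; exact/measurable_EFinP.
  - by move=> y x _; rewrite mule_ge0 ?lee_fin// -lee_fin nnfun_muleindic_ge0.
apply: eq_fsbigr => r; rewrite inE => -[t _ <-].
have mh : measurable (h n @^-1` [set h n t]) by [].
under eq_integral do rewrite EFinM.
rewrite ge0_integralZl//=; last 2 first.
  - exact/measurable_EFinP.
  - by rewrite lee_fin.
rewrite integral_indic// setIT.
under [RHS]eq_integral do rewrite EFinM -muleA.
rewrite ge0_integralZl//=; last 3 first.
  - by apply: emeasurable_funM; exact/measurable_EFinP.
  - by move=> x _; rewrite mule_ge0// lee_fin.
  - by rewrite lee_fin.
congr (_ * _); rewrite /density_measure integral_mkcond.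
apply: eq_integral => x _; rewrite /patch indicE.
by case: ifPn => _; rewrite ?mul1e ?mul0e.
Qed.

End def.
End density_measure.

Section weak_unique.
Context {R : realType} {m n : nat}.
Local Notation M := 'M[R]_(m, n).
Local Notation mu := (@lebesgue_mx R m n).
Implicit Types (a b : 'I_m -> 'I_n -> R).

(** Open boxes, because the products of bumps converge pointwise exactly to their indicators. *)
Definition mx_obox a b : set M := mx_box (fun i j => `]a i j, b i j[%classic).

Definition mx_oboxes : set (set M) := [set X | exists a b, X = mx_obox a b].

Lemma measurable_mx_obox a b : measurable (mx_obox a b).
Proof. by apply: measurable_mx_box => i j; exact: measurable_itv. Qed.

Lemma mx_oboxesI : setI_closed mx_oboxes.
Proof.
move=> _ _ [a [b ->]] [a' [b' ->]].
exists (fun i j => Num.max (a i j) (a' i j)), (fun i j => Num.min (b i j) (b' i j)).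
apply/seteqP; split => x /=.
  move=> [H1 H2] i j; have := H1 i j; have := H2 i j; rewrite /= !in_itv /=.
  by rewrite gt_max lt_min => /andP[-> ->] /andP[-> ->].
move=> H; split=> i j; have := H i j; rewrite /= !in_itv /= gt_max lt_min.
  by move=> /andP[/andP[-> _] /andP[-> _]].
by move=> /andP[/andP[_ ->] /andP[_ ->]].
Qed.

Lemma measurable_mx_oboxes : measurable = <<s mx_oboxes >>.
Proof.
apply/seteqP; split; last first.
  apply: smallest_sub; first exact: sigma_algebra_measurable.
  by move=> _ [a [b ->]]; exact: measurable_mx_obox.
apply: smallest_sub; first exact: smallest_sigma_algebra.
move=> A; rewrite -bigcup_seq /= => -[k _] [Y mY <-].
have mk : measurable_fun setT (@mx_coords R m n k : g_sigma_algebraType mx_oboxes -> measurableTypeR R).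
  apply: (measurability _ (RGenOInfty.measurableE R)).
  move=> _ [_ [c ->] <-]; rewrite setTI.
  case/mxvec_indexP: k => i0 j0.
  (* A half-space in one entry is a union of bounded open boxes, the other entries being confined to
     []-N, N[]. *)
  rewrite (_ : _ @^-1` _ = \bigcup_(N : nat) mx_obox
     (fun i j => if (i == i0) && (j == j0) then c else - N%:R) (fun i j => N%:R)).
    by apply: bigcupT_measurable => N; apply: sub_sigma_algebra; eexists; eexists.
  apply/seteqP; split => x /=; rewrite /mx_coords mxvecE in_itv/= andbT.
    move=> cx; exists (Num.bound `|x|) => // i j; rewrite /= in_itv /=.
    have xN : `|x i j| < (Num.bound `|x|)%:R.
      exact: le_lt_trans (norm_entry x i j) (archi_boundP _).
    move: xN; rewrite ltr_norml => /andP[h1 ->]; rewrite andbT.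
    by case: ifP => [/andP[/eqP -> /eqP ->]|].
  by move=> [N _ /(_ i0 j0)] /=; rewrite !eqxx in_itv /= => /andP[].
exact: (mk measurableT Y mY).
Qed.

Lemma tensor_bump_itv a b k (x : M) : 0 <= tensor (fun i j => smooth_bump (a i j) (b i j) k) x <= 1.
Proof.
have P (y z : R) : 0 <= y <= 1 -> 0 <= z <= 1 -> 0 <= y * z <= 1.
  by move=> /andP[y0 y1] /andP[z0 z1]; rewrite mulr_ge0//= mulr_ile1.
have P1 : 0 <= (1 : R) <= 1 by rewrite ler01 lexx.
apply: (big_ind (fun y => 0 <= y <= 1)) => // i _.
by apply: (big_ind (fun y => 0 <= y <= 1)) => // j _; exact: bump_itv.
Qed.

Lemma mx_obox_cube a b : exists2 r, 0 < r & mx_obox a b `<=` mx_cube r.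
Proof.
pose A : M := \matrix_(i, j) a i j; pose B : M := \matrix_(i, j) b i j.
have A0 : 0 <= `|A| by []. have B0 : 0 <= `|B| by [].
exists (`|A| + `|B| + 1); first by rewrite ltr_wpDl// addr_ge0.
move=> x H; apply/mx_cubeP => i j; have := H i j; rewrite /= in_itv /= => /andP[h1 h2].
have := norm_entry A i j; have := norm_entry B i j; rewrite !mxE !ler_norml.
by move=> /andP[h3 h4] /andP[h5 h6]; apply/andP; split; lra.
Qed.

Lemma notin_mx_obox a b (x : M) : ~ mx_obox a b x -> exists i j, ~~ (a i j < x i j < b i j).
Proof.
move=> xb; apply: contrapT => H; apply: xb => i j; rewrite /= in_itv /=.
by apply: contrapT => H2; apply: H; exists i, j; exact/negP.
Qed.

Lemma tensor_bump_eq0 a b k (x : M) : ~ mx_obox a b x ->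
  tensor (fun i j => smooth_bump (a i j) (b i j) k) x = 0.
Proof.
by move=> /notin_mx_obox[i [j xij]]; rewrite (tensorE _ i j) bump_eq0// !mul0r.
Qed.

Lemma cvg_tensor_bump a b (x : M) :
  tensor (fun i j => smooth_bump (a i j) (b i j) k) x @[k --> \oo] --> (\1_(mx_obox a b) x : R).
Proof.
have [xb|xb] := pselect (mx_obox a b x).
  rewrite indicE mem_set// /tensor.
  have -> : 1%:R = \prod_(i < m) \prod_(j < n) (1 : R) by rewrite big1// => i _; rewrite big1.
  apply: cvg_big => [|i _]; first exact: mul_continuous.
  apply: cvg_big => [|j _]; first exact: mul_continuous.
  by apply: cvg_bump; have := xb i j; rewrite /= in_itv.
rewrite indicE memNset//.
rewrite (_ : (fun k => _) = cst 0); first exact: cvg_cst.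
by apply/funext => k; rewrite tensor_bump_eq0.
Qed.

Lemma compactly_supported_of_cube (f : M -> R) r : (forall x, ~ mx_cube r x -> f x = 0) -> compactly_supported f.
Proof. by move=> f0; exists (mx_cube r); [exact: compact_mx_cube|]. Qed.

Lemma loc_integrable_mul (h t : M -> R) r : loc_integrable h -> continuous t ->
  (forall x, ~ mx_cube r x -> t x = 0) -> mu.-integrable setT (EFin \o (fun x => h x * t x)).
Proof.
move=> [mh ih] ct t0; have [C C0 HC] := continuous_bounded_cube r ct.
have mc : measurable (@mx_cube R m n r) by exact: measurable_mx_cube.
have ihr := ih _ (@compact_mx_cube R m n r).
have mt : measurable_fun setT t by exact: continuous_measurable_mx.
have : mu.-integrable (mx_cube r) (EFin \o (fun x => h x * t x)).
  apply: (le_integrable mc _ _ (integrableZl mc C (integrable_abse ihr))).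
    by apply: measurable_funTS; apply/measurable_EFinP; exact: measurable_funM.
  move=> x xr /=; rewrite !lee_fin normrM normrM normr_id (ger0_norm C0) mulrC.
  by rewrite ler_wpM2r// HC.
move=> /(integrable_mkcond _ mc); congr (_.-integrable _ _).
apply/funext => x; rewrite /patch; case: ifPn => //=.
by move=> /negP; rewrite inE => /t0 ->; rewrite mulr0.
Qed.

(* The difference of two weak derivatives integrates to 0 against products of
   bumps, hence over open boxes, which form a pi-system generating the
   sigma-algebra. *)
Lemma weak_partial_unique ij (f h h' : M -> R) :
  weak_partial ij f h -> weak_partial ij f h' -> {ae mu, forall x, h x = h' x}.
Proof.
move=> [_ lh wh] [_ lh' wh'].
pose q x := h x - h' x.
have mq : measurable_fun setT q by apply: measurable_funB; [case: lh|case: lh'].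
have lq : loc_integrable q.
  split=> // K cK.
  have mK : measurable K.
    by apply: closed_measurable_mx; apply: compact_closed => //; exact: norm_hausdorff.
  case: lh => _ /(_ K cK) i1; case: lh' => _ /(_ K cK) i2.
  exact: (integrableB mK i1 i2).
have q0 theta : smooth theta -> compactly_supported theta -> (\int[mu]_x (q x * theta x)%:E = 0)%E.
  move=> st ct; have [r r0 t0] := compactly_supported_cube ct.
  have cth := smooth_continuous st.
  have i1 := loc_integrable_mul lh cth t0; have i2 := loc_integrable_mul lh' cth t0.
  have := wh theta st ct; rewrite wh'// => /oppr_inj e.
  transitivity (\int[mu]_x ((h x * theta x)%:E - (h' x * theta x)%:E))%E.
    by apply: eq_integral => x _; rewrite -EFinB /q mulrBl.
  rewrite (integralB measurableT i1 i2).
  rewrite -[X in (X - _)%E]fineK; last exact: integrable_fin_num.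
  rewrite -[X in (_ - X)%E]fineK; last exact: integrable_fin_num.
  by rewrite -EFinB -[fine _]/(\int[mu]_x (h x * theta x)) -e subrr.
have qbox a b : (\int[mu]_x (q x * \1_(mx_obox a b) x)%:E = 0)%E.
  have [r r0 br] := mx_obox_cube a b.
  have t0 k x : ~ mx_cube r x -> tensor (fun i j => smooth_bump (a i j) (b i j) k) x = 0.
    by move=> xr; rewrite tensor_bump_eq0// => /br.
  pose th k : M -> R := tensor (fun i j => smooth_bump (a i j) (b i j) k).
  have sth k : smooth (th k) by apply: smooth_tensor => i j; exact: smooth1_bump.
  have mc : measurable (@mx_cube R m n r) by exact: measurable_mx_cube.
  have mth k : measurable_fun setT (th k).
    by apply: continuous_measurable_mx; exact: smooth_continuous.
  have [|||||_ _] := @dominated_convergence _ _ _ mu setT measurableT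
     (fun k x => (q x * th k x)%:E) (fun x => (q x * \1_(mx_obox a b) x)%:E)
     (fun x => (`|q x|%R * \1_(mx_cube r) x)%:E).
  - by move=> k; apply/measurable_EFinP; exact: measurable_funM.
  - apply/measurable_EFinP; apply: measurable_funM => //.
    by apply: measurable_indic; exact: measurable_mx_obox.
  - apply: aeW => x _; apply: cvg_EFin; first exact: nearW.
    by apply: cvgM; [exact: cvg_cst|exact: cvg_tensor_bump].
  - have [_ /(_ _ (@compact_mx_cube R m n r)) iq] := lq.
    have := (integrable_mkcond _ mc).1 (integrable_norm iq).
    congr (_.-integrable _ _); apply/funext => x; rewrite /patch indicE.
    by case: ifPn => _; rewrite ?mulr1 ?mulr0.
  - apply: aeW => x k _; rewrite abse_EFin lee_fin normrM ler_wpM2l// indicE.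
    have /andP[h0 h1] := tensor_bump_itv a b k x.
    have [xr|xr] := pselect (mx_cube r x).
      by rewrite mem_set// ger0_norm.
    by rewrite memNset// /th t0// normr0.
  rewrite (_ : [sequence _]_n = cst 0%E); last first.
    apply/funext => k; apply: q0 => //.
    exact: (compactly_supported_of_cube (t0 k)).
  by move=> /cvg_lim <- //; rewrite lim_cst.
(* [q] has no fixed sign, so uniqueness of measures is applied to the measures with densities its
   positive and negative parts. *)
pose qp x := Num.max (q x) 0; pose qn x := Num.max (- q x) 0.
have mqp : measurable_fun setT qp by apply: measurable_maxr => //; exact: measurable_cst.
have mqn : measurable_fun setT qn.
  by apply: measurable_maxr; [exact: measurableT_comp|exact: measurable_cst].
have qp0 x : 0 <= qp x by rewrite /qp le_max lexx orbT.
have qn0 x : 0 <= qn x by rewrite /qn le_max lexx orbT.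
have qE x : q x = qp x - qn x.
  rewrite /qp /qn; have [h0|h0] := leP 0 (q x).
    by rewrite max_r ?subr0 ?oppr_le0.
  by rewrite max_l ?sub0r ?opprK// oppr_ge0 ltW.
have qple x : qp x <= `|q x| by rewrite /qp ge_max ler_norm normr_ge0.
have qnle x : qn x <= `|q x| by rewrite /qn ge_max -normrN ler_norm normr_ge0.
pose m1 := density_measure mu mqp qp0; pose m2 := density_measure mu mqn qn0.
have iK r : mu.-integrable (@mx_cube R m n r) (EFin \o qp) /\ mu.-integrable (@mx_cube R m n r) (EFin \o qn).
  have mc : measurable (@mx_cube R m n r) by exact: measurable_mx_cube.
  have [_ /(_ _ (@compact_mx_cube R m n r)) iq] := lq.
  split; apply: (le_integrable mc _ _ iq); try (by apply: measurable_funTS; exact/measurable_EFinP).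
    by move=> x _; rewrite /= lee_fin ger0_norm.
  by move=> x _; rewrite /= lee_fin ger0_norm.
have ibox a b : mu.-integrable (mx_obox a b) (EFin \o qp) /\ mu.-integrable (mx_obox a b) (EFin \o qn).
  have [r r0 br] := mx_obox_cube a b; have [i1 i2] := iK r.
  split; [apply: integrableS br i1|apply: integrableS br i2];
    by [exact: measurable_mx_cube|exact: measurable_mx_obox].
have m12 A : mx_oboxes A -> m1 A = m2 A.
  move=> [a [b ->]]; have [i1 i2] := ibox a b.
  have mb := measurable_mx_obox a b.
  have := qbox a b.
  rewrite (_ : (\int[mu]_x _)%E = \int[mu]_(x in mx_obox a b) ((EFin \o qp) \- (EFin \o qn)) x)%E; last first.
    rewrite [RHS]integral_mkcond; apply: eq_integral => x _; rewrite /patch indicE qE.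
    by case: ifPn => _; rewrite ?mulr1 ?mulr0.
  rewrite integralB// => /eqP; rewrite sube_eq; last 2 first.
    - exact: integrable_fin_num.
    - by rewrite fin_num_adde_defl// integrable_fin_num.
  by rewrite add0e => /eqP.
have m12' A : measurable A -> m1 A = m2 A.
  apply: (measure_unique mx_oboxes (fun k => mx_obox (fun _ _ => - k%:R) (fun _ _ => k%:R))) => //.
  - exact: measurable_mx_oboxes.
  - exact: mx_oboxesI.
  - by move=> k; eexists; eexists.
  - apply/seteqP; split => // x _; exists (Num.bound `|x|) => // i j; rewrite /= in_itv /= -ltr_norml.
    exact: le_lt_trans (norm_entry x i j) (archi_boundP _).
  - move=> k; have [i1 _] := ibox (fun _ _ => - k%:R) (fun _ _ => k%:R).
    have := integrable_fin_num (measurable_mx_obox _ _) i1.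
    by rewrite ge0_fin_numE//; apply: integral_ge0 => x _; rewrite lee_fin.
(* Equality of all integrals gives equality almost everywhere where the densities are integrable,
   hence cube by cube. *)
have aek k : {ae mu, forall x, mx_cube k%:R x -> (EFin \o qp) x = (EFin \o qn) x}.
  have mc : measurable (@mx_cube R m n k%:R) by exact: measurable_mx_cube.
  apply: (integral_ae_eq mc) => //.
  - by have [] := iK k%:R.
  - by apply: measurable_funTS; exact/measurable_EFinP.
  - by move=> E _ mE; exact: m12'.
apply: filterS (ae_foralln aek) => x H.
have [k _ xk] : (\bigcup_k (@mx_cube R m n k%:R)) x by rewrite mx_cube_cover.
have [e] := H k xk.
by apply/eqP; rewrite -subr_eq0 -/(q x) qE e subrr.
Qed.

End weak_unique.

(** * Integration along lines *)

Section line_integrals.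
Context {R : realType} {m n : nat}.
Local Notation M := 'M[R]_(m, n).
Local Notation mu := (@lebesgue_mx R m n).
Local Notation leb := (@lebesgue_measure R).

Lemma integral_indic_itvcc (a b : R) : a <= b ->
  (\int[leb]_s (\1_(`[a, b]%classic : set (measurableTypeR R)) s)%:E = (b - a)%:E)%E.
Proof.
move=> ab; rewrite integral_indic//.
transitivity (lebesgue_measure (`[a, b]%classic : set (measurableTypeR R))).
  by rewrite setIT.
rewrite lebesgue_measure_itv /= lte_fin; case: ltP => [//|ba].
by rewrite (le_anti (introT andP (conj ab ba))) subrr.
Qed.

Lemma measurable_line (v : M) :
  measurable_fun setT (fun p : M * measurableTypeR R => p.1 + (p.2 : R) *: v).
Proof.
apply: measurable_fun_mx => i j.
rewrite (_ : (fun p => _) = (fun p : M * measurableTypeR R => p.1 i j + p.2 * v i j)); last first.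
  by apply/funext => p; rewrite !mxE.
apply: measurable_funD; first exact: (measurableT_comp (measurable_mx_entry i j) measurable_fst).
by apply: measurable_funM; [exact: measurable_snd|exact: measurable_cst].
Qed.

Lemma ge0_integral_lebesgue_shift (c : R) (f : R -> \bar R) :
  measurable_fun setT f -> (forall x, 0 <= f x)%E ->
  (\int[leb]_x f (x + c)%R = \int[leb]_x f x)%E.
Proof.
move=> mf f0.
have mc : measurable_fun setT (fun s : measurableTypeR R => s + c : measurableTypeR R).
  by apply: measurable_funD => //; exact: measurable_cst.
transitivity (\int[pushforward leb (fun s : measurableTypeR R => (s + c)%R : measurableTypeR R)]_x f x)%E.
  by rewrite (ge0_integral_pushforward mc)// => y _; exact: f0.
by apply: eq_measure_integral => A mA _; exact: lebesgue_measure_shift.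
Qed.

(** Tonelli, then translation invariance of the inner integral. *)
Lemma ge0_integral_lines (v : M) (k : R -> R) (F : M -> R) :
  measurable_fun setT k -> (forall s, 0 <= k s) ->
  measurable_fun setT F -> (forall x, 0 <= F x) ->
  (\int[mu]_x \int[leb]_s (k s * F (x + s *: v))%:E =
   (\int[leb]_s (k s)%:E) * \int[mu]_x (F x)%:E)%E.
Proof.
move=> mk k0 mF F0.
pose f (p : M * measurableTypeR R) := (k p.2 * F (p.1 + (p.2 : R) *: v))%:E.
have mf : measurable_fun setT f.
  apply/measurable_EFinP; apply: measurable_funM.
    exact: (measurableT_comp mk measurable_snd).
  exact: (measurableT_comp mF (measurable_line v)).
have f0 p : (0 <= f p)%E by rewrite lee_fin mulr_ge0.
rewrite -[LHS]/(\int[mu]_x \int[leb]_s f (x, s))%E (fubini_tonelli f mf f0).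
transitivity (\int[leb]_s ((k s)%:E * \int[mu]_x (F x)%:E))%E; last first.
  rewrite ge0_integralZr//.
  - exact/measurable_EFinP.
  - by move=> s _; rewrite lee_fin.
  - by apply: integral_ge0 => x _; rewrite lee_fin.
apply: eq_integral => s _; rewrite /f /=.
under eq_integral do rewrite EFinM.
rewrite ge0_integralZl//=.
- congr (_ * _)%E; apply: (ge0_integral_mx_shift (s *: v) (f := EFin \o F)) => //.
  by apply/measurable_EFinP.
- apply/measurable_EFinP; exact: (measurableT_comp mF (measurable_mx_shift _)).
- by move=> x _; rewrite lee_fin.
- by rewrite lee_fin.
Qed.

(* The window 1_[0,1](x i j) selects each line exactly once: shifting x by
   - s E leaves the integral of 1_[0,1](x i j - s) over s, which is 1. *)
Lemma integral_line_unit (ij : 'I_m * 'I_n) (F : M -> R) :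
  measurable_fun setT F -> (forall x, 0 <= F x) ->
  (\int[mu]_x (\int[leb]_s (F (x + s *: delta_mx ij.1 ij.2))%:E * (\1_(`[0%R, 1%R]%classic) (x ij.1 ij.2))%:E)
   = \int[mu]_x (F x)%:E)%E.
Proof.
case: ij => i j /= mF F0; set E := delta_mx i j.
pose I01 := \1_(`[0%R, 1%R]%classic : set (measurableTypeR R)) : R -> R.
have mI : measurable_fun setT I01 by apply: measurable_indic; exact: measurable_itv.
have I0 s : 0 <= I01 s by rewrite /I01 indicE.
pose f (p : M * measurableTypeR R) := (F (p.1 + (p.2 : R) *: E) * I01 (p.1 i j))%:E.
have mxij : measurable_fun setT (fun x : M => I01 (x i j)).
  exact: (measurableT_comp mI (measurable_mx_entry i j)).
have mf : measurable_fun setT f.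
  apply/measurable_EFinP; apply: measurable_funM.
    exact: (measurableT_comp mF (measurable_line E)).
  exact: (measurableT_comp mxij measurable_fst).
have f0 p : (0 <= f p)%E by rewrite lee_fin mulr_ge0.
pose g (p : M * measurableTypeR R) := (F p.1 * I01 (p.1 i j - (p.2 : R)))%:E.
have mg : measurable_fun setT g.
  apply/measurable_EFinP; apply: measurable_funM.
    exact: (measurableT_comp mF measurable_fst).
  apply: (measurableT_comp mI); apply: measurable_funB.
    exact: (measurableT_comp (measurable_mx_entry i j) measurable_fst).
  exact: measurable_snd.
have g0 p : (0 <= g p)%E by rewrite lee_fin mulr_ge0.
transitivity (\int[mu]_x \int[leb]_s f (x, s))%E.
  apply: eq_integral => x _; rewrite /f /=; under [RHS]eq_integral do rewrite EFinM.
  rewrite ge0_integralZr//.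
  - apply/measurable_EFinP; apply: (measurableT_comp mF).
    exact: (measurableT_comp (measurable_line E) (pair1_measurable x)).
  - by move=> s _; rewrite lee_fin.
  - by rewrite lee_fin.
rewrite (fubini_tonelli f mf f0).
transitivity (\int[leb]_s \int[mu]_x g (x, s))%E.
  apply: eq_integral => s _.
  rewrite -[RHS](ge0_integral_mx_shift (s *: E)) => [|//|x]; last first.
  - exact: g0.
  - exact: (measurableT_comp mg (pair2_measurable s)).
  apply: eq_integral => x _; rewrite /f /g /=; congr (_ * I01 _)%:E.
  by rewrite !mxE !eqxx mulr1 addrK.
rewrite -(fubini_tonelli g mg g0); apply: eq_integral => x _; rewrite /g /=.
under eq_integral do rewrite EFinM.
rewrite ge0_integralZl//; last 3 first.
- apply/measurable_EFinP; apply: (measurableT_comp mI).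
  by apply: measurable_funB; [exact: measurable_cst|exact: measurable_id].
- by move=> s _; rewrite lee_fin.
- by rewrite lee_fin.
rewrite (_ : (\int[_]_s _)%E = 1%E) ?mule1//.
rewrite (eq_integral (fun s => (\1_(`[x i j - 1, x i j]%classic : set (measurableTypeR R)) s)%:E)).
  by rewrite integral_indic_itvcc ?gerBl//; congr (_%:E); ring.
move=> s _; rewrite /I01 !indicE; congr (_%:R%:E); congr nat_of_bool.
apply/idP/idP; rewrite !inE /= !in_itv /= => /andP[h1 h2]; apply/andP; split; lra.
Qed.

(** A comparison on each line parallel to a coordinate axis integrates to a comparison on the whole
    space with the same constant, in every dimension. *)
Lemma line_integral_le (ij : 'I_m * 'I_n) (F G : M -> R) (C : R) : 0 <= C ->
  measurable_fun setT F -> (forall x, 0 <= F x) ->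
  measurable_fun setT G -> (forall x, 0 <= G x) ->
  (forall x, \int[leb]_s (F (x + s *: delta_mx ij.1 ij.2))%:E <=
     C%:E * \int[leb]_s (G (x + s *: delta_mx ij.1 ij.2))%:E)%E ->
  (\int[mu]_x (F x)%:E <= C%:E * \int[mu]_x (G x)%:E)%E.
Proof.
move=> C0 mF F0 mG G0 FG.
have mline (H : M -> R) : measurable_fun setT H -> (forall x, 0 <= H x) ->
  measurable_fun setT (fun x : M => \int[leb]_s (H (x + s *: delta_mx ij.1 ij.2))%:E * (\1_(`[0%R, 1%R]%classic) (x ij.1 ij.2))%:E)%E.
  move=> mH H0; apply: emeasurable_funM.
    apply: (measurable_fun_fubini_tonelli_F (fun p : M * measurableTypeR R => (H (p.1 + (p.2 : R) *: delta_mx ij.1 ij.2))%:E)).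
      by apply/measurable_EFinP; exact: (measurableT_comp mH (measurable_line _)).
    by move=> p; rewrite lee_fin.
  apply/measurable_EFinP; apply: (measurableT_comp _ (measurable_mx_entry ij.1 ij.2)).
  by apply: measurable_indic; exact: measurable_itv.
rewrite -(integral_line_unit ij mF F0) -(integral_line_unit ij mG G0).
rewrite -ge0_integralZl//; last 2 first.
- exact: mline.
- by move=> x _; rewrite mule_ge0 ?lee_fin//; apply: integral_ge0 => s _; rewrite lee_fin.
apply: ge0_le_integral_nonmeas => x; last by rewrite muleA lee_wpmul2r ?lee_fin.
by rewrite mule_ge0 ?lee_fin//; apply: integral_ge0 => s _; rewrite lee_fin.
Qed.

(** The fundamental theorem of calculus for [f ^+ 2] along the line: its derivative is twice [f]
    times the partial derivative, bounded by the sum of the two squares. *)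
Lemma le_square_increment (f : M -> R) (ij : 'I_m * 'I_n) (t : R) x : 0 < t -> continuous f ->
  (forall x, derivable f x (delta_mx ij.1 ij.2)) -> continuous (partial ij f) ->
  ((`|f (x + t *: delta_mx ij.1 ij.2) ^+ 2 - f x ^+ 2|)%:E <=
   \int[leb]_s (\1_(`[0%R, t]%classic) s * (f (x + s *: delta_mx ij.1 ij.2) ^+ 2 + partial ij f (x + s *: delta_mx ij.1 ij.2) ^+ 2))%:E)%E.
Proof.
move=> t0 cf df cp; set E := delta_mx _ _ in df *.
pose g s := f (x + s *: E) ^+ 2.
pose g' s := 2 * (f (x + s *: E) * partial ij f (x + s *: E)).
have cl (h : M -> R) : continuous h -> continuous (fun s : R => h (x + s *: E)).
  by move=> ch s; exact: (cvg_comp _ _ (@line_continuous R M x E s) (ch _)).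
have cfl := cl f cf. have cpl := cl _ cp.
have cg' : continuous g'.
  move=> s; apply: cvgM; first exact: cvg_cst.
  exact: (cvgM (cfl s) (cpl s)).
have dg (s : R) : is_derive s (1 : R) g (g' s).
  have d1 := is_derive_line (df (x + s *: E)).
  apply: (is_derive1_congr (@is_deriveM _ _ _ _ _ _ _ _ d1 d1)).
    by apply/funext => r; rewrite /g expr2.
  by rewrite /g' /GRing.scale /= /partial -/E; ring.
have cg : continuous g.
  by move=> s; apply/differentiable_continuous; rewrite -derivable1_diffP.
have FTC : (\int[leb]_(s in `[0%R, t]) (g' s)%:E = (g t)%:E - (g 0)%:E)%E.
  apply: continuous_FTC2 => //.
  - exact: continuous_subspaceT.
  - split; first by move=> s _; exact: ex_derive.
    + exact: cvg_at_right_filter (cg 0).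
    + exact: cvg_at_left_filter (cg t).
  - by move=> s _; rewrite derive1E; exact: derive_val.
have -> : f x ^+ 2 = g 0 by rewrite /g scale0r addr0.
have mi : measurable (`[0%R, t]%classic : set (measurableTypeR R)) by exact: measurable_itv.
have mcont (h : R -> R) : continuous h -> measurable_fun setT h by exact: continuous_measurable_fun.
rewrite -/(g t) -abse_EFin EFinB -FTC (le_trans (le_abse_integral _ _ _))//.
  by apply: measurable_funTS; apply/measurable_EFinP; exact: mcont.
rewrite integral_mkcond; apply: ge0_le_integral => //.
- by move=> s _; rewrite erestrict_ge0.
- apply/(measurable_restrictT _ _).1 => //; apply: measurable_funTS.
  by apply: measurableT_comp => //; apply/measurable_EFinP; exact: mcont.
- apply/measurable_EFinP; apply: measurable_funM; first exact: measurable_indic.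
  by apply: measurable_funD; apply: measurable_funX; exact: mcont.
- move=> s _; rewrite /patch indicE; case: ifPn => _; rewrite ?mul0r// mul1r /= lee_fin /g'.
  set a := f _; set b := partial _ _ _.
  rewrite ler_norml; apply/andP; split.
    by have := sqr_ge0 (a + b); rewrite sqrrD; lra.
  by have := sqr_ge0 (a - b); rewrite sqrrB; lra.
Qed.

(** The indicator of the segment serves as kernel in [ge0_integral_lines]; its integral is the
    factor [|t|]. *)
Lemma translation_estimate (f : M -> R) (ij : 'I_m * 'I_n) (t : R) : continuous f ->
  (forall x, derivable f x (delta_mx ij.1 ij.2)) -> continuous (partial ij f) ->
  (\int[mu]_x (`|f (x + t *: delta_mx ij.1 ij.2) ^+ 2 - f x ^+ 2|)%:E <=
   (`|t|)%:E * \int[mu]_x (f x ^+ 2 + partial ij f x ^+ 2)%:E)%E.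
Proof.
move=> cf df cp; set E := delta_mx _ _ in df *.
pose w (x : M) := f x ^+ 2 + partial ij f x ^+ 2.
have w0 x : 0 <= w x by rewrite addr_ge0// sqr_ge0.
have mf : measurable_fun setT f by exact: continuous_measurable_mx.
have mw : measurable_fun setT w.
  by apply: measurable_funD; apply: measurable_funX => //; exact: continuous_measurable_mx.
have mdiff (s : R) : measurable_fun setT (fun x : M => (`|f (x + s *: E) ^+ 2 - f x ^+ 2|)%:E).
  apply/measurable_EFinP; apply: measurableT_comp => //; apply: measurable_funB.
    by apply: measurable_funX; exact: (measurableT_comp mf (measurable_mx_shift _)).
  exact: measurable_funX.
have pos s : 0 < s -> (\int[mu]_(x in setT) (`|f (x + s *: E) ^+ 2 - f x ^+ 2|)%:E <= s%:E * \int[mu]_x (w x)%:E)%E.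
  move=> s0.
  have mI : measurable_fun setT (\1_(`[0%R, s]%classic : set (measurableTypeR R)) : R -> R).
    by apply: measurable_indic; exact: measurable_itv.
  have <- : (\int[leb]_r (\1_(`[0%R, s]%classic : set (measurableTypeR R)) r)%:E = s%:E)%E.
    by rewrite integral_indic_itvcc ?subr0// ltW.
  rewrite -(ge0_integral_lines E mI _ mw w0) => [|r]; last by rewrite indicE.
  apply: ge0_le_integral_nonmeas => x; first by rewrite lee_fin.
  exact: le_square_increment.
have [t0|t0|<-] := ltgtP 0 t.
- by rewrite gtr0_norm//; exact: pos.
(* For negative [t], shifting by [- t] exchanges the two points and leads back to a positive
   step. *)
- rewrite ltr0_norm// -[X in (X <= _)%E](@ge0_integral_mx_shift _ _ _ (- t *: E) (fun x : M => (`|f (x + t *: E) ^+ 2 - f x ^+ 2|)%:E)) => [|//|x]; last first.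
    by rewrite lee_fin.
  under eq_integral => x _ do rewrite scaleNr subrK distrC -scaleNr.
  by apply: pos; rewrite oppr_gt0.
- rewrite normr0 mul0e; under eq_integral do rewrite scale0r addr0 subrr normr0.
  by rewrite integral0.
Qed.

End line_integrals.

(** * The trial state *)

Section integral_bounds.
Context d (T : measurableType d) (R : realType) (mu : {measure set T -> \bar R}).

Lemma integralD_le (f g : T -> R) (a b : R) :
  measurable_fun setT f -> (forall x, 0 <= f x) ->
  measurable_fun setT g -> (forall x, 0 <= g x) ->
  (\int[mu]_x (f x)%:E <= a%:E)%E -> (\int[mu]_x (g x)%:E <= b%:E)%E ->
  (\int[mu]_x (f x + g x)%:E <= (a + b)%:E)%E.
Proof.
move=> mf f0 mg g0 fa gb; under eq_integral do rewrite EFinD.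
rewrite ge0_integralD//; first by rewrite EFinD leeD.
all: by [exact/measurable_EFinP|move=> x _; rewrite lee_fin].
Qed.

Lemma integralZ_le (f : T -> R) (k a : R) :
  measurable_fun setT f -> (forall x, 0 <= f x) -> 0 <= k ->
  (\int[mu]_x (f x)%:E <= a%:E)%E -> (\int[mu]_x (k * f x)%:E <= (k * a)%:E)%E.
Proof.
move=> mf f0 k0 fa; under eq_integral do rewrite EFinM.
rewrite ge0_integralZl//; first by rewrite EFinM lee_wpmul2l.
all: by [exact/measurable_EFinP|move=> x _; rewrite lee_fin].
Qed.

Lemma ge0_integralZ_EFin (f : T -> R) (k : R) :
  measurable_fun setT f -> (forall x, 0 <= f x) -> 0 <= k ->
  (\int[mu]_x (k * f x)%:E = k%:E * \int[mu]_x (f x)%:E)%E.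
Proof.
move=> mf f0 k0; under eq_integral do rewrite EFinM.
by rewrite ge0_integralZl//; [exact/measurable_EFinP|move=> x _; rewrite lee_fin].
Qed.

Lemma measurable_sum_cond (I : Type) (s : seq I) (P : pred I) (f : I -> T -> R) :
  (forall i, measurable_fun setT (f i)) ->
  measurable_fun setT (fun x => \sum_(i <- s | P i) f i x).
Proof.
move=> mf; elim: s => [|i s IH].
  rewrite (_ : (fun x => _) = cst 0); first exact: measurable_cst.
  by apply/funext => x; rewrite big_nil.
case Pi : (P i); last by under eq_fun do rewrite big_cons Pi.
by under eq_fun do rewrite big_cons Pi; apply: measurable_funD.
Qed.

Lemma integral_sum_le (I : finType) (P : pred I) (f : I -> T -> R) (c : I -> R) :
  (forall i, measurable_fun setT (f i)) -> (forall i x, 0 <= f i x) ->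
  (forall i, P i -> (\int[mu]_x (f i x)%:E <= (c i)%:E)%E) ->
  (\int[mu]_x (\sum_(i | P i) f i x)%:E <= (\sum_(i | P i) c i)%:E)%E.
Proof.
move=> mf f0 fc; elim: (index_enum I) => [|i s IH].
  by under eq_integral do rewrite big_nil; rewrite big_nil integral0.
rewrite big_cons; under eq_integral do rewrite big_cons.
case: ifPn => Pi //; apply: integralD_le => //.
- exact: measurable_sum_cond.
- by move=> x; apply: sumr_ge0.
- exact: fc.
Qed.

End integral_bounds.

Section profile.
Context {R : realType}.
Local Notation leb := (@lebesgue_measure R).

Definition profile : R -> R := smooth_bump (-1) 1 1.

Lemma smooth1_profile : smooth1 profile.
Proof. exact: smooth1_bump. Qed.

Lemma profile_itv x : 0 <= profile x <= 1.
Proof. exact: bump_itv. Qed.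

Lemma profile_eq0 x : 1 <= `|x| -> profile x = 0.
Proof. by move=> h; apply: bump_eq0; rewrite -ltr_norml -leNgt. Qed.

(** Both arguments of [invexp 1] are at least [1/2], so each factor is at least [expR (- 2)]. *)
Lemma profile_ge x : `|x| <= 2^-1 -> expR (- 4) <= profile x.
Proof.
rewrite ler_norml => /andP[h1 h2]; rewrite /profile /smooth_bump /invexp.
have H (y : R) : 2^-1 <= y -> expR (- 2) <= (if 0 < y then (1 : {poly R}).[y^-1] * expR (- y^-1) else 0).
  move=> hy; have y0 : 0 < y by rewrite (lt_le_trans _ hy).
  by rewrite y0 hornerC mul1r ler_expR lerN2 invf_ple ?posrE.
have -> : expR (- 4) = expR (- 2) * expR (- 2) :> R by rewrite -expRD; congr expR; ring.
by apply: ler_pM; rewrite ?expR_ge0//; apply: H; lra.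
Qed.

Lemma continuous_sqr_integral (h : R -> R) : continuous h -> (forall x, 1 < `|x| -> h x = 0) ->
  exists2 K, 0 <= K & (\int[leb]_s (h s ^+ 2)%:E = K%:E)%E.
Proof.
move=> ch h0.
have mh : measurable_fun setT h by exact: continuous_measurable_fun.
have : compact (h @` `[-1, 1]%classic).
  by apply: continuous_compact; [exact: continuous_subspaceT|exact: segment_compact].
move=> /compact_bounded[C [_ HC]]; set C' := `|C| + 1.
have hC x : h x ^+ 2 <= C' ^+ 2 * \1_(`[-1, 1]%classic) x.
  have [x1|x1] := pselect (`[-1, 1]%classic x).
    rewrite indicE mem_set// mulr1 -[leLHS]ger0_norm ?sqr_ge0// normrX lerXn2r ?nnegrE ?addr_ge0//.
    by apply: (HC C' (ltr_pwDr ltr01 (ler_norm C))); exists x.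
  rewrite h0 ?expr0n /=.
    by apply: mulr_ge0; [exact: sqr_ge0|rewrite indicE].
  by rewrite ltNge ler_norml; apply/negP => h1; apply: x1; rewrite /= in_itv.
have : (\int[leb]_s (h s ^+ 2)%:E <= (C' ^+ 2 * 2)%:E)%E.
  apply: (@le_trans _ _ (\int[leb]_s (C' ^+ 2 * \1_(`[-1, 1]%classic : set (measurableTypeR R)) s)%:E)%E).
    by apply: ge0_le_integral_nonmeas => x; rewrite lee_fin ?sqr_ge0.
  apply: integralZ_le.
  - by apply: measurable_indic; exact: measurable_itv.
  - by move=> x; rewrite indicE.
  - exact: sqr_ge0.
  - rewrite integral_indic_itvcc; last by rewrite lerNl -subr_ge0; lra.
    by rewrite lee_fin; lra.
set I := (\int[leb]_s _)%E => Ile.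
have I0 : (0 <= I)%E by apply: integral_ge0 => x _; rewrite lee_fin sqr_ge0.
exists (fine I); first exact: fine_ge0.
by rewrite fineK// ge0_fin_numE// (le_lt_trans Ile)// ltry.
Qed.

Lemma profile_sqr_integral : exists2 U, 0 < U & (\int[leb]_s (profile s ^+ 2)%:E = U%:E)%E.
Proof.
have [||U U0 e] := @continuous_sqr_integral profile.
- exact: (smooth1_continuous smooth1_profile).
- by move=> x x1; rewrite profile_eq0// ltW.
exists U => //; rewrite -lte_fin -e.
(* The contribution of [[-1/2, 1/2]], an interval of length 1. *)
apply: (@lt_le_trans _ _ (expR (- 4) ^+ 2)%:E); first by rewrite lte_fin exprn_gt0 ?expR_gt0.
have -> : ((expR (- 4) ^+ 2)%:E = \int[leb]_s (expR (- 4) ^+ 2 * \1_(`[- 2^-1, 2^-1]%classic : set (measurableTypeR R)) s)%:E)%E.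
  rewrite ge0_integralZ_EFin; last 3 first.
  - by apply: measurable_indic; exact: measurable_itv.
  - by move=> x; rewrite indicE.
  - exact: sqr_ge0.
  rewrite integral_indic_itvcc; last by rewrite -subr_ge0; lra.
  by rewrite -EFinM; congr (_%:E); rewrite (_ : 2^-1 - - 2^-1 = 1 :> R) ?mulr1//; lra.
apply: ge0_le_integral_nonmeas => x; rewrite lee_fin indicE.
  by apply: mulr_ge0; first exact: sqr_ge0.
case: (boolP (_ \in _)) => [|_]; last by rewrite mulr0 sqr_ge0.
rewrite inE /= in_itv /= -ler_norml mulr1 => /profile_ge h.
by rewrite lerXn2r ?nnegrE ?expR_ge0//; case/andP: (profile_itv x).
Qed.

Lemma profile_derivative : exists2 u' : R -> R, smooth1 u' &
  (forall t : R, is_derive t (1 : R) profile (u' t)) /\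
  exists2 K, 0 <= K & (\int[leb]_s (u' s ^+ 2)%:E = K%:E)%E.
Proof.
have [u' du su] := smooth1_derivative smooth1_profile.
exists u' => //; split => //; apply: continuous_sqr_integral.
  exact: smooth1_continuous.
move=> x x1; rewrite -(@derive_val _ _ _ _ _ _ _ (du x)).
rewrite (near_eq_derive (g := cst 0)) ?derive_cst//.
have : \forall y \near x, 1 < `|y|.
  have cn : continuous (fun y : R => `|y|) by exact: norm_continuous.
  exact: (cn x _ (lt_nbhsr x1)).
by apply: filterS => y /ltW; exact: profile_eq0.
Qed.

End profile.

Section trial.
Context {R : realType} {m n : nat}.
Local Notation M := 'M[R]_(m, n).
Local Notation mu := (@lebesgue_mx R m n).
Local Notation leb := (@lebesgue_measure R).

(** On a coordinate line all factors but one are constant, so ratios of line integrals involve a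
    single function of one variable, whatever [m] and [n]. *)
Lemma tensor_line (b : 'I_m -> 'I_n -> R -> R) i0 j0 (x : M) s :
  tensor b (x + s *: delta_mx i0 j0) = b i0 j0 (s + x i0 j0) * tensor (upd b i0 j0 (fun=> 1)) x.
Proof.
rewrite (tensorE _ i0 j0) tensor_updE mul1r !mxE !eqxx mulr1 [s + _]addrC -mulrA.
congr (_ * (_ * _)).
  by apply: eq_bigr => i /negPf ii0; apply: eq_bigr => j _; rewrite !mxE ii0 mulr0 addr0.
by apply: eq_bigr => j /negPf jj0; rewrite !mxE jj0 andbF mulr0 addr0.
Qed.

Definition trial : M -> R := tensor (fun _ _ => profile).

Lemma continuous_trial : continuous trial.
Proof. by apply: continuous_tensor => i j; exact: (smooth1_continuous smooth1_profile). Qed.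

Lemma trial_itv x : 0 <= trial x <= 1.
Proof. exact: (tensor_bump_itv (fun _ _ => -1) (fun _ _ => 1) 1). Qed.

Lemma trial_eq0 x : ~ mx_cube 1 x -> trial x = 0.
Proof.
move=> xr; apply: (tensor_bump_eq0 (a := fun _ _ => -1) (b := fun _ _ => 1)) => xb.
by apply: xr; apply/mx_cubeP => i j; have := xb i j; rewrite /= in_itv /= -ltr_norml => /ltW.
Qed.

(** The cube of half-side [1/2] has measure 1 in every dimension, and the product of profiles is
    bounded below on it. *)
Lemma trial_sqr_integral : exists2 Z, 0 < Z & (\int[mu]_x (trial x ^+ 2)%:E = Z%:E)%E.
Proof.
have i2 : mu.-integrable setT (EFin \o (fun x => trial x ^+ 2)).
  apply: (continuous_integrable (r := 1)) => [x|x xr]; last by rewrite trial_eq0// expr0n.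
  rewrite (_ : (fun x0 => _) = fun x0 => trial x0 * trial x0); last exact/funext.
  by have ct : continuous trial := continuous_trial; exact: (cvgM (ct x) (ct x)).
have i0 : (0 <= \int[mu]_x (trial x ^+ 2)%:E)%E by apply: integral_ge0 => x _; rewrite lee_fin sqr_ge0.
exists (fine (\int[mu]_x (trial x ^+ 2)%:E)); last by rewrite fineK// integrable_fin_num.
rewrite -lte_fin fineK ?integrable_fin_num//.
pose c : R := \prod_(i < m) \prod_(j < n) expR (- 4).
have c0 : 0 < c by apply: prodr_gt0 => i _; apply: prodr_gt0 => j _; exact: expR_gt0.
apply: (@lt_le_trans _ _ (c ^+ 2)%:E); first by rewrite lte_fin exprn_gt0.
have mc := @measurable_mx_cube R m n 2^-1.
have -> : ((c ^+ 2)%:E = \int[mu]_x (c ^+ 2 * \1_(mx_cube 2^-1) x)%:E)%E.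
  rewrite ge0_integralZ_EFin; last 3 first.
  - exact: measurable_indic.
  - by move=> x; rewrite indicE.
  - exact: sqr_ge0.
  rewrite integral_indic// setIT.
  rewrite [X in (_ * X)%E](_ : _ = 1%E) ?mule1// -[LHS]/(mu (mx_cube 2^-1)).
  rewrite /mx_cube lebesgue_mx_box; last by move=> i j; exact: measurable_itv.
  rewrite big1// => i _; rewrite big1// => j _; rewrite lebesgue_measure_itv /= lte_fin.
  by rewrite ifT; [rewrite -EFinD; congr (_%:E); lra|lra].
apply: ge0_le_integral_nonmeas => x; rewrite lee_fin indicE.
  by apply: mulr_ge0; first exact: sqr_ge0.
case: (boolP (_ \in _)) => [|_]; last by rewrite mulr0 sqr_ge0.
rewrite inE => /mx_cubeP xc; rewrite mulr1 lerXn2r ?nnegrE//; first exact: ltW.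
  by case/andP: (trial_itv x).
apply: ler_prod => i _; rewrite prodr_ge0 => [/=|j _]; last exact: expR_ge0.
by apply: ler_prod => j _; rewrite expR_ge0/= profile_ge.
Qed.

Lemma ge0_integral_line_scale (h : R -> R) (c k : R) : measurable_fun setT h -> (forall s, 0 <= h s) -> 0 <= k ->
  (\int[leb]_s (h (s + c) * k)%:E = (\int[leb]_s (h s)%:E) * k%:E)%E.
Proof.
move=> mh h0 k0; under eq_integral do rewrite EFinM.
rewrite ge0_integralZr//.
- congr (_ * _)%E; apply: (@ge0_integral_lebesgue_shift R c (EFin \o h)) => //.
  exact/measurable_EFinP.
- apply/measurable_EFinP; apply: (measurableT_comp mh).
  by apply: measurable_funD => //; exact: measurable_cst.
- by move=> s _; rewrite lee_fin.
Qed.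

(** The coordinates form a list so that the windows can be integrated out one at a time, by
    induction. *)
Definition pair_window (delta : R) (i j : 'I_m) (s : seq 'I_n) (x : M) : R :=
  \prod_(l <- s) \1_(`[- delta, delta]%classic) (x i l - x j l).

Lemma measurable_pair_window delta i j s : measurable_fun setT (pair_window delta i j s).
Proof.
rewrite /pair_window; elim: s => [|l s IH].
  rewrite (_ : (fun x => _) = cst 1); first exact: measurable_cst.
  by apply/funext => x; rewrite big_nil.
rewrite (_ : (fun x => _) = fun x : M => \1_(`[- delta, delta]%classic) (x i l - x j l) * pair_window delta i j s x); last first.
  by apply/funext => x; rewrite big_cons.
apply: measurable_funM => //.
have mI : measurable_fun setT (\1_(`[- delta, delta]%classic : set (measurableTypeR R)) : R -> R).
  by apply: measurable_indic; exact: measurable_itv.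
apply: (measurableT_comp mI).
by apply: measurable_funB; exact: measurable_mx_entry.
Qed.

Lemma pair_window_ge0 delta i j s x : 0 <= pair_window delta i j s x.
Proof. by apply: prodr_ge0 => l _; rewrite indicE. Qed.

End trial.

(** * Trial estimates uniform in the number of particles *)

Section trial_bounds.
Context {R : realType}.
Local Notation leb := (@lebesgue_measure R).

(** The constant precedes the dimensions: on every line the ratio is [K / U], with [K] and [U] the
    integrals of the squared derivative and of the square of the profile. *)
Lemma trial_kinetic : exists2 C, 0 <= C & forall m n (ij : 'I_m * 'I_n),
  [/\ (forall x : 'M[R]_(m, n), derivable trial x (delta_mx ij.1 ij.2)), continuous (partial ij (@trial R m n)) &
   (\int[lebesgue_mx]_x (partial ij (@trial R m n) x ^+ 2)%:E <= C%:E * \int[lebesgue_mx]_x (@trial R m n x ^+ 2)%:E)%E].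
Proof.
have [U U0 UE] := @profile_sqr_integral R.
have [u' su [du [K K0 KE]]] := @profile_derivative R.
exists (K / U) => [|m n [i j]] /=; first by rewrite divr_ge0// ltW.
have dT (x : 'M[R]_(m, n)) : is_derive x (delta_mx i j) trial (tensor (upd (fun _ _ => profile) i j u') x).
  exact: is_derive_tensor.
have pE : partial (i, j) (@trial R m n) = tensor (upd (fun _ _ => profile) i j u').
  by apply/funext => x; rewrite /partial /=; exact: derive_val.
have cp : continuous (partial (i, j) (@trial R m n)).
  rewrite pE; apply: continuous_tensor => i' j'; apply: smooth1_continuous.
  by apply: smooth1_upd => // *; exact: smooth1_profile.
split => //.
have mT := continuous_measurable_mx (@continuous_trial R m n).
have mp := continuous_measurable_mx cp.
apply: (@line_integral_le _ _ _ (i, j) (fun x : 'M[R]_(m, n) => partial (i, j) trial x ^+ 2) (fun x : 'M[R]_(m, n) => trial x ^+ 2)).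
- by rewrite divr_ge0// ltW.
- exact: measurable_funX.
- by move=> x; exact: sqr_ge0.
- exact: measurable_funX.
- by move=> x; exact: sqr_ge0.
move=> x /=.
have mu' : measurable_fun setT u' by apply: continuous_measurable_fun; exact: smooth1_continuous.
have mpr : measurable_fun setT (@profile R).
  by apply: continuous_measurable_fun; exact: (smooth1_continuous smooth1_profile).
pose r := tensor (upd (fun _ _ => profile) i j (fun=> 1)) x.
have -> : (\int[leb]_s (partial (i, j) trial (x + s *: delta_mx i j) ^+ 2)%:E = K%:E * (r ^+ 2)%:E)%E.
  rewrite -KE -(@ge0_integral_line_scale R (fun s => u' s ^+ 2) (x i j)).
  - apply: eq_integral => s _; rewrite pE tensor_line {1}/upd !eqxx /= exprMn.
    congr (_ * tensor _ _ ^+ 2)%:E; apply/funext => i'; apply/funext => j'.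
    by rewrite /upd; case: ifP => // ->.
  - exact: measurable_funX.
  - by move=> s; exact: sqr_ge0.
  - exact: sqr_ge0.
have -> : (\int[leb]_s (trial (x + s *: delta_mx i j) ^+ 2)%:E = U%:E * (r ^+ 2)%:E)%E.
  rewrite -UE -(@ge0_integral_line_scale R (fun s => profile s ^+ 2) (x i j)).
  - by apply: eq_integral => s _; rewrite /trial tensor_line exprMn.
  - exact: measurable_funX.
  - by move=> s; exact: sqr_ge0.
  - exact: sqr_ge0.
by rewrite -!EFinM lee_fin [leRHS]mulrA mulfVK ?gt_eqF.
Qed.

(** Each window costs one integration in the entry [(i, l)]. There [profile ^+ 2 <= 1] leaves at
    most the length [2 * delta] of the window, against [U] without the window; hence [C = 2 / U]. *)
Lemma trial_pair_window : exists2 C, 0 <= C & forall m n delta (i j : 'I_m) (s : seq 'I_n), 0 <= delta -> i != j -> uniq s ->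
  (\int[lebesgue_mx]_x (@trial R m n x ^+ 2 * pair_window delta i j s x)%:E <=
   ((C * delta) ^+ size s)%:E * \int[lebesgue_mx]_x (@trial R m n x ^+ 2)%:E)%E.
Proof.
have [U U0 UE] := @profile_sqr_integral R.
exists (2 / U) => [|m n delta i j s d0 ij]; first by rewrite divr_ge0// ltW.
have C0 : 0 <= 2 / U * delta by rewrite mulr_ge0// divr_ge0// ltW.
have mT : measurable_fun setT (fun x : 'M[R]_(m, n) => trial x ^+ 2).
  by apply: measurable_funX; exact: (continuous_measurable_mx (@continuous_trial R m n)).
elim: s => [_|l s IH /=/andP[ls us]].
  by rewrite mul1e; under eq_integral do rewrite /pair_window big_nil mulr1.
rewrite exprS EFinM -muleA; apply: le_trans (lee_wpmul2l _ (IH us)); last by rewrite lee_fin.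
have mc t := @measurable_pair_window R m n delta i j t.
apply: (@line_integral_le _ _ _ (i, l) (fun x : 'M[R]_(m, n) => trial x ^+ 2 * pair_window delta i j (l :: s) x)
  (fun x : 'M[R]_(m, n) => trial x ^+ 2 * pair_window delta i j s x)) => //.
- exact: measurable_funM.
- by move=> x; rewrite mulr_ge0 ?sqr_ge0 ?pair_window_ge0.
- exact: measurable_funM.
- by move=> x; rewrite mulr_ge0 ?sqr_ge0 ?pair_window_ge0.
move=> x /=.
have mpr : measurable_fun setT (@profile R).
  by apply: continuous_measurable_fun; exact: (smooth1_continuous smooth1_profile).
pose r := tensor (upd (fun _ _ => profile) i l (fun=> 1)) x.
(* Moving the entry [(i, l)] does not affect the remaining windows, as [l] is not in [s]. *)
have pair_windowE (t : R) : pair_window delta i j s (x + t *: delta_mx i l) = pair_window delta i j s x.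
  rewrite /pair_window; elim: (s) ls => [|k t' IHt]; first by rewrite !big_nil.
  rewrite inE negb_or => /andP[lk lt]; rewrite !big_cons IHt//; congr (_ * _).
  by rewrite !mxE !eqxx [k == l]eq_sym (negPf lk) !andbF !mulr0 !addr0.
have k0 : 0 <= r ^+ 2 * pair_window delta i j s x by rewrite mulr_ge0 ?sqr_ge0 ?pair_window_ge0.
have -> : (\int[leb]_t (trial (x + t *: delta_mx i l) ^+ 2 * pair_window delta i j s (x + t *: delta_mx i l))%:E = U%:E * (r ^+ 2 * pair_window delta i j s x)%:E)%E.
  rewrite -UE -(@ge0_integral_line_scale R (fun t => profile t ^+ 2) (x i l))//.
  - by apply: eq_integral => t _; rewrite pair_windowE /trial tensor_line exprMn mulrA.
  - exact: measurable_funX.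
  - by move=> t; exact: sqr_ge0.
pose I := \1_(`[- delta, delta]%classic : set (measurableTypeR R)) : R -> R.
have mI : measurable_fun setT I by apply: measurable_indic; exact: measurable_itv.
apply: (@le_trans _ _ (\int[leb]_t (I (t + (x i l - x j l)) * (r ^+ 2 * pair_window delta i j s x))%:E)%E).
  apply: ge0_le_integral_nonmeas => t; rewrite lee_fin; first by rewrite mulr_ge0 ?sqr_ge0 ?pair_window_ge0.
  rewrite {1}/pair_window big_cons -/(pair_window delta i j s _) pair_windowE /trial tensor_line exprMn -/r.
  rewrite !mxE !eqxx eq_sym (negPf ij) /= mulr1 mulr0 addr0.
  rewrite [x i l + t]addrC -addrA -/(I _) mulrACA [X in X * _]mulrC -mulrA.
  rewrite -[leRHS]mulr1 -[leRHS]mulrA ler_wpM2l ?indicE//.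
  rewrite mulrC ler_wpM2l// expr_le1//; by have /andP[] := profile_itv (t + x i l).
rewrite (ge0_integral_line_scale _ mI)//.
rewrite integral_indic_itvcc; last by rewrite lerNl -subr_ge0; lra.
rewrite -!EFinM lee_fin [leRHS]mulrA ler_wpM2r//.
by rewrite mulrAC mulfVK ?gt_eqF// opprK; lra.
Qed.

End trial_bounds.

(** * Energy bounds *)

Section energy.
Context {R : realType}.

(** Compactness in the form of near coverings: the local bounds are combined through the filter at
    [+oo] of admissible bounds. *)
Lemma locally_bounded_cube m n (V : 'M[R]_(m, n) -> R) r : locally_bounded V ->
  exists2 C, 0 <= C & forall x, mx_cube r x -> `|V x| <= C.
Proof.
move=> lV.
have /compact_near_coveringP cK := @compact_mx_cube R m n r.
have := cK R +oo (fun i x => `|V x| <= i) _.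
case=> [x _|M [_ HM]].
  have [M0 VM0] := lV x; exists ([set y | `|V y| <= M0], [set i | M0 <= i]) => /=.
    by split; [exact: VM0|apply: nbhs_pinfty_ge; exact: num_real].
  by move=> [y i] /= [h1 h2]; exact: le_trans h1 h2.
exists (`|M| + 1); first by rewrite addr_ge0.
by move=> x; apply: HM; rewrite (le_lt_trans (ler_norm M))// ltrDl.
Qed.

Lemma normsq_real (a : R) : normsq (a%:C)%C = a ^+ 2.
Proof. by rewrite /normsq /= expr0n addr0. Qed.

Lemma normsq_ge0 (z : R[i]) : 0 <= normsq z.
Proof. by rewrite addr_ge0 ?sqr_ge0. Qed.

Lemma C1_weak_gradient m n (f : 'M[R]_(m, n) -> R) : continuous f ->
  (forall (ij : 'I_m * 'I_n) x, derivable f x (delta_mx ij.1 ij.2)) ->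
  (forall ij, continuous (partial ij f)) ->
  weak_gradient (real_wave f) (fun ij x => ((partial ij f x)%:C)%C).
Proof.
move=> cf df cp ij; split; first exact: C1_weak_partial.
have p0 : partial ij (cst 0 : 'M[R]_(m, n) -> R) = cst 0.
  by apply/funext => x; rewrite /partial derive_cst.
have c0 : continuous (cst 0 : 'M[R]_(m, n) -> R) by exact: cst_continuous.
have := @C1_weak_partial R m n ij (cst 0); rewrite p0; apply => //.
Qed.

(** The classical gradient is one of the competitors in the infimum. *)
Lemma energy_le_trial m n (W : 'M[R]_(m, n) -> R -> R) (f : 'M[R]_(m, n) -> R) : continuous f ->
  (forall (ij : 'I_m * 'I_n) x, derivable f x (delta_mx ij.1 ij.2)) ->
  (forall ij, continuous (partial ij f)) ->
  (energy W (real_wave f) <= \int[lebesgue_mx]_x (\sum_ij partial ij f x ^+ 2 + W x (f x ^+ 2))%:E)%E.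
Proof.
move=> cf df cp; apply: ereal_inf_lbound; eexists; first exact: C1_weak_gradient.
apply: eq_integral => x _; rewrite normsq_real; congr (_ + _)%:E.
by apply: eq_bigr => ij _; rewrite normsq_real.
Qed.

Lemma gp_length_gt0 (g : R) N : 0 < g -> (0 < N)%N -> 0 < gp_length g N.
Proof. by move=> g0 N0; rewrite /gp_length divr_gt0// !mulr_gt0// ?pi_gt0 ?ltr0n. Qed.

(** [v1] is at most [B] on a cube of half-side [L] and vanishes outside it. Scaling turns the cube
    into windows of half-width [L * a], while [B] and [L] depend neither on [g] nor on [N]. *)
Lemma gp_potential_bound (v1 : 'rV[R]_3 -> R) : (forall x, 0 <= v1 x) ->
  smooth v1 -> compactly_supported v1 ->
  exists B L : R, [/\ 0 <= B, 0 <= L & forall g N y, 0 < g -> (0 < N)%N ->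
    gp_potential v1 g N y <= (gp_length g N) ^- 2 * B *
      \prod_(l <- index_enum 'I_3) \1_(`[- (L * gp_length g N), L * gp_length g N]%classic) (y ord0 l)].
Proof.
move=> v0 sv cv; have [L L0 vL] := compactly_supported_cube cv.
have [B B0 HB] := continuous_bounded_cube L (smooth_continuous sv).
exists B, L; split => //; first exact: ltW.
move=> g N y g0 N0; have a0 := gp_length_gt0 g0 N0; set a := gp_length g N in a0 *.
have a2 : 0 <= a ^- 2 by rewrite invr_ge0 exprn_ge0// ltW.
rewrite /gp_potential -/a -mulrA ler_wpM2l//.
have P0 : 0 <= \prod_(l <- index_enum 'I_3) \1_(`[- (L * a), L * a]%classic) (y ord0 l) :> R.
  by apply: prodr_ge0 => l _; rewrite indicE.
have [yL|yL] := pselect (mx_cube L (a^-1 *: y)); last by rewrite vL ?mulr_ge0.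
rewrite big1 ?mulr1 => [|l _]; first by rewrite (le_trans (ler_norm _))// HB.
rewrite indicE mem_set//= in_itv /= -ler_norml.
have := (mx_cubeP L _).1 yL ord0 l; rewrite mxE normrM gtr0_norm ?invr_gt0// mulrC.
by rewrite ler_pdivrMr.
Qed.

Lemma trial_symmetric m n (s : 'S_m) (x : 'M[R]_(m, n)) : trial (row_perm s x) = trial x.
Proof.
rewrite /trial /tensor (reindex_inj (@perm_inj _ s^-1%g)) /=.
by apply: eq_bigr => i _; apply: eq_bigr => j _; rewrite mxE permKV.
Qed.

(* The N^2 pairs contribute N^2 a^-2 a^3 = N^2 a = N g / (4 pi). *)
Lemma many_body_energy_bound (V : 'rV[R]_3 -> R) (g : R) (v1 : 'rV[R]_3 -> R) :
  locally_bounded V -> (forall x, 0 <= V x) -> 0 < g -> (forall x, 0 <= v1 x) ->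
  smooth v1 -> compactly_supported v1 ->
  exists2 C, 0 <= C & forall N, (0 < N)%N -> exists2 Phi : 'M[R]_(N, 3) -> R[i],
    normalized Phi /\ permutation_symmetric Phi &
    (many_body_energy V (gp_potential v1 g N) Phi <= (C * N%:R)%:E)%E.
Proof.
move=> lV V0 g0 v0 sv cv.
have [MV MV0 HMV] := locally_bounded_cube 1 lV.
have [B [L [B0 L0 HB]]] := gp_potential_bound v0 sv cv.
have [C1 C10 kin] := @trial_kinetic R; have [C2 C20 clo] := @trial_pair_window R.
(* Per particle: the kinetic energy of three coordinates, the trap on [mx_cube 1], outside which the
   trial state vanishes, and the pairs, with [N * a] replaced by [g / (4 * pi)]. *)
exists (3%:R * C1 + MV + g / (4 * pi) * (B * (C2 * L) ^+ 3)) => [|N N0].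
  rewrite !addr_ge0 ?mulr_ge0 ?exprn_ge0 ?divr_ge0//; first exact: ltW.
  by rewrite invr_ge0 mulr_ge0// pi_ge0.
have [Z Z0 ZE] := @trial_sqr_integral R N 3.
have a0 := gp_length_gt0 g0 N0; set a := gp_length g N in a0.
pose c := Num.sqrt Z^-1.
have c2 : c ^+ 2 = Z^-1 by rewrite sqr_sqrtr// invr_ge0 ltW.
pose T : 'M[R]_(N, 3) -> R := trial.
have cT : continuous T by exact: continuous_trial.
have mT := continuous_measurable_mx cT.
have dT (ij : 'I_N * 'I_3) x : derivable T x (delta_mx ij.1 ij.2) by have [] := kin _ _ ij.
have cpT (ij : 'I_N * 'I_3) : continuous (partial ij T) by have [] := kin _ _ ij.
have mpT (ij : 'I_N * 'I_3) := continuous_measurable_mx (cpT ij).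
pose f x := c * T x.
have pf ij : partial ij f = fun x => c * partial ij T x.
  by apply/funext => x; rewrite /partial /f (deriveMl c (dT ij x)).
have cf : continuous f by move=> x; exact: (cvgM (cvg_cst c) (cT x)).
have df (ij : 'I_N * 'I_3) x : derivable f x (delta_mx ij.1 ij.2).
  by apply: derivableM => //; exact: derivable_cst.
have cpf ij : continuous (partial ij f).
  by rewrite pf => x; exact: (cvgM (cvg_cst c) (cpT ij x)).
have mT2 : measurable_fun setT (fun x => T x ^+ 2) by exact: measurable_funX.
exists (real_wave f); first split; first split.
- exact: continuous_measurable_mx.
- exact: measurable_cst.
- under eq_integral do rewrite normsq_real /f exprMn.
  rewrite ge0_integralZ_EFin ?sqr_ge0// => [|x]; last exact: sqr_ge0.
  by rewrite ZE -EFinM c2 mulVf// gt_eqF.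
- by move=> s; apply: aeW => x; rewrite /real_wave /f /T trial_symmetric.
apply: (le_trans (energy_le_trial _ cf df cpf)).
(* A bound of the energy density before normalization, with the potentials replaced by their upper
   bounds; the factor [c ^+ 2] returns in [le_bnd]. *)
pose bnd x := \sum_(ij : 'I_N * 'I_3) partial ij T x ^+ 2 +
  (N%:R * MV * T x ^+ 2 +
   (a ^- 2 * B) * \sum_(i < N) \sum_(j < N | (i < j)%N) T x ^+ 2 * pair_window (L * a) i j (index_enum 'I_3) x).
have gp0 y : 0 <= gp_potential v1 g N y.
  by rewrite /gp_potential mulr_ge0// invr_ge0 sqr_ge0.
have W0 x : 0 <= many_body_potential V (gp_potential v1 g N) x.
  rewrite addr_ge0// ?sumr_ge0// => i _; apply: sumr_ge0 => j _; exact: gp0.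
have le_bnd x : \sum_ij partial ij f x ^+ 2 +
    many_body_potential V (gp_potential v1 g N) x * f x ^+ 2 <= c ^+ 2 * bnd x.
  rewrite /bnd mulrDr lerD//.
    by rewrite mulr_sumr ler_sum// => ij _; rewrite pf exprMn.
  rewrite /f exprMn mulrCA ler_wpM2l ?sqr_ge0// /many_body_potential mulrDl lerD//.
    have [xc|xc] := pselect (mx_cube 1 x); last first.
      by rewrite /T trial_eq0// expr0n !mulr0.
    have -> : N%:R * MV = \sum_(i < N) MV by rewrite sumr_const card_ord mulr_natl.
    rewrite ler_wpM2r ?sqr_ge0// ler_sum// => i _.
    rewrite (le_trans (ler_norm _))// HMV//; apply/mx_cubeP => k l.
    by rewrite mxE; exact: (mx_cubeP _ _).1.
  rewrite mulr_suml mulr_sumr ler_sum// => i _; rewrite mulr_suml mulr_sumr ler_sum// => j _.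
  rewrite mulrC [leRHS]mulrCA ler_wpM2l ?sqr_ge0// (le_trans (HB g N _ g0 N0))//.
  rewrite -/a ler_wpM2l ?mulr_ge0 ?invr_ge0 ?sqr_ge0// le_eqVlt; apply/orP; left; apply/eqP.
  by apply: eq_bigr => l _; rewrite !mxE.
have La : 0 <= L * a by rewrite mulr_ge0// ltW.
have mclose i j : measurable_fun setT (fun x => T x ^+ 2 * pair_window (L * a) i j (index_enum 'I_3) x).
  by apply: measurable_funM => //; exact: measurable_pair_window.
have close0 i j x : 0 <= T x ^+ 2 * pair_window (L * a) i j (index_enum 'I_3) x.
  by rewrite mulr_ge0 ?sqr_ge0 ?pair_window_ge0.
have mpairs (i : 'I_N) : measurable_fun setT (fun x : 'M[R]_(N, 3) => \sum_(j < N | (i < j)%N) T x ^+ 2 * pair_window (L * a) i j (index_enum 'I_3) x).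
  exact: measurable_sum_cond.
have pairs0 (i : 'I_N) (x : 'M[R]_(N, 3)) : 0 <= \sum_(j < N | (i < j)%N) T x ^+ 2 * pair_window (L * a) i j (index_enum 'I_3) x.
  by apply: sumr_ge0 => j _.
have i1 : (\int[lebesgue_mx]_x (\sum_(ij : 'I_N * 'I_3) partial ij T x ^+ 2)%:E <= (\sum_(ij : 'I_N * 'I_3) C1 * Z)%:E)%E.
  apply: integral_sum_le => [ij|ij x|ij _].
  - exact: measurable_funX.
  - exact: sqr_ge0.
  - by have [_ _] := kin _ _ ij; rewrite ZE -EFinM.
have i3 : (\int[lebesgue_mx]_x (\sum_(i < N) \sum_(j < N | (i < j)%N) T x ^+ 2 * pair_window (L * a) i j (index_enum 'I_3) x)%:E
    <= (\sum_(i < N) \sum_(j < N | (i < j)%N) (C2 * (L * a)) ^+ 3 * Z)%:E)%E.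
  apply: integral_sum_le => // i _; apply: integral_sum_le => // j ij.
  have := clo N 3 (L * a) i j (index_enum 'I_3) La.
  rewrite neq_ltn ij /= => /(_ isT (index_enum_uniq _)).
  have -> : size (index_enum 'I_3) = 3%N by rewrite -sum1_size !big_ord_recl big_ord0.
  by rewrite ZE -EFinM.
have mpart : measurable_fun setT (fun x : 'M[R]_(N, 3) => \sum_(ij : 'I_N * 'I_3) partial ij T x ^+ 2).
  by apply: measurable_sum_cond => ij; exact: measurable_funX.
have mpp : measurable_fun setT (fun x : 'M[R]_(N, 3) => \sum_(i < N) \sum_(j < N | (i < j)%N) T x ^+ 2 * pair_window (L * a) i j (index_enum 'I_3) x).
  exact: measurable_sum_cond.
have pp0 (x : 'M[R]_(N, 3)) : 0 <= \sum_(i < N) \sum_(j < N | (i < j)%N) T x ^+ 2 * pair_window (L * a) i j (index_enum 'I_3) x.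
  by apply: sumr_ge0.
have a2B : 0 <= a ^- 2 * B by rewrite mulr_ge0// invr_ge0 sqr_ge0.
have NMV : 0 <= N%:R * MV by rewrite mulr_ge0.
have i2 : (\int[lebesgue_mx]_x (N%:R * MV * T x ^+ 2)%:E <= (N%:R * MV * Z)%:E)%E.
  by apply: integralZ_le => // [x|]; [exact: sqr_ge0|rewrite ZE].
have i4 := integralZ_le mpp pp0 a2B i3.
have mT2' : measurable_fun setT (fun x : 'M[R]_(N, 3) => N%:R * MV * T x ^+ 2).
  by apply: measurable_funM => //; exact: measurable_cst.
have mpp' : measurable_fun setT (fun x : 'M[R]_(N, 3) => a ^- 2 * B * \sum_(i < N) \sum_(j < N | (i < j)%N) T x ^+ 2 * pair_window (L * a) i j (index_enum 'I_3) x).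
  by apply: measurable_funM => //; exact: measurable_cst.
have T20 (x : 'M[R]_(N, 3)) : 0 <= N%:R * MV * T x ^+ 2 by rewrite mulr_ge0// sqr_ge0.
have pp0' (x : 'M[R]_(N, 3)) : 0 <= a ^- 2 * B * \sum_(i < N) \sum_(j < N | (i < j)%N) T x ^+ 2 * pair_window (L * a) i j (index_enum 'I_3) x.
  by rewrite mulr_ge0.
have i5 := integralD_le mT2' T20 mpp' pp0' i2 i4.
have part0 (x : 'M[R]_(N, 3)) : 0 <= \sum_(ij : 'I_N * 'I_3) partial ij T x ^+ 2.
  by apply: sumr_ge0 => ij _; exact: sqr_ge0.
have i6 := integralD_le mpart part0 (measurable_funD mT2' mpp') (fun x => addr_ge0 (T20 x) (pp0' x)) i1 i5.
have mbnd := measurable_funD mpart (measurable_funD mT2' mpp').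
have bnd0 x : 0 <= bnd x by rewrite !addr_ge0.
have i7 := integralZ_le mbnd bnd0 (sqr_ge0 c) i6.
apply: (le_trans _ (le_trans i7 _)).
  apply: ge0_le_integral_nonmeas => x; rewrite lee_fin; last exact: le_bnd.
  apply: addr_ge0; first by apply: sumr_ge0 => ij _; exact: sqr_ge0.
  by apply: mulr_ge0; [exact: W0|exact: sqr_ge0].
rewrite lee_fin c2 sumr_const card_prod !card_ord.
set Q := (C2 * (L * a)) ^+ 3 * Z.
have Q0 : 0 <= Q by apply: mulr_ge0; [apply: exprn_ge0; exact: mulr_ge0|exact: ltW].
(* All [N^2] ordered pairs are counted instead of those with [i < j]. *)
have sQ : \sum_(i < N) \sum_(j < N | (i < j)%N) Q <= N%:R * (N%:R * Q).
  have sc (q : R) : N%:R * q = \sum_(i < N) q by rewrite sumr_const card_ord mulr_natl.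
  rewrite sc ler_sum// => i _; rewrite sc [leRHS](bigID (fun j : 'I_N => (i < j)%N)) /=.
  by rewrite lerDl sumr_ge0.
apply: (@le_trans _ _ (Z^-1 * ((C1 * Z) *+ (N * 3) + (N%:R * MV * Z + a ^- 2 * B * (N%:R * (N%:R * Q)))))).
  by rewrite ler_wpM2l ?invr_ge0 ?(ltW Z0)// !lerD2l ler_wpM2l.
rewrite le_eqVlt; apply/orP; left; apply/eqP.
have aE : N%:R * a = g / (4 * pi).
  have N1 : N%:R != 0 :> R by rewrite pnatr_eq0 -lt0n.
  by rewrite /a /gp_length invfM mulrC -!mulrA mulVf ?mulr1.
rewrite -aE /Q -mulr_natl natrM; field.
by rewrite !gt_eqF.
Qed.

(** The potentials are non-negative, so the kinetic part is at most the whole energy, which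
    minimality keeps below that of the trial state. *)
Lemma kinetic_energy_le (V : 'rV[R]_3 -> R) (g : R) (v1 : 'rV[R]_3 -> R) :
  locally_bounded V -> (forall x, 0 <= V x) -> 0 < g -> (forall x, 0 <= v1 x) ->
  smooth v1 -> compactly_supported v1 ->
  exists2 C, 0 <= C & forall N (Psi : 'M[R]_(N, 3) -> R), (0 < N)%N ->
    ground_state V (gp_potential v1 g N) Psi ->
    (\sum_ij \int[lebesgue_mx]_x (partial ij Psi x ^+ 2)%:E <= (C * N%:R)%:E)%E.
Proof.
move=> lV V0 g0 v0 sv cv.
have [C C0 HC] := many_body_energy_bound lV V0 g0 v0 sv cv.
(* [C + 1] makes the inequality strict, so that the infimum over weak gradients provides an actual
   gradient [D]. *)
exists (C + 1) => [|N Psi N0 [[_ minP] _ Ppos CkP]]; first by rewrite addr_ge0.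
have [Phi HPhi PhiC] := HC N N0.
have := le_trans (minP Phi HPhi) PhiC.
have NC : ((C * N%:R)%:E < ((C + 1) * N%:R)%:E)%E.
  by rewrite lte_fin mulrDl mul1r ltrDl ltr0n.
move=> /le_lt_trans - /(_ _ NC) /ereal_inf_lt[_ [D gD ->]] intD.
have gp0 y : 0 <= gp_potential v1 g N y.
  by rewrite /gp_potential mulr_ge0// invr_ge0 sqr_ge0.
have W0 x : 0 <= many_body_potential V (gp_potential v1 g N) x.
  by rewrite addr_ge0// ?sumr_ge0// => i _; apply: sumr_ge0.
have ReD ij := (gD ij).1.
have cPsi (ij : 'I_N * 'I_3) := Ck1P ij CkP.
have mRe ij : measurable_fun setT (fun x => complex.Re (D ij x)) by have [_ [+ _] _] := ReD ij.
(* The weak gradient supplied by the infimum agrees almost everywhere with the classical one. Its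
   real part suffices: the squared imaginary part is dropped below. *)
have DE ij : (\int[lebesgue_mx]_x (partial ij Psi x ^+ 2)%:E = \int[lebesgue_mx]_x ((complex.Re (D ij x)) ^+ 2)%:E)%E.
  have [cP dP cpP] := cPsi ij.
  have mp := continuous_measurable_mx cpP.
  apply: ae_eq_integral => //.
  - by apply/measurable_EFinP; exact: measurable_funX.
  - by apply/measurable_EFinP; exact: measurable_funX.
  - apply: filterS (weak_partial_unique (C1_weak_partial cP dP cpP) (ReD ij)) => x e _.
    by rewrite e.
under eq_bigr do rewrite DE.
rewrite -ge0_integral_sum//; last 2 first.
- by move=> ij; apply/measurable_EFinP; exact: measurable_funX.
- by move=> ij x _; rewrite lee_fin sqr_ge0.
apply: le_trans (ltW intD); apply: ge0_le_integral_nonmeas => x.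
  by apply: sume_ge0 => ij _; rewrite lee_fin sqr_ge0.
rewrite sumEFin lee_fin -[leLHS]addr0 lerD//.
  by apply: ler_sum => ij _; rewrite /normsq lerDl sqr_ge0.
by rewrite mulr_ge0// normsq_ge0.
Qed.

End energy.

(** * From continuous test functions to Borel sets *)

Section approximation.
Context {R : realType} {m n : nat}.
Local Notation M := 'M[R]_(m, n).
Variable la : {measure set M -> \bar R}.
Hypothesis la_lty : (la setT < +oo)%E.

Definition unit_continuous (F : M -> R) :=
  continuous F /\ forall x, 0 <= F x <= 1.

(** The sets with this property form a sigma-algebra, so it only has to be established on
    generators. *)
Definition approximable (A : set M) := measurable A /\
  forall e : R, 0 < e -> exists2 F, unit_continuous F &
    (\int[la]_x (`|\1_A x - F x|)%:E <= e%:E)%E.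

(** Dominated convergence with the constant 1, which is integrable because [la] is finite. *)
Lemma approximable_cvg (A : set M) (G : nat -> M -> R) : measurable A ->
  (forall k, measurable_fun setT (G k)) -> (forall k x, 0 <= G k x <= 1) ->
  (forall x, G k x @[k --> \oo] --> (\1_A x : R)) ->
  (forall e : R, 0 < e -> exists k, (\int[la]_x (`|\1_A x - G k x|)%:E <= e%:E)%E).
Proof.
move=> mA mG G01 GA e e0.
have mI : measurable_fun setT (\1_A : M -> R) by exact: measurable_indic.
have [|||||_] := @dominated_convergence _ _ _ la setT measurableT
   (fun k x => (G k x)%:E) (fun x => (\1_A x)%:E) (fun x => 1%:E).
- by move=> k; exact/measurable_EFinP.
- exact/measurable_EFinP.
- by apply: aeW => x _; apply: cvg_EFin; [exact: nearW|exact: GA].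
- apply/integrableP; split; first exact: measurable_cst.
  by under eq_integral do rewrite abse_EFin normr1; rewrite integral_cst// mul1e.
- by apply: aeW => x k _; rewrite abse_EFin lee_fin; have /andP[h0 h1] := G01 k x; rewrite ger0_norm.
move=> + _ => /fine_cvgP[_ /cvgrPdist_le /(_ e e0) [k _ /(_ k (leqnn k))]].
rewrite /= sub0r normrN => H; exists k.
rewrite (eq_integral (fun x => `|(G k x)%:E - (\1_A x)%:E|%E)); last first.
  by move=> x _; rewrite -EFinB abse_EFin distrC.
set I := (\int[la]_x _)%E in H *.
have I0 : (0 <= I)%E by apply: integral_ge0 => x _; rewrite lee_fin.
have Ifin : I \is a fin_num.
  rewrite ge0_fin_numE// (@le_lt_trans _ _ (\int[la]_x 1%:E)%E)//.
    apply: ge0_le_integral_nonmeas => x; rewrite lee_fin// indicE; have /andP[h0 h1] := G01 k x.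
    by rewrite ler_norml; case: (_ \in _) => /=; apply/andP; split; lra.
  by rewrite integral_cst// mul1e.
by rewrite -[I]fineK// lee_fin (le_trans (ler_norm _)).
Qed.

Lemma approximableC A : approximable A -> approximable (~` A).
Proof.
move=> [mA hA]; split; first exact: measurableC.
move=> e e0; have [F [cF F01] HF] := hA e e0.
exists (fun x => 1 - F x).
  split; first by move=> x; exact: (cvgB (cvg_cst (1 : R)) (cF x)).
  by move=> x; have /andP[? ?] := F01 x; apply/andP; split; lra.
apply: le_trans HF; rewrite le_eqVlt; apply/orP; left; apply/eqP.
apply: eq_integral => x _; congr (_%:E); rewrite !indicE in_setC -normrN.
by case: (x \in A); congr `|_|; rewrite /=; ring.
Qed.

(** The maximum of the two approximations works, [max] being 1-Lipschitz in each argument. *)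
Lemma approximableU A B : approximable A -> approximable B -> approximable (A `|` B).
Proof.
move=> [mA hA] [mB hB]; split; first exact: measurableU.
move=> e e0; have e20 : 0 < e / 2 by rewrite divr_gt0.
have [F [cF F01] HF] := hA _ e20; have [G [cG G01] HG] := hB _ e20.
have cM : continuous (fun x => Num.max (F x) (G x)).
  by move=> x; apply: continuous_max; [exact: cF|exact: cG].
exists (fun x => Num.max (F x) (G x)).
  split=> // x; have /andP[? ?] := F01 x; have /andP[? ?] := G01 x.
  by rewrite le_max ge_max; apply/andP; split; [apply/orP; left|apply/andP; split].
have mF := continuous_measurable_mx cF; have mG := continuous_measurable_mx cG.
have mIA : measurable_fun setT (\1_A : M -> R) by exact: measurable_indic.
have mIB : measurable_fun setT (\1_B : M -> R) by exact: measurable_indic.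
have : (\int[la]_x (`|\1_A x - F x| + `|\1_B x - G x|)%:E <= (e / 2 + e / 2)%:E)%E.
  apply: integralD_le => //.
  - by apply: measurableT_comp => //; exact: measurable_funB.
  - by apply: measurableT_comp => //; exact: measurable_funB.
rewrite -splitr; apply: le_trans; apply: ge0_le_integral_nonmeas => x; rewrite lee_fin//.
rewrite !indicE in_setU; have /andP[f0 f1] := F01 x; have /andP[g0 g1] := G01 x.
rewrite ler_norml.
have a0 := normr_ge0 ((x \in A)%:R - F x); have b0 := normr_ge0 ((x \in B)%:R - G x).
move: a0 b0 (ler_norm ((x \in A)%:R - F x)) (ler_norm ((x \in B)%:R - G x)).
have := ler_norm (- ((x \in A)%:R - F x)); have := ler_norm (- ((x \in B)%:R - G x)).
rewrite !normrN; move: `|_| `|_| => u v.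
by case: (x \in A); case: (x \in B) => /=; case: (leP (F x) (G x)) => FG h1 h2 h3 h4 h5 h6; apply/andP; split; lra.
Qed.

Lemma approximable0 : approximable set0.
Proof.
split=> // e e0; exists (fun=> 0).
  by split; [exact: cst_continuous|move=> x; rewrite lexx ler01].
under eq_integral do rewrite indic0 subr0 normr0.
by rewrite integral0 lee_fin ltW.
Qed.

Lemma approximable_of_approx (A : set M) (B : nat -> set M) : measurable A ->
  (forall k, approximable (B k)) -> (forall x, \1_(B k) x @[k --> \oo] --> (\1_A x : R)) ->
  approximable A.
Proof.
move=> mA aB BA; split=> // e e0; have e20 : 0 < e / 2 by rewrite divr_gt0.
have mB k : measurable_fun setT (\1_(B k) : M -> R).
  by apply: measurable_indic; case: (aB k).
have B01 k x : 0 <= (\1_(B k) x : R) <= 1 by rewrite indicE; case: (_ \in _); rewrite ?lexx ?ler01.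
have [k Hk] := approximable_cvg mA mB B01 BA e20.
have [_ /(_ _ e20) [F cF HF]] := aB k; exists F => //.
have mF := continuous_measurable_mx cF.1.
have mIA : measurable_fun setT (\1_A : M -> R) by exact: measurable_indic.
have : (\int[la]_x (`|\1_A x - \1_(B k) x| + `|\1_(B k) x - F x|)%:E <= (e / 2 + e / 2)%:E)%E.
  by apply: integralD_le => //; apply: measurableT_comp => //; exact: measurable_funB.
rewrite -splitr; apply: le_trans; apply: ge0_le_integral_nonmeas => x; rewrite lee_fin//.
by rewrite -(subrKA (\1_(B k) x)) ler_normD.
Qed.

(** At each point the indicators of the finite unions are eventually constant, so dominated
    convergence reaches the countable union. *)
Lemma approximable_bigcup (A : nat -> set M) : (forall k, approximable (A k)) ->
  approximable (\bigcup_k A k).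
Proof.
move=> aA; apply: (@approximable_of_approx _ (fun k => \big[setU/set0]_(i < k) A i)).
- by apply: bigcupT_measurable => k; case: (aA k).
- by move=> k; apply: (big_ind approximable) => //; [exact: approximable0|exact: approximableU].
- move=> x; have [[k _ Ak]|nA] := pselect ((\bigcup_k A k) x).
    rewrite indicE mem_set; last by exists k.
    apply: cvg_near_cst; exists k.+1 => // j /= kj; rewrite indicE mem_set//.
    by rewrite -bigcup_mkord; exists k.
  rewrite indicE memNset//; apply: cvg_near_cst; apply: nearW => j.
  rewrite indicE memNset// -bigcup_mkord => -[k _ Ak]; by apply: nA; exists k.
Qed.

Lemma approximable_halfspace i j (c : R) : approximable [set x | c < x i j].
Proof.
have mA : measurable [set x : M | c < x i j].
  rewrite (_ : [set x : M | _] = setT `&` (fun x : M => x i j) @^-1` `]c, +oo[%classic).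
    by apply: measurable_mx_entry => //; exact: measurable_itv.
  by apply/seteqP; split => x /=; rewrite in_itv /= andbT => // -[].
(* Ramps of slope [k], clamped to [[0, 1]]; at every point they eventually equal the indicator. *)
split=> //; pose G (k : nat) (x : M) : R := Num.min 1 (Num.max 0 (k%:R * (x i j - c))).
have cG k : continuous (G k).
  have cl : continuous (fun x : M => k%:R * (x i j - c)).
    move=> x; exact: (cvgM (cvg_cst (k%:R : R)) (cvgB (@coord_continuous R m n i j x) (cvg_cst c))).
  move=> x; change ({for x, continuous ((cst 1 : M -> R) \min ((cst 0 : M -> R) \max (fun x : M => k%:R * (x i j - c))))}).
  apply: continuous_min; first exact: cst_continuous.
  by apply: continuous_max; [exact: cst_continuous|exact: cl].
have G01 k x : 0 <= G k x <= 1 by rewrite /G le_min ler01 le_max lexx /= ge_min lexx.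
move=> e e0; have [|||k Hk] := @approximable_cvg _ G mA _ _ _ e e0.
- by move=> k; exact: continuous_measurable_mx.
- exact: G01.
- move=> x; have [cx|xc] := ltP c (x i j); last first.
    rewrite indicE memNset; last by rewrite /= ltNge xc.
    apply: cvg_near_cst; apply: nearW => k; rewrite /G max_l ?min_r ?ler01//.
    by rewrite mulr_ge0_le0// subr_le0.
  rewrite indicE mem_set//.
  have d0 : 0 < x i j - c by rewrite subr_gt0.
  apply: cvg_near_cst; exists (Num.bound (x i j - c)^-1) => // k /= hk.
  rewrite /G min_l// le_max; apply/orP; right; rewrite -ler_pdivrMr// mul1r.
  have iv0 : 0 <= (x i j - c)^-1 by rewrite invr_ge0 ltW.
  by apply: (le_trans (ltW (archi_boundP iv0))); rewrite ler_nat.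
- by exists (G k) => //; split.
Qed.

Lemma approximable_sigma_algebra : sigma_algebra setT approximable.
Proof.
split; first exact: approximable0.
- by move=> A aA; rewrite setTD; exact: approximableC.
- exact: approximable_bigcup.
Qed.

Lemma measurable_approximable A : measurable A -> approximable A.
Proof.
move: A; apply: smallest_sub; first exact: approximable_sigma_algebra.
move=> A; rewrite -bigcup_seq /= => -[k _] [Y mY <-].
rewrite setTI; case/mxvec_indexP: k => i j.
(* Borel sets of the line are generated by rays, whose preimages are half-spaces, and the sets with
   approximable preimage form a sigma-algebra. *)
have : <<s @RGenOInfty.G R >> Y -> approximable ((fun x : M => x i j : measurableTypeR R) @^-1` Y).
  move: Y {mY}; apply: smallest_sub; last first.
    move=> _ [c ->]; rewrite (_ : _ @^-1` _ = [set x : M | c < x i j]); first exact: approximable_halfspace.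
    by apply/seteqP; split => x /=; rewrite in_itv /= andbT.
  split; first by rewrite preimage_set0; exact: approximable0.
  - by move=> B aB; rewrite setTD preimage_setC; exact: approximableC.
  - by move=> B aB; rewrite preimage_bigcup; exact: approximable_bigcup.
rewrite RGenOInfty.measurableE in mY; move=> /(_ mY); congr approximable.
by apply/seteqP; split => x /=; rewrite /mx_coords mxvecE.
Qed.

End approximation.

Section duality.
Context {R : realType} {m n : nat}.
Local Notation M := 'M[R]_(m, n).
Variables P Q : {finite_measure set M -> \bar R}.

Lemma integral_le_of_L1 (P' : {measure set M -> \bar R}) (f g : M -> R) e : measurable_fun setT f -> (forall x, 0 <= f x) ->
  measurable_fun setT g -> (forall x, 0 <= g x) ->
  (\int[P']_x (`|f x - g x|)%:E <= e%:E)%E ->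
  (\int[P']_x (f x)%:E <= \int[P']_x (g x)%:E + e%:E)%E.
Proof.
move=> mf f0 mg g0 H; apply: (@le_trans _ _ (\int[P']_x (g x)%:E + \int[P']_x (`|f x - g x|)%:E)%E); last first.
  by rewrite leeD2l.
rewrite -ge0_integralD//; last 3 first.
- by move=> x _; rewrite lee_fin.
- exact/measurable_EFinP.
- by apply/measurable_EFinP; apply: measurableT_comp => //; exact: measurable_funB.
apply: ge0_le_integral_nonmeas => x; first by rewrite lee_fin.
by rewrite -EFinD lee_fin -lerBlDl ler_norm.
Qed.

Lemma measure_le_of_unit_continuous (d : R) :
  (forall F, unit_continuous F -> (\int[Q]_x (F x)%:E <= \int[P]_x (F x)%:E + d%:E)%E) ->
  forall A, measurable A -> (Q A <= P A + d%:E)%E.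
Proof.
move=> H A mA; apply/lee_addgt0Pr => e e0.
have e20 : 0 < e / 2 by rewrite divr_gt0.
have mIA : measurable_fun setT (\1_A : M -> R) by exact: measurable_indic.
have IA0 x : 0 <= (\1_A x : R) by rewrite indicE.
(* Approximating with respect to the sum gives one [F] that serves both measures. *)
pose la := measure_add P Q.
have lafin : (la setT < +oo)%E.
  by rewrite /la measure_addE lte_add_pinfty// fin_num_fun_lty.
have [_ /(_ _ e20) [F uF HF]] := measurable_approximable lafin mA.
have mF := continuous_measurable_mx uF.1.
have F0 x : 0 <= F x by have /andP[] := uF.2 x.
have mAF : measurable_fun setT (fun x => (`|\1_A x - F x|)%:E).
  by apply/measurable_EFinP; apply: measurableT_comp => //; exact: measurable_funB.
have HPQ : (\int[P]_x (`|\1_A x - F x|)%:E + \int[Q]_x (`|\1_A x - F x|)%:E <= (e / 2)%:E)%E.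
  by rewrite -ge0_integral_measure_add// => x _; rewrite lee_fin.
have pos (P' : {measure set M -> \bar R}) : (0 <= \int[P']_x (`|\1_A x - F x|)%:E)%E.
  by apply: integral_ge0 => x _; rewrite lee_fin.
have HP : (\int[P]_x (`|F x - \1_A x|)%:E <= (e / 2)%:E)%E.
  by under eq_integral do rewrite distrC; apply: le_trans HPQ; rewrite leeDl.
have HQ : (\int[Q]_x (`|\1_A x - F x|)%:E <= (e / 2)%:E)%E.
  by apply: le_trans HPQ; rewrite leeDr.
have h1 := integral_le_of_L1 mIA IA0 mF F0 HQ.
have h2 := integral_le_of_L1 mF F0 mIA IA0 HP.
rewrite !integral_indic// !setIT in h1 h2.
apply: (le_trans h1); rewrite (_ : e%:E = (e / 2)%:E + (e / 2)%:E)%E; last by rewrite -EFinD -splitr.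
rewrite addeA -[leRHS]addeAC; apply: leeD => //.
by apply: (le_trans (H F uF)); rewrite [leRHS]addeAC; exact: leeD2r.
Qed.

End duality.

(** * Mollification and total variation *)

Section mollifier.
Context {R : realType} {m n : nat}.
Local Notation M := 'M[R]_(m, n).
Local Notation mu := (@lebesgue_mx R m n).

(** By continuity [g] exceeds [g 0 / 2] on a small cube, and cubes have positive measure. *)
Lemma continuous_integral_gt0 (g : M -> R) : continuous g -> (forall x, 0 <= g x) -> 0 < g 0 ->
  (0 < \int[mu]_x (g x)%:E)%E.
Proof.
move=> cg g0 g00.
have : \forall x \near (0 : M), g 0 / 2 < g x.
  have H : g 0 / 2 < g 0 by rewrite ltr_pdivrMr// ltr_pMr// ltr1n.
  exact: (cg 0 _ (lt_nbhsr H)).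
move=> /nbhs_ballP[r /= r0 Hr].
have h0 : 0 < r / 2 by rewrite divr_gt0.
apply: (@lt_le_trans _ _ (\int[mu]_x (g 0 / 2 * \1_(mx_cube (r / 2)) x)%:E)%E).
  rewrite ge0_integralZ_EFin; last 3 first.
  - by apply: measurable_indic; exact: measurable_mx_cube.
  - by move=> x; rewrite indicE.
  - by rewrite divr_ge0// ltW.
  rewrite mule_gt0// ?lte_fin ?divr_gt0//.
  rewrite integral_indic//; last exact: measurable_mx_cube.
  rewrite setIT -[X in (_ < X)%E]/(mu (mx_cube (r / 2))) /mx_cube lebesgue_mx_box; last first.
    by move=> i j; exact: measurable_itv.
  apply: (big_ind (fun x => 0 < x)%E) => [||i _]; [by rewrite lte_fin|by move=> *; exact: mule_gt0|].
  apply: (big_ind (fun x => 0 < x)%E) => [||j _]; [by rewrite lte_fin|by move=> *; exact: mule_gt0|].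
  rewrite lebesgue_measure_itv /= lte_fin ifT; last by rewrite gtrN.
  by rewrite -EFinD lte_fin opprK addr_gt0.
apply: ge0_le_integral_nonmeas => x; rewrite lee_fin indicE.
  by apply: mulr_ge0 => //; rewrite divr_ge0// ltW.
case: (boolP (_ \in _)) => [|_]; last by rewrite mulr0.
rewrite inE => /mx_cubeP xr; rewrite mulr1 ltW//; apply: Hr; split=> // i j.
rewrite mxE /ball /= sub0r normrN (le_lt_trans (xr i j))//.
by rewrite ltr_pdivrMr// ltr_pMr// ltr1n.
Qed.

(** The trial state, rescaled and divided by its integral. *)
Lemma mollifier_exists (e : R) : 0 < e -> exists eta : M -> R,
  [/\ continuous eta, forall x, 0 <= eta x, forall x, ~ mx_cube e x -> eta x = 0,
      (exists B, forall x, eta x <= B) & (\int[mu]_x (eta x)%:E = 1)%E].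
Proof.
move=> e0; pose g (x : M) := trial (e^-1 *: x).
have cT : continuous (@trial R m n) := continuous_trial.
have cg : continuous g.
  move=> x; apply: (@cvg_comp _ _ _ (fun x : M => e^-1 *: x) (@trial R m n)); last exact: cT.
  exact: scaler_continuous.
have g01 x : 0 <= g x <= 1 by exact: trial_itv.
have g0 x : 0 <= g x by have /andP[] := g01 x.
have gz x : ~ mx_cube e x -> g x = 0.
  move=> xe; apply: trial_eq0 => /mx_cubeP h; apply: xe; apply/mx_cubeP => i j.
  by have := h i j; rewrite mxE normrM gtr0_norm ?invr_gt0// mulrC ler_pdivrMr// mul1r.
have g00 : 0 < g 0.
  rewrite /g scaler0; apply: prodr_gt0 => i _; apply: prodr_gt0 => j _; rewrite mxE.
  by apply: lt_le_trans (profile_ge _); rewrite ?expR_gt0// normr0 invr_ge0.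
have ig := continuous_integrable cg gz.
have If := integrable_fin_num measurableT ig.
have Ipos := continuous_integral_gt0 cg g0 g00.
pose Z := fine (\int[mu]_x (g x)%:E).
have ZE : (\int[mu]_x (g x)%:E = Z%:E)%E by rewrite fineK.
have Z0 : 0 < Z by rewrite -lte_fin -ZE.
exists (fun x => Z^-1 * g x); split.
- by move=> x; exact: (cvgM (cvg_cst Z^-1) (cg x)).
- by move=> x; rewrite mulr_ge0// invr_ge0 ltW.
- by move=> x /gz ->; rewrite mulr0.
- exists Z^-1 => x; rewrite ler_piMr ?invr_ge0 ?(ltW Z0)//; by have /andP[] := g01 x.
- rewrite ge0_integralZ_EFin ?invr_ge0 ?(ltW Z0)//; last exact: continuous_measurable_mx.
  by rewrite ZE -EFinM mulVf// gt_eqF.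
Qed.

Lemma measurable_mx_add : measurable_fun setT (fun p : M * M => p.1 + p.2).
Proof.
apply: measurable_fun_mx => i j.
rewrite (_ : (fun p => _) = (fun p : M * M => p.1 i j + p.2 i j)); last by apply/funext => p; rewrite !mxE.
by apply: measurable_funD; [exact: (measurableT_comp (measurable_mx_entry i j) measurable_fst)|
  exact: (measurableT_comp (measurable_mx_entry i j) measurable_snd)].
Qed.

Lemma measurable_mx_sub : measurable_fun setT (fun p : M * M => p.1 - p.2).
Proof.
apply: measurable_fun_mx => i j.
rewrite (_ : (fun p => _) = (fun p : M * M => p.1 i j - p.2 i j)); last by apply/funext => p; rewrite !mxE.
by apply: measurable_funB; [exact: (measurableT_comp (measurable_mx_entry i j) measurable_fst)|
  exact: (measurableT_comp (measurable_mx_entry i j) measurable_snd)].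
Qed.

Variables (P : probability M R) (eta : M -> R).
Hypotheses (meta : measurable_fun setT eta) (eta0 : forall x, 0 <= eta x)
  (eta1 : (\int[mu]_x (eta x)%:E = 1)%E).

(* The density of the convolution of P with eta. *)
Definition mollified (y : M) : \bar R := (\int[P]_x (eta (y - x))%:E)%E.

Lemma mollified_ge0 y : (0 <= mollified y)%E.
Proof. by apply: integral_ge0 => x _; rewrite lee_fin. Qed.

Lemma measurable_mollified : measurable_fun setT mollified.
Proof.
apply: (measurable_fun_fubini_tonelli_F (m2 := P) (fun p : M * M => (eta (p.1 - p.2))%:E)).
  by apply/measurable_EFinP; exact: (measurableT_comp meta measurable_mx_sub).
by move=> p; rewrite lee_fin.
Qed.

(** Tonelli and the substitution [y = x + z]: the mollified density averages the integrals of the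
    shifts of [F] with weight [eta]. *)
Lemma integral_mollified (F : M -> R) : measurable_fun setT F -> (forall x, 0 <= F x) ->
  (\int[mu]_y ((F y)%:E * mollified y) = \int[mu]_z ((eta z)%:E * \int[P]_x (F (x + z)%R)%:E))%E.
Proof.
move=> mF F0.
have msub y : measurable_fun setT (fun x : M => eta (y - x)).
  exact: (measurableT_comp meta (measurableT_comp measurable_mx_sub (pair1_measurable y))).
pose f (p : M * M) := (F p.1 * eta (p.1 - p.2))%:E.
have mf : measurable_fun setT f.
  apply/measurable_EFinP; apply: measurable_funM; first exact: (measurableT_comp mF measurable_fst).
  exact: (measurableT_comp meta measurable_mx_sub).
have f0 p : (0 <= f p)%E by rewrite lee_fin mulr_ge0.
pose g (p : M * M) := (eta p.1 * F (p.2 + p.1))%:E.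
have mg : measurable_fun setT g.
  apply/measurable_EFinP; apply: measurable_funM; first exact: (measurableT_comp meta measurable_fst).
  rewrite (_ : (fun p => _) = (fun p : M * M => F (p.1 + p.2))); last first.
    by apply/funext => p; rewrite addrC.
  exact: (measurableT_comp mF measurable_mx_add).
have g0 p : (0 <= g p)%E by rewrite lee_fin mulr_ge0.
transitivity (\int[mu]_y \int[P]_x f (y, x))%E.
  apply: eq_integral => y _; rewrite /mollified /f /= -ge0_integralZ_EFin//.
rewrite (fubini_tonelli f mf f0).
transitivity (\int[P]_x \int[mu]_z g (z, x))%E; last first.
  rewrite -(fubini_tonelli g mg g0); apply: eq_integral => z _; rewrite /g /=.
  rewrite ge0_integralZ_EFin//.
  exact: (measurableT_comp mF (measurable_mx_shift z)).
apply: eq_integral => x _; rewrite -[LHS](ge0_integral_mx_shift x) => [|//|y]; last first.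
- exact: f0.
- exact: (measurableT_comp mf (pair2_measurable x)).
by apply: eq_integral => z _; rewrite /f /g /= addrK mulrC [z + x]addrC.
Qed.

Lemma integral_mollified1 : (\int[mu]_y mollified y = 1)%E.
Proof.
have := @integral_mollified (cst 1) (measurable_cst _) (fun=> ler01).
under eq_integral do rewrite /= mul1e.
move=> ->; rewrite -[RHS]eta1; apply: eq_integral => z _.
rewrite -[X in (_ * X)%E]/(\int[P]_x (cst 1%E x))%E integral_cst//.
by rewrite /= probability_setT !mule1.
Qed.

(** [eta] has mass 1, so a bound valid for every shift with [eta z != 0] survives the averaging. *)
Lemma le_integral_mollified (F : M -> R) (c : R) : measurable_fun setT F -> (forall x, 0 <= F x) -> 0 <= c ->
  (forall z, eta z != 0 -> (\int[P]_x (F x)%:E <= \int[P]_x (F (x + z)%R)%:E + c%:E)%E) ->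
  (\int[P]_x (F x)%:E <= \int[mu]_y ((F y)%:E * mollified y) + c%:E)%E.
Proof.
move=> mF F0 c0 H; rewrite integral_mollified//.
have PF0 : (0 <= \int[P]_x (F x)%:E)%E by apply: integral_ge0 => x _; rewrite lee_fin.
have PFz0 z : (0 <= \int[P]_x (F (x + z)%R)%:E)%E by apply: integral_ge0 => x _; rewrite lee_fin.
rewrite -[X in (X <= _)%E]mul1e -[X in (_ <= _ + X)%E]mul1e -eta1.
rewrite -!ge0_integralZr//; try (by [exact/measurable_EFinP|move=> x _; rewrite lee_fin|rewrite lee_fin]).
have m1 : measurable_fun setT (fun z => (eta z)%:E * \int[P]_x (F (x + z)%R)%:E)%E.
  apply: emeasurable_funM; first exact/measurable_EFinP.
  apply: (measurable_fun_fubini_tonelli_F (m2 := P) (fun p : M * M => (F (p.2 + p.1))%:E)).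
    apply/measurable_EFinP; rewrite (_ : (fun p => _) = (fun p : M * M => F (p.1 + p.2))).
      exact: (measurableT_comp mF measurable_mx_add).
    by apply/funext => p; rewrite addrC.
  by move=> p; rewrite lee_fin.
have m2 : measurable_fun setT (fun z => (eta z)%:E * c%:E)%E.
  by apply: emeasurable_funM; [exact/measurable_EFinP|exact: measurable_cst].
have p1 z : [set: M] z -> (0 <= (eta z)%:E * \int[P]_x (F (x + z)%R)%:E)%E.
  by move=> _; rewrite mule_ge0 ?lee_fin.
have p2 z : [set: M] z -> (0 <= (eta z)%:E * c%:E)%E.
  by move=> _; rewrite mule_ge0 ?lee_fin.
rewrite -(ge0_integralD _ measurableT p1 m1 p2 m2).
apply: ge0_le_integral_nonmeas => z; first by rewrite mule_ge0 ?lee_fin.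
have [->|ez] := eqVneq (eta z) 0; first by rewrite !mul0e adde0.
by rewrite -ge0_muleDr ?lee_fin//; apply: lee_wpmul2l; rewrite ?lee_fin//; exact: H.
Qed.

Lemma integral_mollified_le (F : M -> R) (c : R) : measurable_fun setT F -> (forall x, 0 <= F x) -> 0 <= c ->
  (forall z, eta z != 0 -> (\int[P]_x (F (x + z)%R)%:E <= \int[P]_x (F x)%:E + c%:E)%E) ->
  (\int[mu]_y ((F y)%:E * mollified y) <= \int[P]_x (F x)%:E + c%:E)%E.
Proof.
move=> mF F0 c0 H; rewrite integral_mollified//.
have PF0 : (0 <= \int[P]_x (F x)%:E)%E by apply: integral_ge0 => x _; rewrite lee_fin.
have PFz0 z : (0 <= \int[P]_x (F (x + z)%R)%:E)%E by apply: integral_ge0 => x _; rewrite lee_fin.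
rewrite -[X in (_ <= X)%E]mul1e -eta1.
rewrite -!ge0_integralZr//; try (by [exact/measurable_EFinP|move=> x _; rewrite lee_fin|rewrite adde_ge0// lee_fin]).
apply: ge0_le_integral_nonmeas => z; first by rewrite mule_ge0 ?lee_fin.
have [->|ez] := eqVneq (eta z) 0; first by rewrite !mul0e.
by apply: lee_wpmul2l; rewrite ?lee_fin//; exact: H.
Qed.

End mollifier.

(** * From weak convergence and shift estimates to total variation *)

Section total_variation.
Context {R : realType} {m n : nat}.
Local Notation M := 'M[R]_(m, n).
Local Notation mu := (@lebesgue_mx R m n).

Lemma measure_le_near (P : nat -> probability M R) (Q : probability M R) (C : R) : 0 <= C ->
  (forall k (F : M -> R), measurable_fun setT F -> (forall x, 0 <= F x <= 1) -> forall z,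
    (\int[P k]_x (F x)%:E <= \int[P k]_x (F (x + z)%R)%:E + (C * \sum_i \sum_j `|z i j|)%:E)%E) ->
  (forall f : M -> R, continuous f -> (exists B : R, forall x, `|f x| <= B) ->
    (\int[P k]_x (f x)%:E)%E @[k --> \oo] --> (\int[Q]_x (f x)%:E)%E) ->
  forall e : R, 0 < e -> \forall k \near \oo, forall A, measurable A -> (Q A <= P k A + e%:E)%E.
Proof.
move=> C0 TP W e e0.
(* Three errors share [e]: mollifying [Q], comparing the two densities, and mollifying [P k]. *)
pose c := e / 3; have c0 : 0 < c by rewrite divr_gt0.
(* On [mx_cube r] the absolute values of the entries add up to at most [m * n * r]; the extra 1
   keeps the denominator positive. *)
pose r := c / (C * (m%:R * n%:R) + 1).
have D0 : 0 < C * (m%:R * n%:R) + 1 by rewrite ltr_wpDl// mulr_ge0// mulr_ge0.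
have r0 : 0 < r by rewrite divr_gt0.
have [eta [ceta eta0 etaz [B HB] eta1]] := @mollifier_exists R m n r r0.
have meta := continuous_measurable_mx ceta.
have Hz (z : M) : eta z != 0 -> C * \sum_i \sum_j `|z i j| <= c.
  move=> ez; have /mx_cubeP zr : mx_cube r z.
    by apply: contrapT => /etaz /eqP; rewrite (negPf ez).
  apply: (@le_trans _ _ (C * (m%:R * n%:R * r))).
    rewrite ler_wpM2l// -mulrA mulr_natl -[X in _ *+ X](card_ord m) -sumr_const ler_sum// => i _.
    by rewrite mulr_natl -[X in _ *+ X](card_ord n) -sumr_const ler_sum.
  rewrite mulrA /r mulrCA ger_pMr// ler_pdivrMr// mul1r lerDl//.
have TP1 k (F : M -> R) z : measurable_fun setT F -> (forall x, 0 <= F x <= 1) -> eta z != 0 ->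
    (\int[P k]_x (F x)%:E <= \int[P k]_x (F (x + z)%R)%:E + c%:E)%E.
  by move=> mF F01 ez; apply: (le_trans (TP k F mF F01 z)); rewrite leeD2l// lee_fin Hz.
(* The reverse estimate is the direct one for the shifted function and the shift [- z]. *)
have TP2 k (F : M -> R) z : measurable_fun setT F -> (forall x, 0 <= F x <= 1) -> eta z != 0 ->
    (\int[P k]_x (F (x + z)%R)%:E <= \int[P k]_x (F x)%:E + c%:E)%E.
  move=> mF F01 ez.
  have := TP k (fun x : M => F (x + z)) (measurableT_comp mF (measurable_mx_shift z)) (fun x => F01 _) (- z).
  under [X in (_ <= X + _)%E -> _]eq_integral do rewrite subrK.
  move=> /le_trans; apply; rewrite leeD2l// lee_fin; apply: le_trans (Hz _ ez).
  by rewrite ler_wpM2l// ler_sum// => i _; apply: ler_sum => j _; rewrite mxE normrN.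
have TQ (F : M -> R) z : unit_continuous F -> eta z != 0 ->
    (\int[Q]_x (F x)%:E <= \int[Q]_x (F (x + z)%R)%:E + c%:E)%E.
  move=> [cF F01] ez; have mF := continuous_measurable_mx cF.
  have cFz : continuous (fun x : M => F (x + z)).
    by move=> x; exact: (cvg_comp _ _ (cvgD cvg_id (cvg_cst _)) (cF _)).
  have bF x : `|F x| <= 1 by have /andP[? ?] := F01 x; rewrite ger0_norm.
  have W1 := W F cF (ex_intro _ 1 bF).
  have W2 : (\int[P k]_x (F (x + z)%R)%:E)%E @[k --> \oo] --> (\int[Q]_x (F (x + z)%R)%:E)%E.
    by apply: (W (fun x : M => F (x + z)) cFz); exists 1 => x; exact: bF.
  have W3 : (\int[P k]_x (F (x + z)%R)%:E + c%:E)%E @[k --> \oo] --> (\int[Q]_x (F (x + z)%R)%:E + c%:E)%E.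
    by apply: cvgeD => //; [rewrite fin_num_adde_defl|exact: cvg_cst].
  rewrite -(cvg_lim (@ereal_hausdorff R) W1) -(cvg_lim (@ereal_hausdorff R) W3).
  apply: lee_lim; [by apply/cvg_ex; eexists; exact: W1|by apply/cvg_ex; eexists; exact: W3|].
  by apply: nearW => k; exact: TP1.
have Dle (P' : probability M R) y : (mollified P' eta y <= B%:E)%E.
  apply: (@le_trans _ _ (\int[P']_x (cst B%:E x))%E).
    by apply: ge0_le_integral_nonmeas => x; rewrite lee_fin.
  by rewrite integral_cst//= probability_setT mule1.
have Dfin (P' : probability M R) y : mollified P' eta y \is a fin_num.
  by rewrite ge0_fin_numE ?mollified_ge0// (le_lt_trans (Dle P' y)) ?ltry.
pose d (P' : probability M R) y := fine (mollified P' eta y).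
have dE (P' : probability M R) y : (mollified P' eta y = (d P' y)%:E)%E by rewrite /d fineK.
have d0 (P' : probability M R) y : 0 <= d P' y by rewrite fine_ge0// mollified_ge0.
have mD (P' : probability M R) : measurable_fun setT (mollified P' eta) by exact: measurable_mollified.
have md (P' : probability M R) : measurable_fun setT (d P').
  by apply/measurable_EFinP; apply: eq_measurable_fun (mD P') => y _; rewrite dE.
have id (P' : probability M R) : mu.-integrable setT (EFin \o d P').
  apply/integrableP; split; first exact/measurable_EFinP.
  rewrite (eq_integral (mollified P' eta)) ?integral_mollified1 ?ltry// => y _.
  by rewrite dE /= ger0_norm.
(* A one-sided Scheffe argument: the positive part of the gap stays below the fixed integrable
   function [d Q], so pointwise convergence suffices. *)
pose h k y := Num.max (d Q y - d (P k) y) 0.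
have h0 k y : 0 <= h k y by rewrite /h le_max lexx orbT.
have mh k : measurable_fun setT (h k).
  by apply: measurable_maxr; [exact: measurable_funB|exact: measurable_cst].
have hle k y : h k y <= d Q y by rewrite /h ge_max d0 andbT lerBlDr lerDl.
have hcvg y : h k y @[k --> \oo] --> (0 : R).
  (* For fixed [y], the function [eta (y - x)] of [x] is bounded and continuous, so weak convergence
     applies to it. *)
  have Wy : mollified (P k) eta y @[k --> \oo] --> mollified Q eta y.
    apply: (W (fun x : M => eta (y - x))).
      have cs : continuous (fun x : M => eta (x + y)).
        by move=> x; exact: (cvg_comp _ _ (cvgD cvg_id (cvg_cst _)) (ceta _)).
      rewrite (_ : (fun x : M => _) = (fun x => eta (x + y)) \o -%R); last first.
        by apply/funext => x; rewrite /= addrC.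
      by move=> x; apply: continuous_comp; [exact: opp_continuous|exact: cs].
    by exists B => x; rewrite ger0_norm.
  have dy : d (P k) y @[k --> \oo] --> d Q y by apply: fine_cvg; rewrite -dE.
  have h1 : d Q y - d (P k) y @[k --> \oo] --> (0 : R).
    by rewrite -(subrr (d Q y)); apply: cvgB => //; exact: cvg_cst.
  apply/cvgrPdist_le => t t0; move/cvgrPdist_le : h1 => /(_ t t0); apply: filterS => k.
  rewrite !sub0r !normrN (ger0_norm (h0 k y)) /h ge_max (ltW t0) andbT.
  by move=> H; rewrite (le_trans (ler_norm _)).
have [|||||_ _] := @dominated_convergence _ _ _ mu setT measurableT
   (fun k y => (h k y)%:E) (fun=> 0%:E) (fun y => (d Q y)%:E).
- by move=> k; exact/measurable_EFinP.
- exact: measurable_cst.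
- by apply: aeW => y _; apply: cvg_EFin; [exact: nearW|exact: hcvg].
- exact: id.
- by apply: aeW => y k _; rewrite abse_EFin lee_fin ger0_norm.
rewrite integral0 => /fine_cvgP[fin_s /cvgrPdist_le /(_ c c0) s_le].
near=> k.
have sk : (\int[mu]_y (h k y)%:E <= c%:E)%E.
  have f1 : (\int[mu]_y (h k y)%:E)%E \is a fin_num by near: k.
  rewrite -[X in (X <= _)%E]fineK// lee_fin.
  have : `|fine (0 : \bar R) - fine (\int[mu]_y (h k y)%:E)%E| <= c by near: k.
  by rewrite sub0r normrN => /(le_trans (ler_norm _)).
apply: measure_le_of_unit_continuous => F uF.
have mF := continuous_measurable_mx uF.1.
have F0 x : 0 <= F x by have /andP[] := uF.2 x.
have F1 x : F x <= 1 by have /andP[] := uF.2 x.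
have s1 := @le_integral_mollified _ _ _ Q eta meta eta0 eta1 F c mF F0 (ltW c0) (fun z ez => TQ F z uF ez).
have s3 := @integral_mollified_le _ _ _ (P k) eta meta eta0 eta1 F c mF F0 (ltW c0) (fun z ez => TP2 k F z mF uF.2 ez).
(* As [0 <= F <= 1], the gap between the densities weighted by [F] is at most its positive part
   [h k]. *)
have s2 : (\int[mu]_y ((F y)%:E * mollified Q eta y) <= \int[mu]_y ((F y)%:E * mollified (P k) eta y) + \int[mu]_y (h k y)%:E)%E.
  have mF1 (P' : probability M R) : measurable_fun setT (fun y => (F y)%:E * mollified P' eta y)%E.
    by apply: emeasurable_funM => //; exact/measurable_EFinP.
  have F10 (P' : probability M R) y : [set: M] y -> (0 <= (F y)%:E * mollified P' eta y)%E.
    by move=> _; rewrite mule_ge0 ?lee_fin ?mollified_ge0.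
  have mh1 : measurable_fun setT (EFin \o h k) by exact/measurable_EFinP.
  have h10 y : [set: M] y -> (0 <= (EFin \o h k) y)%E by move=> _; rewrite lee_fin.
  rewrite -(ge0_integralD _ measurableT (F10 (P k)) (mF1 (P k)) h10 mh1).
  apply: ge0_le_integral_nonmeas => y; first by rewrite mule_ge0 ?lee_fin ?mollified_ge0.
  rewrite !dE -!EFinM -EFinD lee_fin -lerBlDl -mulrBr.
  have hd : d Q y - d (P k) y <= h k y by rewrite /h le_max lexx.
  by rewrite (le_trans (ler_wpM2l (F0 y) hd))// ler_piMl.
apply: (le_trans s1); apply: (le_trans (leeD s2 (lexx _))).
apply: (le_trans (leeD (leeD s3 sk) (lexx _))).
rewrite (_ : e%:E = c%:E + c%:E + c%:E)%E; first by rewrite !addeA.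
by rewrite -!EFinD; congr (_%:E); rewrite /c; field.
Unshelve. all: by end_near. Qed.

End total_variation.

(** Both masses are 1, so the inequality for the complement bounds the difference from the other
    side. *)
Lemma tv_distance_cvg0 {R : realType} n (P : nat -> probability 'rV[R]_n R) (Q : probability 'rV[R]_n R) :
  (forall e : R, 0 < e -> \forall k \near \oo, forall A, measurable A -> (Q A <= P k A + e%:E)%E) ->
  tv_distance (P k) Q @[k --> \oo] --> 0%E.
Proof.
move=> H.
have key k (e : R) : (forall A, measurable A -> (Q A <= P k A + e%:E)%E) -> (0 <= tv_distance (P k) Q <= e%:E)%E.
  move=> He; apply/andP; split.
    apply: (@le_trans _ _ `|P k set0 - Q set0|%E); first exact: abse_ge0.
    by apply: ereal_sup_ubound; exists set0.
  apply: ge_ereal_sup => _ [A mA <-].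
  have h1 := He _ mA; have h2 := He _ (measurableC mA).
  have fP B : measurable B -> P k B \is a fin_num by move=> mB; exact: fin_num_measure.
  have fQ B : measurable B -> Q B \is a fin_num by move=> mB; exact: fin_num_measure.
  rewrite !probability_setC// in h2.
  move: h1 h2; rewrite -[P k A]fineK ?fP// -[Q A]fineK ?fQ//.
  move: (fine _) (fine _) => p q; rewrite -!EFinB -!EFinD !lee_fin => h1 h2.
  by rewrite ler_norml; apply/andP; split; lra.
apply/fine_cvgP; split.
  apply: filterS (H 1 ltr01) => k /key /andP[h0 h1].
  by rewrite ge0_fin_numE// (le_lt_trans h1)// ltry.
apply/cvgrPdist_le => e e0; apply: filterS (H e e0) => k /key /andP[h0 h1].
rewrite sub0r normrN ger0_norm ?fine_ge0//= -lee_fin fineK//.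
by rewrite ge0_fin_numE// (le_lt_trans h1)// ltry.
Qed.

(** * The one-particle marginal *)

Section probability_of_measure.
Context d (T : measurableType d) (R : realType) (mu : {measure set T -> \bar R}).

(** Bundles a measure with its mass, so that a bare set function such as [density_law f] can be
    identified with a [probability]. *)
Definition probability_of_measure of mu setT = 1%E : set T -> \bar R := mu.

Variable mu1 : mu setT = 1%E.

HB.instance Definition _ := Measure.on (probability_of_measure mu1).

HB.instance Definition _ :=
  Measure_isProbability.Build _ _ _ (probability_of_measure mu1) mu1.

End probability_of_measure.

Section marginal.
Context {R : realType}.

Lemma min_le_average (I : finType) (k : I -> R) (C : R) : (0 < #|I|)%N ->
  \sum_i k i <= C * #|I|%:R -> exists i, k i <= C.
Proof.
move=> /card_gt0P[i0 _] H; apply: contrapT => /forallNP hC.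
have : \sum_(i : I) C < \sum_i k i.
  apply: ltr_sum; first by apply/hasP; exists i0; rewrite ?mem_index_enum.
  by move=> i _; rewrite ltNge; apply/negP; exact: hC.
by rewrite sumr_const -mulr_natr ltNge H.
Qed.

Lemma lee_sum_term (I : finType) (f : I -> \bar R) i : (forall j, (0 <= f j)%E) ->
  (f i <= \sum_j f j)%E.
Proof.
move=> f0; rewrite (bigD1 i)//=; apply: leeDl; apply: sume_ge0 => j _; exact: f0.
Qed.

Variables (N : nat) (Psi : 'M[R]_(N.+1, 3) -> R) (C : R).
Local Notation mu := (@lebesgue_mx R N.+1 3).
Hypotheses (cPsi : continuous Psi)
  (dPsi : forall (ij : 'I_N.+1 * 'I_3) x, derivable Psi x (delta_mx ij.1 ij.2))
  (cpPsi : forall ij, continuous (partial ij Psi))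
  (symPsi : permutation_symmetric (real_wave Psi))
  (normPsi : (\int[mu]_x (Psi x ^+ 2)%:E = 1)%E)
  (C0 : 0 <= C)
  (kinPsi : (\sum_ij \int[mu]_x (partial ij Psi x ^+ 2)%:E <= (C * N.+1%:R)%:E)%E).

Let mPsi : measurable_fun setT Psi := continuous_measurable_mx cPsi.

(** The transposition of [i] and [ord0] preserves Lebesgue measure and, almost everywhere, [Psi]. *)
Lemma integral_row_symmetric (F : 'rV[R]_3 -> R) i : measurable_fun setT F -> (forall x, 0 <= F x) ->
  (\int[mu]_x (Psi x ^+ 2 * F (row i x))%:E = \int[mu]_x (Psi x ^+ 2 * F (row ord0 x))%:E)%E.
Proof.
move=> mF F0.
have mFr k : measurable_fun setT (fun x : 'M[R]_(N.+1, 3) => F (row k x)).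
  exact: (measurableT_comp mF (measurable_row k)).
have mint k : measurable_fun setT (fun x : 'M[R]_(N.+1, 3) => (Psi x ^+ 2 * F (row k x))%:E).
  by apply/measurable_EFinP; apply: measurable_funM => //; exact: measurable_funX.
pose s := tperm i ord0.
rewrite -[RHS](ge0_integral_row_perm s) => [|//|x]; last by rewrite lee_fin mulr_ge0 ?sqr_ge0.
apply: ae_eq_integral => //.
  exact: (measurableT_comp (mint ord0) (measurable_row_perm s)).
apply: filterS (symPsi s) => x; rewrite /real_wave => /(congr1 (@complex.Re R)) /= -> _.
by congr (_ * F _)%:E; apply/rowP => j; rewrite !mxE tpermR.
Qed.

(** After the change of variables [x + t *: E] both integrals contain the same value of [F], which
    lies in [[0, 1]], and only the densities differ; [translation_estimate] controls them, its
    summand 1 being the mass of [Psi ^+ 2]. *)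
Lemma row_translation (F : 'rV[R]_3 -> R) i j (t : R) : measurable_fun setT F -> (forall x, 0 <= F x <= 1) ->
  (\int[mu]_x (Psi x ^+ 2 * F (row i x))%:E <=
   \int[mu]_x (Psi x ^+ 2 * F (row i x + t *: delta_mx ord0 j)%R)%:E +
   (`|t|)%:E * (1 + \int[mu]_x (partial (i, j) Psi x ^+ 2)%:E))%E.
Proof.
move=> mF F01.
have F0 x : 0 <= F x by have /andP[] := F01 x.
have F1 x : F x <= 1 by have /andP[] := F01 x.
set E := delta_mx i j : 'M[R]_(N.+1, 3).
have rowE x : row i (x + t *: E) = row i x + t *: delta_mx ord0 j.
  by apply/rowP => k; rewrite !mxE !eqxx.
have mP2 : measurable_fun setT (fun x => Psi x ^+ 2) by exact: measurable_funX.
have mFr : measurable_fun setT (fun x : 'M[R]_(N.+1, 3) => F (row i x)).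
  exact: (measurableT_comp mF (measurable_row i)).
have mFt : measurable_fun setT (fun x : 'M[R]_(N.+1, 3) => F (row i x + t *: delta_mx ord0 j)).
  exact: (measurableT_comp mF (measurableT_comp (measurable_mx_shift _) (measurable_row i))).
have mdiff : measurable_fun setT (fun x : 'M[R]_(N.+1, 3) => `|Psi (x + t *: E) ^+ 2 - Psi x ^+ 2|).
  apply: measurableT_comp => //; apply: measurable_funB => //.
  exact: (measurableT_comp mP2 (measurable_mx_shift _)).
have mp2 : measurable_fun setT (fun x => partial (i, j) Psi x ^+ 2).
  by apply: measurable_funX; exact: continuous_measurable_mx.
have TE := @translation_estimate R N.+1 3 Psi (i, j) t cPsi (@dPsi (i, j)) (@cpPsi (i, j)).
rewrite -[X in (X <= _)%E](ge0_integral_mx_shift (t *: E)) => [|/=|x]; last 2 first.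
- by apply/measurable_EFinP; exact: measurable_funM.
- by rewrite lee_fin mulr_ge0 ?sqr_ge0.
apply: (@le_trans _ _ (\int[mu]_x (Psi x ^+ 2 * F (row i x + t *: delta_mx ord0 j)%R + `|Psi (x + t *: E)%R ^+ 2 - Psi x ^+ 2|)%:E)%E).
  apply: ge0_le_integral_nonmeas => x; rewrite lee_fin; first by rewrite mulr_ge0 ?sqr_ge0.
  rewrite rowE -lerBlDl -mulrBl (le_trans (ler_norm _))// normrM ler_piMr// ger0_norm//.
under eq_integral do rewrite EFinD.
have mPF : measurable_fun setT (fun x => (Psi x ^+ 2 * F (row i x + t *: delta_mx ord0 j))%:E).
  by apply/measurable_EFinP; exact: measurable_funM.
have PF0 (x : 'M[R]_(N.+1, 3)) : [set: 'M[R]_(N.+1, 3)] x -> (0 <= (Psi x ^+ 2 * F (row i x + t *: delta_mx ord0 j)%R)%:E)%E.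
  by move=> _; rewrite lee_fin mulr_ge0 ?sqr_ge0.
have md0 (x : 'M[R]_(N.+1, 3)) : [set: 'M[R]_(N.+1, 3)] x -> (0 <= (`|Psi (x + t *: E)%R ^+ 2 - Psi x ^+ 2|)%:E)%E.
  by move=> _; rewrite lee_fin.
rewrite (ge0_integralD _ measurableT PF0 mPF md0 ((measurable_EFinP _ _).2 mdiff)).
apply: leeD => //; apply: (le_trans TE).
rewrite lee_wpmul2l ?lee_fin//; under eq_integral do rewrite EFinD.
rewrite ge0_integralD ?normPsi//.
- by move=> x _; rewrite lee_fin sqr_ge0.
- exact/measurable_EFinP.
- by move=> x _; rewrite lee_fin sqr_ge0.
- exact/measurable_EFinP.
Qed.

(** Symmetry carries the estimate for row [i] to the first row, so any particle of small kinetic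
    energy will do, and it may change with [j]. *)
Lemma marginal_translation1 (F : 'rV[R]_3 -> R) j (t : R) : measurable_fun setT F -> (forall x, 0 <= F x <= 1) ->
  (\int[mu]_x (Psi x ^+ 2 * F (row ord0 x))%:E <=
   \int[mu]_x (Psi x ^+ 2 * F (row ord0 x + t *: delta_mx ord0 j)%R)%:E + ((1 + C) * `|t|)%:E)%E.
Proof.
move=> mF F01.
have F0 x : 0 <= F x by have /andP[] := F01 x.
pose K ij := (\int[mu]_x (partial ij Psi x ^+ 2)%:E)%E.
have K0 ij : (0 <= K ij)%E by apply: integral_ge0 => x _; rewrite lee_fin sqr_ge0.
have Kfin ij : K ij \is a fin_num.
  rewrite ge0_fin_numE// (le_lt_trans _ (le_lt_trans kinPsi (ltry _)))//.
  exact: (@lee_sum_term _ K).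
(* The kinetic energy in all directions averages to at most [C] per particle, hence that in the
   direction [j] does so too. *)
have [i Ki] : exists i, fine (K (i, j)) <= C.
  apply: min_le_average; rewrite ?card_ord// -lee_fin; apply: le_trans kinPsi.
  rewrite -sumEFin; under eq_bigr do rewrite fineK//.
  rewrite -(pair_bigA _ (fun i j => K (i, j))) /=; apply: lee_sum => i _.
  exact: (@lee_sum_term _ (fun j => K (i, j))).
rewrite -(integral_row_symmetric i mF F0).
rewrite -(@integral_row_symmetric (fun y => F (y + t *: delta_mx ord0 j)) i); last 2 first.
- exact: (measurableT_comp mF (measurable_mx_shift _)).
- by move=> x; exact: F0.
apply: (le_trans (row_translation i j t mF F01)); rewrite leeD2l//.
by rewrite mulrC EFinM lee_wpmul2l ?lee_fin// EFinD leeD2l// -/(K (i, j)) -[K _]fineK// lee_fin.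
Qed.

Lemma marginal_translation (F : 'rV[R]_3 -> R) (z : 'rV[R]_3) : measurable_fun setT F -> (forall x, 0 <= F x <= 1) ->
  (\int[mu]_x (Psi x ^+ 2 * F (row ord0 x))%:E <=
   \int[mu]_x (Psi x ^+ 2 * F (row ord0 x + z)%R)%:E + ((1 + C) * \sum_i \sum_j `|z i j|)%:E)%E.
Proof.
move=> mF F01; rewrite big_ord1 {1}[z]row_sum_delta.
(* [F] varies in the induction: the shift along each coordinate is absorbed into it. *)
elim: (index_enum 'I_3) F mF F01 => [|j s IH] F mF F01.
  rewrite !big_nil mulr0 adde0; under [leRHS]eq_integral do rewrite addr0.
  exact: lexx.
rewrite !big_cons.
have := marginal_translation1 j (z ord0 j) mF F01; move=> /le_trans; apply.
have := IH (fun y => F (y + z ord0 j *: delta_mx ord0 j)) (measurableT_comp mF (measurable_mx_shift _)) (fun x => F01 _).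
move=> H; apply: (le_trans (leeD H (lexx _))).
rewrite -addeA -EFinD -mulrDr [_ + `|z _ _|]addrC; under eq_integral do rewrite -addrA [_ + _ *: delta_mx _ _]addrC.
exact: lexx.
Qed.

End marginal.

(** * The laws as probability measures, and the theorem *)

Section laws.
Context {R : realType} {m n : nat}.

Lemma integral_first_marginal (f : 'M[R]_(m.+1, n) -> R) (mf : measurable_fun setT f)
    (f0 : forall x, 0 <= f x) (F : 'rV[R]_n -> R) : measurable_fun setT F -> (forall x, 0 <= F x) ->
  (\int[first_marginal (density_law f)]_x (F x)%:E = \int[lebesgue_mx]_x (f x * F (row ord0 x))%:E)%E.
Proof.
move=> mF F0; rewrite -[density_law f]/(density_measure lebesgue_mx mf f0 : set _ -> _) /first_marginal.
rewrite (ge0_integral_pushforward (measurable_row ord0))//; last 2 first.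
- exact/measurable_EFinP.
- by move=> y _; rewrite lee_fin.
rewrite ge0_integral_density_measure//.
- by apply: eq_integral => x _; rewrite /= -EFinM mulrC.
- by apply/measurable_EFinP; exact: (measurableT_comp mF (measurable_row ord0)).
- by move=> x; rewrite lee_fin.
Qed.

Lemma first_marginal_probability (f : 'M[R]_(m.+1, n) -> R) : measurable_fun setT f ->
  (forall x, 0 <= f x) -> (\int[lebesgue_mx]_x (f x)%:E = 1)%E ->
  exists P : probability 'rV[R]_n R, first_marginal (density_law f) = P.
Proof.
move=> mf f0 f1.
pose Pm : {measure set 'rV[R]_n -> \bar R} :=
  @measure_function_pushforward__canonical__measure_function_Measure _ _ _ _ _
    (density_measure lebesgue_mx mf f0) (row ord0) (measurable_row ord0).
have H : Pm setT = 1%E by rewrite -[LHS]/(\int[lebesgue_mx]_x (f x)%:E)%E.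
by exists (probability_of_measure H).
Qed.

Lemma density_law_probability (f : 'M[R]_(m, n) -> R) : measurable_fun setT f ->
  (forall x, 0 <= f x) -> (\int[lebesgue_mx]_x (f x)%:E = 1)%E ->
  exists P : probability 'M[R]_(m, n) R, density_law f = P.
Proof.
move=> mf f0 f1; have H : density_measure lebesgue_mx mf f0 setT = 1%E by [].
by exists (probability_of_measure H).
Qed.

Lemma normalized_real_wave (psi : 'M[R]_(m, n) -> R) : normalized (real_wave psi) ->
  measurable_fun setT psi /\ (\int[lebesgue_mx]_x (psi x ^+ 2)%:E = 1)%E.
Proof.
move=> [mRe _ n1]; split; first exact: mRe.
by rewrite -n1; apply: eq_integral => x _; rewrite normsq_real.
Qed.

End laws.

Theorem theorem5p14 (R : realType)
  (V : 'rV[R]_3 -> R) (g : R) (v1 : 'rV[R]_3 -> R)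
  (Psi : forall k : nat, 'M[R]_(k.+2, 3) -> R) (phiGP : 'rV[R]_3 -> R)
  (V_measurable : measurable_fun setT V)
  (V_bounded : locally_bounded V)
  (V_ge0 : forall x, 0 <= V x)
  (V_infty : V x @[x --> at_infinity] --> +oo)
  (g_gt0 : 0 < g)
  (v1_ge0 : forall x, 0 <= v1 x)
  (v1_smooth : smooth v1)
  (v1_compact : compactly_supported v1)
  (v1_radial : spherically_symmetric v1)
  (v1_length : scattering_length v1 1)
  (Psi_ground : forall k, ground_state V (gp_potential v1 g k.+2) (Psi k))
  (phiGP_min : gp_minimizer V g phiGP)
  (chaos : entropy_chaotic (fun k x => Psi k x ^+ 2) (fun x => phiGP x ^+ 2)) :
  tv_distance (first_marginal (density_law (fun x => Psi k x ^+ 2)))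
              (density_law (fun x => phiGP x ^+ 2)) @[k --> \oo] --> 0%E.
Proof.
have [C C0 kin] := kinetic_energy_le V_bounded V_ge0 g_gt0 v1_ge0 v1_smooth v1_compact.
have nPsi k : normalized (real_wave (Psi k)) by have [[[]]] := Psi_ground k.
have sPsi k : permutation_symmetric (real_wave (Psi k)) by have [[[]]] := Psi_ground k.
have CkPsi k : is_Ck 1 (Psi k) by have [] := Psi_ground k.
have mPsi2 k : measurable_fun setT (fun x => Psi k x ^+ 2).
  by apply: measurable_funX; have [] := normalized_real_wave (nPsi k).
have Psi20 k x : 0 <= Psi k x ^+ 2 by exact: sqr_ge0.
have Psi21 k := (normalized_real_wave (nPsi k)).2.
(* The laws are bare set functions; they are replaced by genuine probabilities [P k] and [Q]. *)
have /choice[P PE] k := first_marginal_probability (mPsi2 k) (Psi20 k) (Psi21 k).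
have [[nphi _] _] := phiGP_min.
have [mphi phi1] := normalized_real_wave nphi.
have [Q QE] := density_law_probability (measurable_funX 2 mphi) (fun x => sqr_ge0 (phiGP x)) phi1.
have [W _] := chaos.
rewrite QE (_ : (fun k => _) = fun k => tv_distance (P k) Q); last first.
  by apply/funext => k; rewrite PE.
(* [1 + C] is the mass of [Psi ^+ 2] plus the bound on the kinetic energy per particle. *)
apply: tv_distance_cvg0; apply: (@measure_le_near _ _ _ _ _ (1 + C)).
- by rewrite addr_ge0.
- move=> k F mF F01 z; have F0 x : 0 <= F x by have /andP[] := F01 x.
  rewrite -PE !integral_first_marginal//.
    (* The lemma counts [N.+1] particles and there are [k.+2], hence [k.+1]. *)
    apply: (@marginal_translation _ k.+1 (Psi k) C) => //.
    + by have [] := @Ck1P _ _ _ _ (ord0, ord0) (CkPsi k).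
    + by move=> ij; have [] := @Ck1P _ _ _ _ ij (CkPsi k).
    + by move=> ij; have [] := @Ck1P _ _ _ _ ij (CkPsi k).
    + exact: kin (Psi_ground k).
  exact: (measurableT_comp mF (measurable_mx_shift z)).
- move=> f cf bf; have := W f cf bf; rewrite QE.
  by under eq_fun do rewrite PE.
Qed.
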